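(* Assume the setting below, and suppose in addition that $\inf H>0$, that $d(T_tx,T_{t'}x)\le C|t-t'|^\eta$ for all $t,t'\ge0$, $x\in M$, and that $\mu_Y(H>n)=O(n^{-\beta})$ for some $\beta>1$. For $v\in C_0^\eta(M,\mathbb R^d)$ define $v_t=\int_0^tv\circ T_s\,ds$ and $S_t=\int_0^t\int_0^s(v\circ T_r)\otimes(v\circ T_s)\,dr\,ds$. (a) Let $2<p<\beta$. There is $C>0$ such that $|v_t|_{2(p-1)}\le Ct^{1/2}\|v\|_\eta$ for all $v\in C_0^\eta(M,\mathbb R^d)$, $t>0$. (b) Let $4<p<\beta$. There is $C>0$ such that $|S_t|_{2(p-1)/3}\le Ct\|v\|_\eta^2$ for all $v\in C_0^\eta(M,\mathbb R^d)$, $t>0$.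
   Context: Setting (nonuniformly expanding semiflow). Let $(M,d)$ be a bounded metric space, $Y\subset X\subset M$ Borel subsets and $T_t:M\to M$ a measurable semiflow. Let $h:X\to(0,\infty)$ be such that $f(x)=T_{h(x)}x$ defines $f:X\to X$, and $\tau:Y\to\mathbb Z^+$ such that $F(y)=f^{\tau(y)}y$ defines $F:Y\to Y$. Let $\mu_0$ be a finite Borel measure on $X$ with $\mu_0(Y)>0$, $f$ nonsingular and ergodic for $\mu_0$, $\tau\in L^1$. There is an at most countable measurable partition $\{Y_j\}$ of $Y$ with $\tau$ constant on each $Y_j$, and constants $\lambda>1$, $C\ge1$, $\eta\in(0,1]$ such that for all $j$: (1) $F$ restricts to a measure-theoretic bijection from $Y_j$ onto $Y$; (2) $d(Fy,Fy')\ge\lambda d(y,y')$ for $y,y'\in Y_j$; (3) $\zeta_0=\frac{d\mu_0|_Y}{d\mu_0|_Y\circ F}$ satisfies $|\log\zeta_0(y)-\log\zeta_0(y')|\le Cd(Fy,Fy')^\eta$ for $y,y'\in Y_j$. Let $\mu_Y$ be the unique ergodic $F$-invariant probability measure on $Y$ absolutely continuous w.r.t. $\mu_0$. With $\bar\tau=\int\tau\,d\mu_Y$, let $\mu_X=\pi_*\mu^\tau$, where $\mu^\tau=(\mu_Y\times\text{counting})/\bar\tau$ on $\{(y,\ell):0\le\ell\le\tau(y)-1\}$ and $\pi(y,\ell)=f^\ell y$. Assume $h\in L^1(\mu_X)$ and let $\mu_M$ be the image of $(\mu_X\times\text{Lebesgue})/\int h\,d\mu_X$ on $\{(x,u):0\le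 u\le h(x)\}$ under $(x,u)\mapsto T_ux$. The separation time $s(y,y')$ is the least $n\ge0$ with $F^ny,F^ny'$ in distinct $Y_j$; $d_\theta(y,y')=\theta^{s(y,y')}$. The induced roof function is $H(y)=\sum_{\ell=0}^{\tau(y)-1}h(f^\ell y)$. Assume there are $\theta\in(0,1)$ and $C\ge1$ such that for all $j$: $\sup_{y\ne y'\in Y_j}|H(y)-H(y')|/d_\theta(y,y')\le C\inf_{Y_j}H$, and $d(T_ty,T_ty')\le C\theta^{s(y,y')}$ for $y,y'\in Y_j$, $t\in[0,H(y)]\cap[0,H(y')]$. For $v:M\to\mathbb R^d$, $\|v\|_\eta=|v|_\infty+\sup_{x\ne x'}|v(x)-v(x')|/d(x,x')^\eta$; $C_0^\eta(M,\mathbb R^d)$ is the set of $v$ with $\|v\|_\eta<\infty$ and $\int v\,d\mu_M=0$. $a\otimes b=ab^T$. Norms $|\cdot|_q$ in the conclusions are on $L^q(M,\mu_M)$. *)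

(* Defs.v *)
From HB Require Import structures.
From mathcomp Require Import all_boot all_order all_algebra.
From mathcomp Require Import all_classical all_reals all_analysis.
Set Implicit Arguments. Unset Strict Implicit. Unset Printing Implicit Defensive.
Import Order.TTheory GRing.Theory Num.Theory.
Import numFieldNormedType.Exports.
Local Open Scope classical_set_scope.
Local Open Scope ring_scope.

Section Defs.
Context {R : realType} {dM : measure_display} {M : measurableType dM}.

Definition is_metric (dist : M -> M -> R) : Prop :=
  [/\ (forall x y, 0 <= dist x y), (forall x y, dist x y = 0 <-> x = y),
      (forall x y, dist x y = dist y x) &
      (forall x y z, dist x z <= dist x y + dist y z)].

Definition bounded_metric (dist : M -> M -> R) : Prop :=
  exists B : R, forall x y, dist x y <= B.

Definition dopen (dist : M -> M -> R) (U : set M) : Prop :=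
  forall x, U x -> exists e : R, 0 < e /\ [set y | dist x y < e] `<=` U.

Definition borel_wrt (dist : M -> M -> R) : Prop :=
  forall A : set M, measurable A <-> <<s [set U | dopen dist U] >> A.

Definition is_semiflow (T : R -> M -> M) : Prop :=
  [/\ (forall x, T 0 x = x),
      (forall s t x, 0 <= s -> 0 <= t -> T (s + t) x = T s (T t x)) &
      measurable_fun [set p : R * M | 0 <= p.1] (fun p => T p.1 p.2)].

Definition flowf (T : R -> M -> M) (h : M -> R) (x : M) : M := T (h x) x.
Definition indF (T : R -> M -> M) (h : M -> R) (tau : M -> nat) (y : M) : M :=
  iter (tau y) (flowf T h) y.
Definition Hroof (T : R -> M -> M) (h : M -> R) (tau : M -> nat) (y : M) : R :=
  \sum_(l < tau y) h (iter l (flowf T h) y).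

Definition is_partition (Y : set M) (I : set nat) (Yj : nat -> set M) : Prop :=
  [/\ (forall j, I j -> measurable (Yj j) /\ Yj j `<=` Y),
      (forall i j, I i -> I j -> i <> j -> Yj i `&` Yj j = set0) &
      Y = \bigcup_(j in I) Yj j].

Definition same_piece (I : set nat) (Yj : nat -> set M) (a b : M) : Prop :=
  exists j, [/\ I j, Yj j a & Yj j b].

Lemma sep_exists (Q : nat -> Prop) :
  (exists n, ~ Q n) -> exists n, `[< ~ Q n >].
Proof. by move=> [n Hn]; exists n; apply/asboolP. Qed.

(** separation time s(y,y') (None = infinity) *)
Definition sep_time (F : M -> M) (I : set nat) (Yj : nat -> set M) (y y' : M)
  : option nat :=
  match pselect (exists n, ~ same_piece I Yj (iter n F y) (iter n F y')) with
  | left e => Some (ex_minn (sep_exists e))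
  | right _ => None
  end.

Definition dtheta (theta : R) (F : M -> M) (I : set nat) (Yj : nat -> set M)
  (y y' : M) : R :=
  match sep_time F I Yj y y' with Some n => theta ^+ n | None => 0 end.

Definition nonsingular_on (mu : set M -> \bar R) (X : set M) (f : M -> M) :=
  forall A, measurable A -> A `<=` X ->
    (mu A = 0%E <-> mu (X `&` f @^-1` A) = 0%E).

Definition ergodic_on (mu : set M -> \bar R) (X : set M) (f : M -> M) :=
  forall A, measurable A -> A `<=` X -> X `&` f @^-1` A = A ->
    mu A = 0%E \/ mu (X `\` A) = 0%E.

Definition invariant_on (mu : set M -> \bar R) (X : set M) (f : M -> M) :=
  forall A, measurable A -> A `<=` X -> mu (X `&` f @^-1` A) = mu A.

Definition gibbs_markov (dist : M -> M -> R) (mu0 : {measure set M -> \bar R})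
  (Y : set M) (F : M -> M) (tau : M -> nat) (I : set nat) (Yj : nat -> set M)
  (lam C eta : R) : Prop :=
  [/\ is_partition Y I Yj,
      (forall j, I j -> exists k, forall y, Yj j y -> tau y = k),
      (* (1) F : Y_j -> Y measure-theoretic bijection (injectivity follows from (2)) *)
      (forall j, I j ->
         (forall A, measurable A -> A `<=` Yj j -> measurable (F @` A)) /\
         mu0 (Y `\` F @` Yj j) = 0%E),
      (forall j, I j -> forall y y', Yj j y -> Yj j y' ->
         lam * dist y y' <= dist (F y) (F y')) &
      (* (3) zeta0 = d mu0|_Y / d (mu0|_Y o F), log-Holder on each Y_j *)
      exists zeta : M -> R,
        [/\ (forall y, Y y -> 0 < zeta y), measurable_fun Y zeta,
            (forall j, I j -> forall A, measurable A -> A `<=` Yj j ->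
               mu0 (F @` A) = (\int[mu0]_(y in A) ((zeta y)^-1)%:E)%E) &
            (forall j, I j -> forall y y', Yj j y -> Yj j y' ->
               `|ln (zeta y) - ln (zeta y')| <= C * dist (F y) (F y') `^ eta)]].

(** integral w.r.t. mu_X = pi_* mu^tau *)
Definition intX (muY : {measure set M -> \bar R}) (Y : set M) (tau : M -> nat)
  (f : M -> M) (phi : M -> \bar R) : \bar R :=
  ((\int[muY]_(y in Y) (\sum_(l < tau y) phi (iter l f y)))
   * ((fine (\int[muY]_(y in Y) ((tau y)%:R)%:E))^-1)%:E)%E.

(** integral w.r.t. mu_M, the image of (mu_X x Leb)/int h dmu_X on
    {(x,u): 0 <= u <= h x} under (x,u) |-> T_u x *)
Definition intM (muY : {measure set M -> \bar R}) (Y : set M) (tau : M -> nat)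
  (T : R -> M -> M) (h : M -> R) (g : M -> \bar R) : \bar R :=
  (intX muY Y tau (flowf T h)
     (fun x => \int[@lebesgue_measure R]_(u in `[0%R, h x]%classic) g (T u x))
   * ((fine (intX muY Y tau (flowf T h) (fun x => (h x)%:E)))^-1)%:E)%E.

(** L^q(mu_M) norm of a matrix-valued function (|.| = max norm on entries) *)
Definition LqM (muY : {measure set M -> \bar R}) (Y : set M) (tau : M -> nat)
  (T : R -> M -> M) (h : M -> R) (q : R) {m n : nat} (g : M -> 'M[R]_(m, n))
  : \bar R :=
  ((intM muY Y tau T h (fun x => (`|g x| `^ q)%:E)) `^ q^-1)%E.

Definition holder_norm (dist : M -> M -> R) (eta : R) {n : nat}
  (v : M -> 'rV[R]_n) : \bar R :=
  (ereal_sup ([set 0%E] `|` [set (`|v x|)%:E | x in [set: M]])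
   + ereal_sup ([set 0%E] `|`
       [set (`|v p.1 - v p.2| / dist p.1 p.2 `^ eta)%:E
          | p in [set p : M * M | p.1 <> p.2]]))%E.

Definition C0eta (dist : M -> M -> R) (eta : R) (muY : {measure set M -> \bar R})
  (Y : set M) (tau : M -> nat) (T : R -> M -> M) (h : M -> R) {n : nat}
  (v : M -> 'rV[R]_n) : Prop :=
  (holder_norm dist eta v < +oo)%E /\
  forall i : 'I_n, intM muY Y tau T h (fun x => (v x 0 i)%:E) = 0%E.

Definition vint (T : R -> M -> M) {n : nat} (v : M -> 'rV[R]_n) (t : R)
  (x : M) : 'rV[R]_n :=
  \row_i (\int[@lebesgue_measure R]_(s in `[0%R, t]%classic) v (T s x) 0 i).

Definition Sint (T : R -> M -> M) {n : nat} (v : M -> 'rV[R]_n) (t : R)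
  (x : M) : 'M[R]_n :=
  \matrix_(i, j) (\int[@lebesgue_measure R]_(s in `[0%R, t]%classic)
     (\int[@lebesgue_measure R]_(r in `[0%R, s]%classic) (v (T r x) 0 i * v (T s x) 0 j))).

End Defs.

(* Main.v *)
(** Idea. For a Hoelder observable [v] put [V y := \int_0^{H y} v (T_s y) ds] on [Y].
    Conditionally on the first [k] partition elements, [F ^ k] is distributed like the
    invariant measure up to bounded distortion, and a coupling argument turns this into
    exponentially small bounds for [E (V * (g \o F ^ k))] by [E g], for bounded [g].

    For times up to [t] only excursions with [H <= t] matter, so [V] may be replaced by
    its truncation to such excursions, whose mean is O(1/t).  Moments of the Birkhoff
    sums of the truncated [V], and of the iterated sums for part (b), are estimated by
    expanding [|x + y| ^ q] to second order along the orbit; this involves moments of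
    the truncated [H] alone, which are controlled by the tail: [E min(H, t) ^ q] is at
    most [t ^ (q - p) * E (H ^ p)].  A dyadic argument gives the running maxima.

    The integral over [M] is an integral over [Y] weighted by [H]. This weight is
    absorbed into the excursion containing the initial point, and is independent up to
    a constant factor of the orbit after the first return. *)
Require Import Defs.
From HB Require Import structures.
From mathcomp Require Import all_boot all_order all_algebra.
From mathcomp Require Import all_classical all_reals all_analysis.
From mathcomp Require Import measurable_realfun finmap ring lra.
Set Implicit Arguments.
Unset Strict Implicit.
Unset Printing Implicit Defensive.
Import Order.TTheory GRing.Theory Num.Theory.
Import numFieldNormedType.Exports.
Local Open Scope classical_set_scope.
Local Open Scope ring_scope.

(** * Powers of real numbers *)

(** The exponents come from the weight [H]. A truncated excursion is of order at most [t], so the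
    integral of [H * min(H,t)^q] is at most a multiple of [t^(q+1-p)] times the moment of order [p].
    For [q = 2(p-1)] this power of [t] is [q/2], exactly what (a) allows. The dyadic argument loses
    a little and hence needs a moment slightly above [p], which [p < beta] provides. In (b) one
    excursion contributes quadratically and calls for the exponent [2q]; with [q = 2(p-1)/3] the
    power [2q+1-p] is again [q/2], below the allowed [q].

    The obstacle is that truncation destroys the zero mean and makes the observable depend on [t].
    Moment bounds are therefore uniform: their constants are chosen before the probability space and
    depend on a few numbers only. The bias of the mean is harmless because at most a multiple of [t]
    returns occur before time [t], so the biases add up to a constant. Truncation is decided by the
    infimum of [H] on the partition element, not by [H] itself; this keeps truncated functions
    regular on cylinders, and still bounded. *)

Section PowerInequalities.
Context {R : realType}.
Implicit Types (a b q r x y z u L rho N : R).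

Lemma ler_powR2l r a b : 0 <= r -> 0 <= a -> a <= b -> a `^ r <= b `^ r.
Proof.
move=> r0 a0 ab; apply: ge0_ler_powR => //; rewrite nnegrE //.
exact: le_trans ab.
Qed.

Lemma powRS1 a r : 0 <= a -> 0 < r -> a `^ r = a * a `^ (r - 1).
Proof. by move=> a0 r0; rewrite mulr_powRB1. Qed.

Lemma powRS2 a r : 0 <= a -> 1 < r -> a `^ r = a ^+ 2 * a `^ (r - 2).
Proof.
move=> a0 r1; rewrite expr2 -mulrA powRS1 //; last lra.
rewrite (@powRS1 _ (r - 1)) //; last lra.
by congr (_ * (_ * _ `^ _)); lra.
Qed.

Lemma powRD_le q a b : 0 <= q -> 0 <= a -> 0 <= b ->
  (a + b) `^ q <= 2 `^ q * (a `^ q + b `^ q).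
Proof.
move=> q0 a0 b0.
have [ab|/ltW ba] := leP a b.
- apply: (@le_trans _ _ ((2 * b) `^ q)); first by apply: ler_powR2l; lra.
  rewrite powRM; [|lra..]; rewrite ler_wpM2l ?powR_ge0 //.
  by rewrite lerDr powR_ge0.
- apply: (@le_trans _ _ ((2 * a) `^ q)); first by apply: ler_powR2l; lra.
  rewrite powRM; [|lra..]; rewrite ler_wpM2l ?powR_ge0 //.
  by rewrite lerDl powR_ge0.
Qed.

(** The two summands are weighted unequally: the coefficient of [b] may be as close to 1 as desired,
    since in the dyadic argument it multiplies the main term at every doubling of the horizon. *)
Lemma powRD_le_weighted q rho : 0 < q -> 1 < rho ->
  exists2 C : R, 0 < C & forall a b, 0 <= a -> 0 <= b ->
    (a + b) `^ q <= rho * b `^ q + C * a `^ q.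
Proof.
move=> q0 rho1; have lnr : 0 < ln rho by exact: ln_gt0.
(* With this [e] one has [(1 + e)^q <= expR (q * e) = rho], which settles the case [a <= e * b]. *)
pose e := ln rho / q; have e0 : 0 < e by exact: divr_gt0.
have h1 : 0 < 1 + e^-1 by rewrite addr_gt0 // invr_gt0.
exists ((1 + e^-1) `^ q); first exact: powR_gt0.
move=> a b a0 b0; have [ab|ba] := leP a (e * b).
- apply: (@le_trans _ _ ((expR e * b) `^ q)).
    apply: ler_powR2l; [lra|lra|].
    have := ler_wpM2r b0 (expR_ge1Dx e); lra.
  rewrite powRM ?expR_ge0 // -expRM /e divfK ?gt_eqF // lnK ?posrE; last lra.
  by rewrite lerDl mulr_ge0 ?powR_ge0.
- apply: (@le_trans _ _ (((1 + e^-1) * a) `^ q)).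
    apply: ler_powR2l; [lra|lra|].
    rewrite mulrDl mul1r lerD2l ler_pdivlMl //; exact: ltW.
  by rewrite powRM ?(ltW h1) // lerDr mulr_ge0 ?powR_ge0 // ltW // (lt_trans _ rho1).
Qed.

(** For [u <= 1/2], inverting [1 - u <= expR (- u)] gives [1 + u + 2 * u ^+ 2]; for larger [u] the
    square is at least [1/4], and [4 * expR L * u ^+ 2] alone dominates. *)
Lemma expR_le_quadratic L : 0 <= L ->
  exists2 C : R, 0 < C & forall u, `|u| <= L -> expR u <= 1 + u + C * u ^+ 2.
Proof.
move=> L0; have eL := expR_gt0 L; exists (2 + 4 * expR L); first lra.
move=> u uL; have [u2|u2] := leP u 2^-1.
- have h := expR_ge1Dx (- u).
  have -> : expR u = (expR (- u))^-1 by rewrite expRN invrK.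
  have u1 : 0 < 1 - u by lra.
  apply: (@le_trans _ _ (1 - u)^-1); first by rewrite lef_pV2 ?posrE ?expR_gt0.
  rewrite -[leLHS]mul1r ler_pdivrMr //.
  have : 0 <= u ^+ 2 by exact: sqr_ge0.
  have : 0 <= u ^+ 2 * (1 - 2 * u).
    by apply: mulr_ge0; [exact: sqr_ge0|lra].
  have h2 : 0 <= expR L * u ^+ 2 * (1 - u).
    by apply: mulr_ge0; [apply: mulr_ge0; [exact: ltW|exact: sqr_ge0]|exact: ltW].
  nra.
- apply: (@le_trans _ _ (expR L)).
    by rewrite ler_expR (le_trans (ler_norm u)).
  have : 4^-1 <= u ^+ 2 by nra.
  nra.
Qed.

Lemma powR1D_expR z r : -1 < z -> (1 + z) `^ r = expR (r * ln (1 + z)).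
Proof. by move=> z1; rewrite /powR gt_eqF //; lra. Qed.

Lemma powR1D_le_expR z r : -1 < z -> 0 <= r -> (1 + z) `^ r <= expR (r * z).
Proof.
move=> z1 r0; rewrite powR1D_expR // ler_expR ler_wpM2l //.
by rewrite -[leRHS]expRK ler_ln ?posrE ?expR_gt0 ?expR_ge1Dx //; lra.
Qed.

Lemma powR1D_ge z r : `|z| <= 2^-1 -> 0 <= r ->
  1 - 2 * r * `|z| <= (1 + z) `^ r.
Proof.
move=> z2 r0; have z1 : -1 < z by move: z2; rewrite ler_norml; lra.
have z0 : 0 < 1 + z by lra.
have hln : - (2 * `|z|) <= ln (1 + z).
  rewrite -lerN2 opprK -lnV ?posrE //.
  rewrite -[leRHS]expRK ler_ln ?posrE ?invr_gt0 ?expR_gt0 //.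
  apply: le_trans (expR_ge1Dx _); rewrite -[leLHS]mulr1 ler_pdivrMl //.
  move: z2; rewrite ler_norml => /andP[z3 z4].
  have [zz|zz] := leP 0 z; [rewrite ger0_norm // | rewrite ltr0_norm //]; nra.
rewrite powR1D_expR //; apply: le_trans (expR_ge1Dx _).
have := ler_wpM2l r0 hln; lra.
Qed.

(* [signed_powR r x = |x|^(r-2) x] is, up to the factor [r], the derivative of [|x|^r]. *)
Definition signed_powR r x : R := `|x| `^ (r - 2) * x.

Lemma norm_signed_powR r x : 1 < r -> `|signed_powR r x| = `|x| `^ (r - 1).
Proof.
move=> r1; rewrite /signed_powR normrM (ger0_norm (powR_ge0 _ _)) mulrC.
rewrite (@powRS1 _ (r - 1)) //; last lra.
by congr (_ * _ `^ _); lra.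
Qed.

(** If [|x| <= 2 * |y|], every term is absorbed by the error terms. Otherwise [z = y / x] has
    modulus at most [1/2], and the quadratic bound for [expR (q * z)], which dominates [(1 + z)^q],
    is multiplied by [|x|^q]. *)
Lemma powR_norm_taylor q : 2 < q ->
  exists2 C : R, 0 < C & forall x y,
    `|x + y| `^ q <= `|x| `^ q + q * signed_powR q x * y
      + C * (`|x| `^ (q - 2) * y ^+ 2 + `|y| `^ q).
Proof.
move=> q2; have [|C1 C10 HC1] := @expR_le_quadratic (q * 2^-1); first lra.
have p3 := @powR_ge0 R 3 q.
exists (3 `^ q + 2 * q + C1 * q ^+ 2).
  by rewrite ltr_wpDr ?mulr_ge0 ?sqr_ge0 //; lra.
move=> x y; have yq := @powR_ge0 R `|y| q; have xq := @powR_ge0 R `|x| (q - 2).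
have y2 := sqr_ge0 y.
have c0 : 0 <= C1 * q ^+ 2 by rewrite mulr_ge0 ?sqr_ge0 //; lra.
have [xy|xy] := leP `|x| (2 * `|y|).
- have h1 : `|x + y| `^ q <= 3 `^ q * `|y| `^ q.
    rewrite -powRM //; apply: ler_powR2l => //; first lra.
    by apply: le_trans (ler_normD _ _) _; lra.
  have h2 : `|q * signed_powR q x * y| <= 2 * q * (`|x| `^ (q - 2) * y ^+ 2).
    rewrite /signed_powR !normrM (ger0_norm xq) (@ger0_norm _ q); last lra.
    rewrite -(real_normK (num_real y)).
    have -> : q * (`|x| `^ (q - 2) * `|x|) * `|y| =
      (q * `|x| `^ (q - 2) * `|y|) * `|x| by ring.
    have -> : 2 * q * (`|x| `^ (q - 2) * `|y| ^+ 2) =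
      (q * `|x| `^ (q - 2) * `|y|) * (2 * `|y|) by ring.
    by rewrite ler_wpM2l // !mulr_ge0 //; lra.
  have h3 : - (2 * q * (`|x| `^ (q - 2) * y ^+ 2)) <= q * signed_powR q x * y.
    by move: h2; rewrite ler_norml => /andP[].
  have h4 : 0 <= `|x| `^ q by exact: powR_ge0.
  have h5 : 0 <= `|x| `^ (q - 2) * y ^+ 2 by exact: mulr_ge0.
  nra.
- have x0 : x != 0 by rewrite -normr_gt0; have := normr_ge0 y; lra.
  pose z := y / x; have yE : y = x * z by rewrite /z mulrC divfK.
  have nx : 0 < `|x| by rewrite normr_gt0.
  have z2 : `|z| <= 2^-1.
    by rewrite /z normrM normfV ler_pdivrMr //; lra.
  have z1 : -1 < z by move: z2; rewrite ler_norml; lra.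
  have -> : x + y = x * (1 + z) by rewrite yE; ring.
  rewrite normrM powRM // (@ger0_norm _ (1 + z)); last lra.
  have h1 : (1 + z) `^ q <= 1 + q * z + C1 * (q * z) ^+ 2.
    apply: le_trans (powR1D_le_expR z1 _) _; first lra.
    apply: HC1; rewrite normrM (@ger0_norm _ q); last lra.
    by rewrite ler_pM2l //; lra.
  have xq0 := powR_ge0 `|x| q.
  apply: le_trans (ler_wpM2l xq0 h1) _.
  have e1 : `|x| `^ q = `|x| `^ (q - 2) * x ^+ 2.
    rewrite -(real_normK (num_real x)) powRS2 //; last lra.
    by rewrite mulrC.
  have -> : `|x| `^ q * (1 + q * z + C1 * (q * z) ^+ 2) =
     `|x| `^ q + q * signed_powR q x * y + C1 * q ^+ 2 * (`|x| `^ (q - 2) * y ^+ 2).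
    by rewrite e1 yE /signed_powR; ring.
  rewrite lerD2l.
  have h5 : 0 <= `|x| `^ (q - 2) * y ^+ 2 by exact: mulr_ge0.
  nra.
Qed.

(** The dichotomy is that of [powR_norm_taylor]. Away from the origin a modulus has to be estimated,
    which takes an upper and a lower bound for [(1 + z)^(q-1)]. *)
Lemma signed_powR_lipschitz q : 2 < q ->
  exists2 C : R, 0 < C & forall x y,
    `|signed_powR q (x + y) - signed_powR q x|
      <= C * (`|y| * (`|x| `^ (q - 2) + `|y| `^ (q - 2))).
Proof.
move=> q2; have [|C1 C10 HC1] := @expR_le_quadratic ((q - 1) * 2^-1); first lra.
have p3 := @powR_ge0 R 3 (q - 1).
exists (3 `^ (q - 1) + 2 + 2 * (q - 1) + C1 * (q - 1) ^+ 2).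
  rewrite ltr_wpDr ?mulr_ge0 ?sqr_ge0 //; lra.
move=> x y; have yq := @powR_ge0 R `|y| (q - 2).
have xq := @powR_ge0 R `|x| (q - 2).
have y0 := normr_ge0 y.
have c0 : 0 <= C1 * (q - 1) ^+ 2 by rewrite mulr_ge0 ?sqr_ge0 //; lra.
have h5 : 0 <= `|y| * `|x| `^ (q - 2) by exact: mulr_ge0.
have h6 : 0 <= `|y| * `|y| `^ (q - 2) by exact: mulr_ge0.
have [xy|xy] := leP `|x| (2 * `|y|).
- have h1 : `|signed_powR q (x + y)| <= 3 `^ (q - 1) * (`|y| * `|y| `^ (q - 2)).
    rewrite norm_signed_powR; last lra.
    have -> : `|y| * `|y| `^ (q - 2) = `|y| `^ (q - 1).
      by rewrite (@powRS1 _ (q - 1)) //; [congr (_ * _ `^ _); lra|lra].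
    rewrite -powRM //; apply: ler_powR2l => //; first lra.
    by apply: le_trans (ler_normD _ _) _; lra.
  have h2 : `|signed_powR q x| <= 2 * (`|y| * `|x| `^ (q - 2)).
    by rewrite /signed_powR normrM (ger0_norm xq); nra.
  apply: le_trans (ler_normB _ _) _; nra.
- have x0 : x != 0 by rewrite -normr_gt0; lra.
  pose z := y / x; have yE : y = x * z by rewrite /z mulrC divfK.
  have nx : 0 < `|x| by rewrite normr_gt0.
  have z2 : `|z| <= 2^-1.
    by rewrite /z normrM normfV ler_pdivrMr //; lra.
  have z1 : -1 < z by move: z2; rewrite ler_norml; lra.
  have e0 : signed_powR q (x + y) - signed_powR q x
     = `|x| `^ (q - 2) * x * ((1 + z) `^ (q - 1) - 1).
    rewrite /signed_powR.
    have -> : x + y = x * (1 + z) by rewrite yE; ring.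
    rewrite normrM powRM // (@ger0_norm _ (1 + z)); last lra.
    rewrite (@powRS1 _ (q - 1)); [|lra|lra].
    have -> : q - 1 - 1 = q - 2 by lra.
    by ring.
  have h1 : (1 + z) `^ (q - 1) <= 1 + (q - 1) * z + C1 * ((q - 1) * z) ^+ 2.
    apply: le_trans (powR1D_le_expR z1 _) _; first lra.
    apply: HC1; rewrite normrM (@ger0_norm _ (q - 1)); last lra.
    by rewrite ler_pM2l //; lra.
  have h2 : 1 - 2 * (q - 1) * `|z| <= (1 + z) `^ (q - 1).
    by apply: powR1D_ge => //; lra.
  have h3 : `|(1 + z) `^ (q - 1) - 1|
      <= (2 * (q - 1) + C1 * (q - 1) ^+ 2) * `|z|.
    have zz : z <= `|z| by exact: ler_norm.
    have z02 : z ^+ 2 <= `|z|.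
      rewrite -(real_normK (num_real z)).
      have := normr_ge0 z; nra.
    have h7 : C1 * ((q - 1) * z) ^+ 2 <= C1 * (q - 1) ^+ 2 * `|z|.
      by rewrite exprMn mulrA ler_wpM2l.
    have h8 : 0 <= C1 * (q - 1) ^+ 2 * `|z| by rewrite mulr_ge0.
    have h9 : (q - 1) * z <= (q - 1) * `|z| by rewrite ler_pM2l //; clear -q2; lra.
    have h10 : 0 <= (q - 1) * `|z| by rewrite mulr_ge0 //; clear -q2; lra.
    by clear -h1 h2 h7 h8 h9 h10; rewrite ler_norml; apply/andP; split; lra.
  rewrite e0 !normrM (ger0_norm xq).
  apply: le_trans (ler_wpM2l _ h3) _; first by rewrite mulr_ge0.
  have -> : `|x| `^ (q - 2) * `|x| * ((2 * (q - 1) + C1 * (q - 1) ^+ 2) * `|z|)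
      = (2 * (q - 1) + C1 * (q - 1) ^+ 2) * (`|y| * `|x| `^ (q - 2)).
    have -> : `|y| = `|x| * `|z| by rewrite [in LHS]yE normrM.
    move: (`|x| `^ (q - 2)) (`|x|) (`|z|) => A B D; ring.
  rewrite [leRHS]mulrA [leRHS]mulrDr -![in leRHS]mulrA.
  apply: ler_wpDr; first by rewrite mulr_ge0 //; clear -q2 p3 c0; lra.
  by rewrite ler_wpM2r //; clear -q2 p3 c0; lra.
Qed.

(** Below the threshold [N] the lower power is at most [N^r]; above it [x^(r-q) <= N^(r-q)]. The
    free threshold lets a lower moment be traded for a small multiple of the full moment plus a
    constant. *)
Lemma powR_lower_le q r N x : 0 <= r -> r <= q -> 0 < N -> 0 <= x ->
  x `^ r <= x `^ q * N `^ (r - q) + N `^ r.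
Proof.
move=> r0 rq N0 x0; have [xN|Nx] := leP x N.
  apply: ler_wpDl; first by rewrite mulr_ge0 ?powR_ge0.
  exact: ler_powR2l.
apply: ler_wpDr; first exact: powR_ge0.
have xp : 0 < x by lra.
have -> : x `^ r = x `^ q * x `^ (r - q).
  by rewrite -powRD; [congr (_ `^ _); lra|rewrite (gt_eqF xp) implybT].
rewrite ler_wpM2l ?powR_ge0 //.
have -> : r - q = - (q - r) by lra.
rewrite !powRN lef_pV2 ?posrE ?powR_gt0 //.
by apply: ler_powR2l; lra.
Qed.

End PowerInequalities.

(** * Bounded measurable functions and Birkhoff sums *)

Section BoundedMeasurable.
Context {R : realType} {d : measure_display} {T : measurableType d}.
Implicit Types f g : T -> R.

(** Truncation makes all functions in the moment estimates bounded; with this predicate, linearity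
    and monotonicity of the mean carry no integrability condition. *)
Definition bddm f := measurable_fun setT f /\ exists B, forall x, `|f x| <= B.

Lemma bddm_cst (c : R) : bddm (fun=> c).
Proof. by split; [exact: measurable_cst|exists `|c|]. Qed.

Lemma bddmD f g : bddm f -> bddm g -> bddm (fun x => f x + g x).
Proof.
move=> [mf [B fB]] [mg [B' gB]]; split; first exact: measurable_funD.
by exists (B + B') => x; rewrite (le_trans (ler_normD _ _)) ?lerD.
Qed.

Lemma bddmM f g : bddm f -> bddm g -> bddm (fun x => f x * g x).
Proof.
move=> [mf [B fB]] [mg [B' gB]]; split; first exact: measurable_funM.
by exists (B * B') => x; rewrite normrM ler_pM.
Qed.

Lemma bddmZ (c : R) f : bddm f -> bddm (fun x => c * f x).
Proof. by move=> bf; apply: bddmM => //; exact: bddm_cst. Qed.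

Lemma bddmN f : bddm f -> bddm (fun x => - f x).
Proof.
move=> bf; have := bddmZ (-1) bf.
by congr bddm; apply/funext => x; rewrite mulN1r.
Qed.

Lemma bddmB f g : bddm f -> bddm g -> bddm (fun x => f x - g x).
Proof. by move=> bf bg; apply: bddmD => //; exact: bddmN. Qed.

Lemma bddm_norm f : bddm f -> bddm (fun x => `|f x|).
Proof.
move=> [mf [B fB]]; split; first exact: measurableT_comp.
by exists B => x; rewrite normr_id.
Qed.

Lemma bddm_powR f (r : R) : 0 <= r -> bddm f -> (forall x, 0 <= f x) ->
  bddm (fun x => f x `^ r).
Proof.
move=> r0 [mf [B fB]] f0; split.
  by apply: (measurableT_comp (measurable_powR _)).
exists (B `^ r) => x; rewrite ger0_norm ?powR_ge0 // ler_powR2l //.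
by rewrite (le_trans (ler_norm _)).
Qed.

Lemma bddm_norm_powR f (r : R) : 0 <= r -> bddm f -> bddm (fun x => `|f x| `^ r).
Proof. by move=> r0 bf; apply: bddm_powR => //; exact: bddm_norm. Qed.

Lemma bddm_signed_powR f (q : R) : 2 < q -> bddm f ->
  bddm (fun x => signed_powR q (f x)).
Proof.
by move=> q2 bf; apply: bddmM => //; apply: bddm_norm_powR => //; lra.
Qed.

Lemma bddmX f n : bddm f -> bddm (fun x => f x ^+ n).
Proof.
move=> bf; elim: n => [|n IH]; first exact: bddm_cst.
under eq_fun do rewrite exprS.
exact: bddmM.
Qed.

Lemma bddm_max f g : bddm f -> bddm g -> bddm (fun x => Num.max (f x) (g x)).
Proof.
move=> [mf [B fB]] [mg [B' gB]]; split; first exact: measurable_maxr.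
exists (Num.max B B') => x; rewrite le_max.
by have [_|_] := leP (f x) (g x); rewrite ?fB ?gB ?orbT.
Qed.

Lemma bddm_comp (F : T -> T) f : measurable_fun setT F -> bddm f ->
  bddm (fun x => f (F x)).
Proof.
by move=> mF [mf [B fB]]; split; [exact: measurableT_comp|exists B => x].
Qed.

Lemma bddm_sum (I : Type) (s : seq I) (p : pred I) (f : I -> T -> R) :
  (forall i, bddm (f i)) -> bddm (fun x => \sum_(i <- s | p i) f i x).
Proof.
move=> bf; elim: s => [|a s IH].
  by under eq_fun do rewrite big_nil; exact: bddm_cst.
by under eq_fun do rewrite big_cons; case: (p a) => //; apply: bddmD.
Qed.

Lemma bddm_integrable (P : {finite_measure set T -> \bar R}) f :
  bddm f -> P.-integrable setT (EFin \o f).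
Proof.
move=> [mf [B fB]]; apply: (measurable_bounded_integrable measurableT) => //.
  by rewrite -ge0_fin_numE // fin_num_measure.
exists B; split; first exact: num_real.
by move=> M BM x _; apply: le_trans (fB x) _; exact: ltW.
Qed.

End BoundedMeasurable.

Section Mean.
Context {R : realType} {d : measure_display} {T : measurableType d}.
Variable P : probability T R.
Implicit Types f g : T -> R.

Definition mean f : R := \int[P]_x f x.

Lemma mean_cst (c : R) : mean (fun=> c) = c.
Proof.
rewrite /mean Rintegral_cst // -[RHS]mulr1; congr (_ * _).
exact: (congr1 fine (probability_setT P)).
Qed.

Lemma meanD f g : bddm f -> bddm g -> mean (fun x => f x + g x) = mean f + mean g.
Proof. by move=> bf bg; rewrite /mean RintegralD //; exact: bddm_integrable. Qed.

Lemma meanB f g : bddm f -> bddm g -> mean (fun x => f x - g x) = mean f - mean g.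
Proof. by move=> bf bg; rewrite /mean RintegralB //; exact: bddm_integrable. Qed.

Lemma meanZ (c : R) f : bddm f -> mean (fun x => c * f x) = c * mean f.
Proof. by move=> bf; rewrite /mean RintegralZl //; exact: bddm_integrable. Qed.

Lemma le_mean f g : bddm f -> bddm g -> (forall x, f x <= g x) ->
  mean f <= mean g.
Proof. by move=> bf bg fg; apply: le_Rintegral => //; exact: bddm_integrable. Qed.

Lemma mean_ge0 f : (forall x, 0 <= f x) -> 0 <= mean f.
Proof. by move=> f0; apply: Rintegral_ge0. Qed.

Lemma mean_sum (I : Type) (s : seq I) (f : I -> T -> R) :
  (forall i, bddm (f i)) ->
  mean (fun x => \sum_(i <- s) f i x) = \sum_(i <- s) mean (f i).
Proof.
move=> bf; elim: s => [|a s IH].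
  by rewrite big_nil; under eq_fun do rewrite big_nil; exact: mean_cst.
rewrite big_cons -IH -meanD //; last exact: bddm_sum.
by congr mean; apply/funext => x; rewrite big_cons.
Qed.

Lemma EFin_mean f : bddm f -> (mean f)%:E = (\int[P]_x (f x)%:E)%E.
Proof.
move=> bf; rewrite /mean /Rintegral fineK //.
by apply: integrable_fin_num => //; exact: bddm_integrable.
Qed.

Variable F : T -> T.
Hypothesis mF : measurable_fun setT F.
Hypothesis invF : forall A, measurable A -> P (F @^-1` A) = P A.

Lemma ge0_integral_comp (g : T -> \bar R) : measurable_fun setT g ->
  (forall x, 0 <= g x)%E -> (\int[P]_x g (F x) = \int[P]_x g x)%E.
Proof.
move=> mg g0; have h := @ge0_integral_pushforward _ _ _ _ _ F mF P setT g measurableT.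
rewrite preimage_setT in h; rewrite -[LHS]h //.
apply: eq_measure_integral => A mA _; exact: invF.
Qed.

Lemma mean_comp f : bddm f -> mean (fun x => f (F x)) = mean f.
Proof.
move=> bf.
have pos g : bddm g -> (forall x, 0 <= g x) -> mean (fun x => g (F x)) = mean g.
  move=> bg g0; apply: (congr1 fine).
  apply: (@ge0_integral_comp (EFin \o g)) => [|x]; last by rewrite /= lee_fin.
  by apply/measurable_EFinP; case: bg.
have [mf [B fB]] := bf.
(* Adding a bound of [f] reduces the claim to nonnegative functions; the constant cancels on both
   sides. *)
have bf1 : bddm (fun x => f x + B) by apply: bddmD => //; exact: bddm_cst.
have := pos _ bf1.
rewrite (@meanD (fun x => f (F x)) (fun=> B)); last 2 first.
  - exact: bddm_comp.
  - exact: bddm_cst.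
rewrite (@meanD f (fun=> B)) //; last exact: bddm_cst.
move=> /(_ _)/addIr; apply => x.
by have := fB x; rewrite ler_norml => /andP[]; lra.
Qed.

Lemma measurable_iter n : measurable_fun setT (iter n F).
Proof.
elim: n => [|n IH]; first exact: measurable_id.
exact: (measurableT_comp mF IH).
Qed.

Lemma bddm_iter n f : bddm f -> bddm (fun x => f (iter n F x)).
Proof. by move=> bf; apply: bddm_comp => //; exact: measurable_iter. Qed.

Lemma mean_iter n f : bddm f -> mean (fun x => f (iter n F x)) = mean f.
Proof.
move=> bf; elim: n => [//|n IH]; rewrite -IH -[in RHS]mean_comp //; last exact: bddm_iter.
by congr mean; apply/funext => x; rewrite -iterSr.
Qed.

End Mean.

(** The increment may depend on the largest earlier value [m], because the cross terms in the moment
    estimates involve all shorter sums. The majorant [k * beta * (1 + alpha / n) ^+ k] increases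
    with [k], hence dominates earlier values too, and [(1 + alpha / n) ^+ n <= expR alpha]. *)
Lemma discrete_gronwall {R : realType} (n : nat) (alpha beta : R) (a : nat -> R) :
  (0 < n)%N -> 0 <= alpha -> 0 <= beta -> a 0%N <= 0 ->
  (forall k m, (k < n)%N -> (forall j, (j <= k)%N -> a j <= m) ->
     a k.+1 <= a k + m * n%:R^-1 * alpha + beta) ->
  a n <= n%:R * beta * expR alpha.
Proof.
move=> n0 al0 be0 a0 rec.
have n0' : 0 < n%:R :> R by rewrite ltr0n.
pose t := 1 + alpha / n%:R; have t1 : 1 <= t by rewrite lerDl divr_ge0 ?ler0n.
have claim k : (k <= n)%N -> forall j, (j <= k)%N -> a j <= k%:R * beta * t ^+ k.
  elim: k => [_ j|k IH kn j]; first by rewrite leqn0 => /eqP ->; rewrite !mul0r.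
  have mono : k%:R * beta * t ^+ k <= k.+1%:R * beta * t ^+ k.+1.
    rewrite ler_pM ?mulr_ge0 ?exprn_ge0 //; [lra| |].
      by rewrite ler_wpM2r // ler_nat.
    by rewrite exprS ler_peMl // exprn_ge0 //; lra.
  rewrite leq_eqVlt ltnS => /orP[/eqP ->|jk]; last first.
    by apply: le_trans mono; apply: IH => //; exact: ltnW.
  have := rec k _ kn (IH (ltnW kn)).
  have hk := IH (ltnW kn) k (leqnn k).
  move=> h; apply: (le_trans h).
  apply: (@le_trans _ _ (k%:R * beta * t ^+ k * t + beta * t ^+ k.+1)).
    rewrite /t -/t; apply: lerD; last by rewrite ler_peMr // exprn_ege1.
    have -> : k%:R * beta * t ^+ k * t =
       k%:R * beta * t ^+ k + k%:R * beta * t ^+ k / n%:R * alpha.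
      by rewrite {2}/t; ring.
    by rewrite lerD2r.
  by rewrite -mulrA -exprSr -[k.+1]addn1 natrD mulrDl mulrDl mul1r.
apply: le_trans (claim n (leqnn n) n (leqnn n)) _.
rewrite ler_wpM2l ?mulr_ge0 //.
apply: (@le_trans _ _ (expR (alpha / n%:R) ^+ n)).
  by apply: lerXn2r; rewrite ?nnegrE ?expR_ge0 ?expR_ge1Dx //; lra.
by rewrite -expRM_natl mulrC divfK // gt_eqF.
Qed.

(** * Birkhoff sums, iterated sums and running maxima *)

Section Birkhoff.
Context {R : realType} {T : Type}.
Variable F : T -> T.
Implicit Types (V W : T -> R).

Definition birkhoff V k x : R := \sum_(i < k) V (iter i F x).

Lemma birkhoff0 V x : birkhoff V 0 x = 0.
Proof. by rewrite /birkhoff big_ord0. Qed.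

Lemma birkhoffS V k x : birkhoff V k.+1 x = V x + birkhoff V k (F x).
Proof.
rewrite /birkhoff big_ord_recl; congr (_ + _).
by apply: eq_bigr => i _; rewrite -iterSr.
Qed.

Lemma birkhoffD V m n x :
  birkhoff V (m + n) x = birkhoff V m x + birkhoff V n (iter m F x).
Proof.
elim: m x => [|m IH] x; first by rewrite birkhoff0 add0r.
by rewrite addSn !birkhoffS IH addrA -iterSr.
Qed.

(* [birkhoff2 V W k x] is the sum of [V (F^i x) * W (F^j x)] over [i < j < k]. *)
Fixpoint birkhoff2 V W k x : R :=
  if k is k'.+1 then birkhoff2 V W k' (F x) + V x * birkhoff W k' (F x) else 0.

(** Chen's relation: a pair [i < j] lies in one of the two blocks or straddles the cut, and the
    straddling pairs form the product. *)
Lemma birkhoff2D V W m n x : birkhoff2 V W (m + n) x =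
  birkhoff2 V W m x + birkhoff2 V W n (iter m F x)
  + birkhoff V m x * birkhoff W n (iter m F x).
Proof.
elim: m x => [|m IH] x /=; first by rewrite birkhoff0 mul0r add0r addr0.
rewrite IH birkhoffD birkhoffS -iterSr /=; ring.
Qed.

Fixpoint runmax (f : nat -> T -> R) k x : R :=
  if k is k'.+1 then Num.max (runmax f k' x) `|f k x| else `|f 0%N x|.

Lemma runmax_ge f k i x : (i <= k)%N -> `|f i x| <= runmax f k x.
Proof.
elim: k => [|k IH]; first by rewrite leqn0 => /eqP ->.
rewrite leq_eqVlt => /orP[/eqP ->|ik] /=; first by rewrite le_max lexx orbT.
by rewrite le_max IH.
Qed.

Lemma runmax_le f k x (B : R) : (forall i, (i <= k)%N -> `|f i x| <= B) ->
  runmax f k x <= B.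
Proof.
elim: k => [|k IH] fB /=; first exact: fB.
by rewrite ge_max fB // IH // => i ik; apply: fB; exact: leq_trans ik _.
Qed.

Lemma runmax_ge0 f k x : 0 <= runmax f k x.
Proof. by apply: le_trans (runmax_ge f x (leqnn k)). Qed.

(** The [j]-th increment is evaluated [k - j - 1] steps later, so a factor one step before [x] sees
    it across a gap of [k - j], and decay of correlations applies with a summable rate. *)
Lemma telescope_along_orbit (Psi : nat -> T -> R) k x : Psi 0%N = (fun=> 0) ->
  Psi k x = \sum_(j < k) (Psi j.+1 (iter (k - j.+1) F x)
                          - Psi j (F (iter (k - j.+1) F x))).
Proof.
move=> P0; elim: k x => [|k IH] x; first by rewrite big_ord0 P0.
rewrite big_ord_recr /= subnn /= -[LHS](subrK (Psi k (F x))) addrC.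
congr (_ + _); rewrite IH; apply: eq_bigr => j _.
by rewrite subSS -iterSr -subSn.
Qed.

End Birkhoff.

(** * Weak dependence between the present and the future of an orbit *)

Section Moments.
Context {R : realType}.
Implicit Types (q c D : R).

(* The standing assumptions on an observable: [U] dominates [V], and functions
   of the future are nearly independent of [U `^ a] and of [V]. *)
Record weakly_dependent {d} {T : measurableType d} (P : probability T R)
    (F : T -> T) (a c D : R) (N : nat) (U V : T -> R) : Prop := WeaklyDependent {
  wd_bddU : bddm U;
  wd_bddV : bddm V;
  wd_U1 : forall x, 1 <= U x;
  wd_VU : forall x, `|V x| <= U x;
  wd_quasi : forall g, bddm g -> (forall x, 0 <= g x) ->
    mean P (fun x => U x `^ a * g (F x)) <= c * mean P g;
  wd_decorrelation : exists cc : nat -> R, (forall k, 0 <= cc k) /\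
    (forall k g, (0 < k <= N)%N -> bddm g ->
      `|mean P (fun x => V x * g (iter k F x))| <= cc k * mean P (fun x => `|g x|))
    /\ \sum_(1 <= k < N.+1) cc k <= D }.

Section Fixed.
Context {d : measure_display} {T : measurableType d}.
Variables (P : probability T R) (F : T -> T).
Hypothesis mF : measurable_fun setT F.
Hypothesis invF : forall A, measurable A -> P (F @^-1` A) = P A.
Variables (a c D : R) (N : nat) (U V : T -> R).
Hypothesis wd : weakly_dependent P F a c D N U V.
Hypothesis a0 : 0 <= a.

(** A power of [U] at the present point is integrated out against a function of the future at the
    price of the factor [c]; as [U >= 1], every exponent up to [a] is covered. *)
Lemma mean_quasi r (g f : T -> R) : bddm g -> (forall x, 0 <= g x) -> r <= a ->
  bddm f -> (forall x, f x <= U x `^ r * g (F x)) -> mean P f <= c * mean P g.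
Proof.
move=> bg g0 ra bf fUg; apply: le_trans (wd_quasi wd bg g0).
have U0 x : 0 <= U x by apply: le_trans (wd_U1 wd x).
apply: le_mean => //.
  apply: bddmM; last exact: bddm_comp.
  exact: bddm_powR (wd_bddU wd) _.
move=> x; apply: le_trans (fUg x) _.
by apply: ler_wpM2r => //; apply: ler_powR => //; exact: wd_U1 wd x.
Qed.

Lemma bddm_birkhoff (W : T -> R) k : bddm W -> bddm (birkhoff F W k).
Proof. by move=> bW; apply: bddm_sum => i; exact: bddm_iter. Qed.

Lemma bddm_birkhoff2 (V1 W : T -> R) k : bddm V1 -> bddm W -> bddm (birkhoff2 F V1 W k).
Proof.
move=> bV bW; elim: k => [|k IH] /=; first exact: bddm_cst.
apply: bddmD; first exact: bddm_comp.
by apply: bddmM => //; apply: bddm_comp => //; exact: bddm_birkhoff.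
Qed.

Lemma bddm_runmax (f : nat -> T -> R) k : (forall i, bddm (f i)) ->
  bddm (runmax f k).
Proof.
move=> bf; elim: k => [|k IH] /=; first exact: bddm_norm.
by apply: bddm_max => //; exact: bddm_norm.
Qed.

(* Expanding [Psi k] along the orbit into increments, each of which is seen by
   [V] only through the decay of correlations. *)
Lemma mean_telescope_le (Psi : nat -> T -> R) k (m : R) :
  (k < N.+1)%N -> 0 <= D -> Psi 0%N = (fun=> 0) -> (forall j, bddm (Psi j)) ->
  (forall j, (j < k)%N ->
     mean P (fun x => `|Psi j.+1 x - Psi j (F x)|) <= m) -> 0 <= m ->
  mean P (fun x => V x * Psi k (F x)) <= D * m.
Proof.
move=> kN D0 P0 bP Hm m0; have [cc [cc0 [dec ccD]]] := wd_decorrelation wd.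
pose G j x := Psi j.+1 x - Psi j (F x).
have bG j : bddm (G j) by apply: bddmB => //; exact: bddm_comp.
have -> : (fun x => V x * Psi k (F x)) =
    (fun x => \sum_(j < k) V x * G j (iter (k - j) F x)).
  apply/funext => x; rewrite (telescope_along_orbit F) // mulr_sumr.
  apply: eq_bigr => j _; rewrite /G -!iterSr -subSn //.
rewrite mean_sum; last first.
  by move=> j; apply: bddmM; [exact: wd_bddV wd|exact: bddm_iter].
apply: (@le_trans _ _ (\sum_(j < k) cc (k - j)%N * m)).
  apply: ler_sum => j _; apply: le_trans (ler_norm _) _.
  apply: (le_trans (dec _ _ _ (bG j))).
    by rewrite subn_gt0 ltn_ord /= (leq_trans (leq_subr _ _)).
  by apply: ler_wpM2l => //; exact: Hm.
rewrite -mulr_suml; apply: ler_wpM2r => //; apply: le_trans ccD.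
(* Read backwards, the gaps [k - j] run through [1, ..., k], so their coefficients form part of the
   sum bounded by [D]. *)
rewrite -(big_mkord xpredT (fun j => cc (k - j)%N)).
rewrite big_nat_rev /= add0n big_add1 /=.
rewrite (@big_cat_nat _ _ _ k 0 N) //=.
apply: ler_wpDr; first exact: sumr_ge0.
rewrite big_nat [leRHS]big_nat; apply: ler_sum => j /andP[_ jk].
by rewrite subKn.
Qed.

End Fixed.
End Moments.

(** * Moments of Birkhoff sums *)

Section MomentBounds.
Context {R : realType}.
Implicit Types (a q c D : R).

Lemma mean_powR_lower {d} {T : measurableType d} (P : probability T R) q r
    (K : R) (f : T -> R) : 0 <= r -> r <= q -> 0 < K -> bddm f ->
  mean P (fun x => `|f x| `^ r) <=
    mean P (fun x => `|f x| `^ q) * K `^ (r - q) + K `^ r.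
Proof.
move=> r0 rq K0 bf.
have bq : bddm (fun x => `|f x| `^ q).
  by apply: bddm_norm_powR => //; exact: le_trans rq.
rewrite -(mean_cst P (K `^ r)) mulrC -meanZ // -meanD; last 2 first.
- exact: bddmZ.
- exact: bddm_cst.
apply: le_mean.
- exact: bddm_norm_powR.
- by apply: bddmD; [exact: bddmZ|exact: bddm_cst].
- by move=> x; rewrite [_ * (_ `^ q)]mulrC; apply: powR_lower_le.
Qed.

(** An inequality of Rosenthal type. Writing [S_(k+1) = V + S_k o F] and expanding the [q]-th power
    to second order, the linear term is handled by decorrelation and the quadratic one by
    quasi-independence. Both leave only the moment of order [q - 2], which is converted into [1/n]
    of the [q]-th moment plus [n^(q/2-1)]; the discrete Gronwall inequality concludes. *)
Lemma moment_birkhoff q c D : 2 < q -> 0 <= c -> 0 <= D ->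
  exists2 C : R, 0 < C &
  forall d (T : measurableType d) (P : probability T R) (F : T -> T),
    measurable_fun setT F ->
    (forall A, measurable A -> P (F @^-1` A) = P A) ->
  forall a N U V, 2 <= a -> weakly_dependent P F a c D N U V ->
  forall n, (n <= N)%N -> mean P (fun x => `|birkhoff F V n x| `^ q) <=
    C * (n%:R `^ (q / 2) + n%:R * mean P (fun x => U x `^ q)).
Proof.
move=> q2 c0 D0.
have [C1 C10 HC1] := powR_norm_taylor q2.
have [C2 C20 HC2] := signed_powR_lipschitz q2.
pose K := q * D * C2 + C1.
have K0 : 0 < K by rewrite ltr_wpDl // !mulr_ge0 //; lra.
exists (K * (c + 1) * expR (K * c)).
  by rewrite !mulr_gt0 ?expR_gt0 //; lra.
move=> d T P F mF invF a N U V a2 wd.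
have S0 : mean P (fun x => `|birkhoff F V 0 x| `^ q) = 0.
  rewrite -[RHS](mean_cst P); congr mean; apply/funext => x.
  by rewrite birkhoff0 normr0 powR0 // gt_eqF //; lra.
move=> [|n] nN.
  rewrite S0 mul0r addr0 !mulr_ge0 ?powR_ge0 ?expR_ge0 //; lra.
have a0 : 0 <= a by lra.
set nn : R := n.+1%:R; have nn0 : 0 < nn by rewrite ltr0n.
pose S := birkhoff F V; pose b := mean P (fun x => U x `^ q).
pose e := nn `^ (q / 2 - 1).
have bU := wd_bddU wd; have bV := wd_bddV wd.
have U1 := wd_U1 wd; have VU := wd_VU wd.
have U0 x : 0 <= U x by apply: le_trans (U1 x).
have bS k : bddm (S k) by exact: bddm_birkhoff.
have bSF k : bddm (fun x => S k (F x)) by exact: bddm_comp.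
have b0 : 0 <= b by apply: mean_ge0 => x; exact: powR_ge0.
have e0 : 0 <= e by exact: powR_ge0.
have q20 : 0 <= q - 2 by lra.
(* The threshold is the square root of [n]: its power [-2] is the factor [1/n] that Gronwall
   tolerates, and its power [q - 2] is [e]. *)
have lo k : mean P (fun x => `|S k x| `^ (q - 2)) <=
    mean P (fun x => `|S k x| `^ q) * nn^-1 + e.
  have h : q - 2 <= q by lra.
  have := mean_powR_lower P q20 h (powR_gt0 2^-1 nn0) (bS k).
  rewrite -!powRrM /e.
  have -> : 2^-1 * (q - 2 - q) = - 1 :> R by field.
  rewrite powR_inv1; last exact: ltW.
  by have -> : 2^-1 * (q - 2) = q / 2 - 1 by field.
have bUq : bddm (fun x => U x `^ q) by apply: bddm_powR => //; lra.
have bSq k : bddm (fun x => `|S k x| `^ q) by apply: bddm_norm_powR => //; lra.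
have bSq2 k : bddm (fun x => `|S k x| `^ (q - 2)) by exact: bddm_norm_powR.
have bSq2F k : bddm (fun x => `|S k (F x)| `^ (q - 2)).
  exact: bddm_comp mF (bSq2 k).
have rec k m : (k < n.+1)%N ->
    (forall j, (j <= k)%N -> mean P (fun x => `|S j x| `^ q) <= m) ->
    mean P (fun x => `|S k.+1 x| `^ q) <=
    mean P (fun x => `|S k x| `^ q) + m * nn^-1 * (K * c) + K * (c * e + b).
  move=> kn Hm.
  have m0 : 0 <= m.
    by apply: le_trans (Hm 0%N (leq0n _)); apply: mean_ge0 => x; exact: powR_ge0.
  have M0 : 0 <= m * nn^-1 + e by rewrite addr_ge0 // divr_ge0 // ltW.
  have lom j : (j <= k)%N -> mean P (fun x => `|S j x| `^ (q - 2)) <= m * nn^-1 + e.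
    move=> jk; apply: le_trans (lo j) _.
    by rewrite lerD2r ler_wpM2r ?invr_ge0 ?(ltW nn0) //; exact: Hm.
  have quad j : (j <= k)%N ->
      mean P (fun x => `|S j (F x)| `^ (q - 2) * V x ^+ 2) <= c * (m * nn^-1 + e).
    move=> jk; apply: (@le_trans _ _ (c * mean P (fun x => `|S j x| `^ (q - 2)))).
      apply: (@mean_quasi _ _ _ _ _ mF _ _ _ _ _ _ wd a0 2) => //.
        by apply: bddmM => //; exact: bddmX.
      move=> x; rewrite mulrC ler_wpM2r ?powR_ge0 // powR_mulrn //.
      rewrite -(real_normK (num_real (V x))).
      by apply: lerXn2r; rewrite ?nnegrE.
    by apply: ler_wpM2l => //; exact: lom.
  have step : mean P (fun x => `|S k.+1 x| `^ q) <=
      mean P (fun x => `|S k x| `^ q)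
      + q * mean P (fun x => V x * signed_powR q (S k (F x)))
      + C1 * (c * (m * nn^-1 + e) + b).
    have bsg : bddm (fun x => V x * signed_powR q (S k (F x))).
      by apply: bddmM => //; apply: bddm_signed_powR.
    have bt : bddm (fun x => `|S k (F x)| `^ (q - 2) * V x ^+ 2 + U x `^ q).
      by apply: bddmD => //; apply: bddmM => //; exact: bddmX.
    apply: (@le_trans _ _ (mean P (fun x => `|S k (F x)| `^ q +
       q * (V x * signed_powR q (S k (F x))) +
       C1 * (`|S k (F x)| `^ (q - 2) * V x ^+ 2 + U x `^ q)))).
      apply: le_mean => //.
        apply: bddmD; last exact: bddmZ.
        by apply: bddmD; [exact: bddm_comp mF (bSq k)|exact: bddmZ].
      move=> x; rewrite /S birkhoffS addrC; apply: le_trans (HC1 _ _) _.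
      rewrite -/(S k) -mulrA [signed_powR _ _ * _]mulrC lerD2l ler_pM2l // lerD2l.
      by apply: ler_powR2l => //; lra.
    rewrite meanD; last 2 first.
      by apply: bddmD; [exact: bddm_comp mF (bSq k)|exact: bddmZ].
      exact: bddmZ.
    rewrite meanD; last 2 first.
      exact: bddm_comp mF (bSq k).
      exact: bddmZ.
    rewrite !meanZ // (mean_comp mF invF (bSq k)) lerD2l ler_pM2l //.
    rewrite meanD //; first by rewrite lerD2r; exact: quad.
    by apply: bddmM => //; exact: bddmX.
  (* A pointwise estimate would lose the cancellation. Telescoping [signed_powR q (S j)] replaces
     the power [q - 1] of the sum by increments that cost only its power [q - 2]. *)
  have cross : mean P (fun x => V x * signed_powR q (S k (F x))) <=
      D * (C2 * (c * (m * nn^-1 + e) + b)).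
    apply: (@mean_telescope_le _ _ _ _ _ mF _ _ _ _ _ _ wd
              (fun j x => signed_powR q (S j x))) => //.
    - exact: leq_trans kn (leq_trans nN _).
    - by apply/funext => x; rewrite /S birkhoff0 /signed_powR mulr0.
    - by move=> j; apply: bddm_signed_powR.
    - move=> j jk; have bt : bddm (fun x => U x * `|S j (F x)| `^ (q - 2)).
        exact: bddmM.
      apply: (@le_trans _ _ (mean P (fun x =>
          C2 * (U x * `|S j (F x)| `^ (q - 2) + U x `^ q)))).
        apply: le_mean.
        + by apply: bddm_norm; apply: bddmB; apply: bddm_signed_powR.
        + by apply: bddmZ; apply: bddmD.
        + move=> x; rewrite /S birkhoffS [V x + _]addrC -/(S j).
          apply: le_trans (HC2 _ _) _; rewrite ler_pM2l // mulrDr lerD //.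
            by rewrite ler_wpM2r ?powR_ge0.
          rewrite (@powRS1 _ _ q) //; last by clear -q2; lra.
          apply: ler_pM => //.
          apply: (@le_trans _ _ (U x `^ (q - 2))); first by apply: ler_powR2l.
          by apply: ler_powR => //; clear -q2; lra.
      rewrite meanZ; last exact: bddmD.
      rewrite ler_pM2l // meanD // lerD2r.
      apply: (@le_trans _ _ (c * mean P (fun x => `|S j x| `^ (q - 2)))).
        apply: (@mean_quasi _ _ _ _ _ mF _ _ _ _ _ _ wd a0 1) => //.
        + by clear -a2; lra.
        + by move=> x; rewrite powRr1.
      by apply: ler_wpM2l => //; apply: lom; exact: ltnW.
    - by rewrite mulr_ge0 ?addr_ge0 ?mulr_ge0 //; exact: ltW.
  apply: (le_trans step); rewrite -addrA -[leRHS]addrA lerD2l.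
  have -> : m * nn^-1 * (K * c) + K * (c * e + b) = K * (c * (m * nn^-1 + e) + b).
    by ring.
  rewrite /K mulrDl lerD2r.
  have -> : q * D * C2 * (c * (m * nn^-1 + e) + b) =
      q * (D * (C2 * (c * (m * nn^-1 + e) + b))) by ring.
  by rewrite ler_pM2l //; clear -q2; lra.
have := @discrete_gronwall R n.+1 (K * c) (K * (c * e + b))
  (fun k => mean P (fun x => `|S k x| `^ q)) (ltn0Sn _).
move=> h; apply: le_trans (h _ _ _ rec) _.
- by rewrite mulr_ge0 // ltW.
- apply: mulr_ge0; first exact: ltW.
  by rewrite addr_ge0 ?mulr_ge0.
- by rewrite /S S0.
have -> : nn `^ (q / 2) = nn * e by rewrite /e powRS1 //; clear -q2; lra.
rewrite -/nn -/b.
have -> : nn * (K * (c * e + b)) * expR (K * c) =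
  K * expR (K * c) * (nn * (c * e + b)) by ring.
have -> : K * (c + 1) * expR (K * c) * (nn * e + nn * b) =
  K * expR (K * c) * (nn * ((c + 1) * (e + b))) by ring.
rewrite ler_pM2l; last by rewrite mulr_gt0 ?expR_gt0.
rewrite ler_pM2l //; have cb : 0 <= c * b by rewrite mulr_ge0.
clear -cb e0; lra.
Qed.

End MomentBounds.

(** * Moments of iterated sums and of sums of squares *)

Section MomentBounds2.
Context {R : realType}.
Implicit Types (a q c D : R).

(** A Young inequality whose weights fit an iterated sum [x] of order [n] and a simple sum [s] of
    order [n^(1/2)]; the cases are separated at [|x| = n^(1/2) * |s|]. *)
Lemma powR_sqr_le q (n x s : R) : 2 < q -> 0 < n ->
  `|x| `^ (q - 2) * s ^+ 2 <= `|x| `^ q * n^-1 + n `^ (q / 2 - 1) * `|s| `^ q.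
Proof.
move=> q2 n0; have q0 : 0 <= q - 2 by lra.
have s2 : `|s| `^ q = s ^+ 2 * `|s| `^ (q - 2).
  by rewrite powRS2 ?real_normK ?num_real //; lra.
have x2 : `|x| `^ q = x ^+ 2 * `|x| `^ (q - 2).
  by rewrite powRS2 ?real_normK ?num_real //; lra.
have [xs|sx] := leP `|x| (n `^ 2^-1 * `|s|).
- apply: ler_wpDl; first by rewrite mulr_ge0 ?powR_ge0 // invr_ge0 ltW.
  rewrite s2 [leRHS]mulrCA [leLHS]mulrC; apply: ler_wpM2l; first exact: sqr_ge0.
  apply: (@le_trans _ _ ((n `^ 2^-1 * `|s|) `^ (q - 2))); first exact: ler_powR2l.
  rewrite powRM ?powR_ge0 // -powRrM.
  by have -> : 2^-1 * (q - 2) = q / 2 - 1 by field.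
- apply: ler_wpDr; first by rewrite mulr_ge0 ?powR_ge0.
  have h : n * s ^+ 2 <= x ^+ 2.
    have : (n `^ 2^-1 * `|s|) ^+ 2 <= `|x| ^+ 2.
      by apply: lerXn2r; rewrite ?nnegrE ?mulr_ge0 ?powR_ge0 // ltW.
    have e : (n `^ 2^-1) ^+ 2 = n.
      by rewrite -powR_mulrn ?powR_ge0 // -powRrM mulVf // powRr1 // ltW.
    by rewrite exprMn e !real_normK ?num_real.
  have h2 : s ^+ 2 <= x ^+ 2 * n^-1 by rewrite ler_pdivlMr // mulrC.
  by rewrite x2 mulrAC [leRHS]mulrC; apply: ler_wpM2l => //; exact: powR_ge0.
Qed.

Lemma powR_le1D q r (s : R) : 0 <= r -> r <= q -> 0 <= s -> s `^ r <= 1 + s `^ q.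
Proof.
move=> r0 rq s0; have := powR_lower_le r0 rq ltr01 s0.
by rewrite !powR1 mulr1 addrC.
Qed.

(** Here [x] and [s] stand for the iterated and the simple sum at the next point, [v] and [w] for
    the present values of the observables. The bound splits off the present as [u^q], so that
    quasi-independence applies to the rest. *)
Lemma signed_powR_increment q : 2 < q ->
  exists2 C : R, 0 < C & forall x s u v w, 1 <= u -> `|v| <= u -> `|w| <= u ->
    `|signed_powR q (x + v * s) * (w + s) - signed_powR q x * s| <=
    u `^ q * (C * (`|x| `^ (q - 2) * s ^+ 2 + `|x| `^ (q - 2) + `|s| `^ q + 1)
              + `|x| `^ (q - 1)).
Proof.
move=> q2; have [C2 C20 HC2] := signed_powR_lipschitz q2.
exists (2 * C2); first lra.
move=> x s u v w u1 vu wu.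
have -> : signed_powR q (x + v * s) * (w + s) - signed_powR q x * s =
  (signed_powR q (x + v * s) - signed_powR q x) * (w + s) + signed_powR q x * w.
  by ring.
apply: le_trans (ler_normD _ _) _; rewrite [leRHS]mulrDr; apply: lerD; last first.
  rewrite normrM norm_signed_powR; last lra.
  rewrite mulrC ler_wpM2r ?powR_ge0 // (le_trans wu) //.
  by apply: le1r_powR => //; lra.
have u0 : 0 <= u by lra.
set X := `|x| `^ (q - 2); have X0 : 0 <= X by exact: powR_ge0.
set Z := `|s| `^ q; have Z0 : 0 <= Z by exact: powR_ge0.
have ws : `|w + s| <= u * (1 + `|s|).
  apply: le_trans (ler_normD _ _) _; rewrite mulrDr mulr1 lerD //.
  by rewrite ler_peMl.
rewrite normrM; apply: le_trans (ler_pM _ _ (HC2 _ _) ws) _ => //.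
rewrite normrM -/X.
have h1 : `|v| * `|s| * (X + (`|v| * `|s|) `^ (q - 2)) * (u * (1 + `|s|)) <=
    u `^ q * ((`|s| * X + `|s| `^ (q - 1)) * (1 + `|s|)).
  rewrite [leLHS]mulrA [leRHS]mulrA; apply: ler_wpM2r; first exact: addr_ge0.
  apply: (@le_trans _ _ (u * `|s| * (X + u `^ (q - 2) * `|s| `^ (q - 2)) * u)).
    rewrite ler_wpM2r // ler_pM ?mulr_ge0 ?addr_ge0 ?powR_ge0 ?ler_wpM2r //.
    rewrite lerD2l powRM // ler_wpM2r ?powR_ge0 // ler_powR2l //; lra.
  have -> : `|s| `^ (q - 1) = `|s| * `|s| `^ (q - 2).
    by rewrite (@powRS1 _ _ (q - 1)) //; [congr (_ * _ `^ _); lra|lra].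
  have uq : u `^ q = u ^+ 2 * u `^ (q - 2) by rewrite powRS2 //; lra.
  have u2 : u ^+ 2 * (`|s| * X) <= u `^ q * (`|s| * X).
    apply: ler_wpM2r; first by rewrite mulr_ge0.
    by rewrite -powR_mulrn // ler_powR //; lra.
  have -> : u * `|s| * (X + u `^ (q - 2) * `|s| `^ (q - 2)) * u =
    u ^+ 2 * (`|s| * X) + u `^ q * (`|s| * `|s| `^ (q - 2)).
    by rewrite uq; ring.
  by rewrite mulrDr lerD2r.
have -> : C2 * (`|v| * `|s| * (X + (`|v| * `|s|) `^ (q - 2))) * (u * (1 + `|s|))
  = C2 * (`|v| * `|s| * (X + (`|v| * `|s|) `^ (q - 2)) * (u * (1 + `|s|))) by ring.
apply: (le_trans (ler_wpM2l (ltW C20) h1)).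
rewrite mulrCA ler_wpM2l ?powR_ge0 // -[2 * C2]mulrC -mulrA ler_wpM2l ?(ltW C20) //.
have s1 : `|s| <= 1 + s ^+ 2.
  by rewrite -(real_normK (num_real s)); have := normr_ge0 s; nra.
have e1 : `|s| * `|s| = s ^+ 2 by rewrite -(real_normK (num_real s)) expr2.
have e2 : `|s| `^ (q - 1) <= 1 + Z by apply: powR_le1D => //; lra.
have e3 : `|s| `^ (q - 1) * `|s| = Z.
  by rewrite mulrC /Z (@powRS1 _ _ q) //; lra.
have -> : (`|s| * X + `|s| `^ (q - 1)) * (1 + `|s|) =
  `|s| * X + (`|s| * `|s|) * X + `|s| `^ (q - 1) + `|s| `^ (q - 1) * `|s| by ring.
rewrite e1 e3; have h2 : `|s| * X <= X + s ^+ 2 * X.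
  by have := ler_wpM2r X0 s1; lra.
have h3 : 0 <= s ^+ 2 * X by rewrite mulr_ge0 ?sqr_ge0.
lra.
Qed.

(** The scheme of [moment_birkhoff] for [A_(k+1) = A_k o F + V * (S_k o F)]. The linear term is now
    [V] times [signed_powR q A_k * S_k] at the next point, and it is this product that is
    telescoped; the moments of [S] enter as a hypothesis. *)
Lemma moment_birkhoff2 q c D sigma : 2 < q -> 0 <= c -> 0 <= D -> 0 <= sigma ->
  exists2 C : R, 0 < C &
  forall d (T : measurableType d) (P : probability T R) (F : T -> T),
    measurable_fun setT F ->
    (forall A, measurable A -> P (F @^-1` A) = P A) ->
  forall a N U V W, q <= a -> weakly_dependent P F a c D N U V ->
    bddm W -> (forall x, `|W x| <= U x) ->
  forall n, (n <= N)%N ->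
    (forall j, (j <= n)%N ->
       mean P (fun x => `|birkhoff F W j x| `^ q) <= sigma * n%:R `^ (q / 2)) ->
    mean P (fun x => `|birkhoff2 F V W n x| `^ q) <= C * n%:R `^ q.
Proof.
move=> q2 c0 D0 sg0.
have q20 : 0 <= q - 2 by lra.
have q10 : 0 <= q - 1 by lra.
have q00 : 0 <= q by lra.
have r2 : q - 2 <= q by lra.
have r1 : q - 1 <= q by lra.
have r12 : q - 2 <= q - 1 by lra.
have r21 : q - 2 - q <= q - 1 - q by lra.
have qgt0 : 0 < q by lra.
have L0 : 0 <= 2 * sigma + 2 by lra.
have [C1 C10 HC1] := powR_norm_taylor q2.
have [C2 C20 HC2] := signed_powR_increment q2.
have C21 : 0 <= 2 * C2 + 1 by lra.
pose K := q * D * (2 * C2 + 1) + C1.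
have K0 : 0 < K by rewrite ltr_wpDl // !mulr_ge0.
pose L := 2 * sigma + 2.
exists (K * c * L * expR (K * c) + 1).
  by rewrite ltr_wpDl // !mulr_ge0 ?expR_ge0 // ?/L; lra.
move=> d T P F mF invF a N U V W qa wd bW WU.
have A0 : mean P (fun x => `|birkhoff2 F V W 0 x| `^ q) = 0.
  rewrite -[RHS](mean_cst P); congr mean; apply/funext => x.
  by rewrite normr0 powR0 // gt_eqF.
move=> [|n] nN HS.
  by rewrite A0 mulr_ge0 ?powR_ge0 // addr_ge0 // !mulr_ge0 ?expR_ge0 // ?/L; lra.
have a0 : 0 <= a by exact: le_trans qa.
set nn : R := n.+1%:R in HS *; have nn0 : 0 < nn by rewrite ltr0n.
have nn1 : 1 <= nn by rewrite ler1n.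
pose S := birkhoff F W; pose A := birkhoff2 F V W.
have bU := wd_bddU wd; have bV := wd_bddV wd.
have U1 := wd_U1 wd; have VU := wd_VU wd.
have U0 x : 0 <= U x by apply: le_trans (U1 x).
have bS k : bddm (S k) by exact: bddm_birkhoff.
have bSF k : bddm (fun x => S k (F x)) by exact: bddm_comp.
have bA k : bddm (A k) by exact: bddm_birkhoff2.
have bAF k : bddm (fun x => A k (F x)) by exact: bddm_comp.
have bUq : bddm (fun x => U x `^ q) by exact: bddm_powR.
have bSq k : bddm (fun x => `|S k x| `^ q) by exact: bddm_norm_powR.
have bAq k r : 0 <= r -> bddm (fun x => `|A k x| `^ r).
  by move=> r0; exact: bddm_norm_powR.
have bAS k : bddm (fun x => `|A k x| `^ (q - 2) * S k x ^+ 2).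
  by apply: bddmM; [exact: bAq|exact: bddmX].
(* The error allowed in one step: [n] of them make [n^q]. *)
pose Q := nn `^ (q - 1).
have Q1 : 1 <= Q by rewrite -[leLHS](powRr0 nn); apply: ler_powR.
have eQ : nn `^ (q / 2 - 1) * nn `^ (q / 2) = Q.
  rewrite -powRD; last by rewrite (gt_eqF nn0) implybT.
  by rewrite /Q; congr (_ `^ _); field.
have hQ : nn `^ (q / 2) <= Q by apply: ler_powR; [exact: nn1|by clear -q2; lra].
have rec k m : (k < n.+1)%N ->
    (forall j, (j <= k)%N -> mean P (fun x => `|A j x| `^ q) <= m) ->
    mean P (fun x => `|A k.+1 x| `^ q) <=
    mean P (fun x => `|A k x| `^ q) + m * nn^-1 * (K * c) + K * (c * (L * Q)).
  move=> kn Hm.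
  have m0 : 0 <= m.
    by apply: le_trans (Hm 0%N (leq0n _)); apply: mean_ge0 => x; exact: powR_ge0.
  have mn0 : 0 <= m * nn^-1 by rewrite divr_ge0 // ltW.
  have HmV j : (j <= k)%N -> mean P (fun x => `|A j x| `^ q) * nn^-1 <= m * nn^-1.
    by move=> jk; rewrite ler_wpM2r ?invr_ge0 ?(ltW nn0) //; exact: Hm.
  have HSk j : (j <= k)%N -> mean P (fun x => `|S j x| `^ q) <= sigma * Q.
    move=> jk; apply: le_trans (HS j _) _; first exact: leq_trans jk (ltnW kn).
    exact: ler_wpM2l.
  (* The mixed term is separated by [powR_sqr_le]: the weight [n^(q/2-1)] times the moment
     [sigma * n^(q/2)] of the simple sum is [sigma * Q]. *)
  have as2 j : (j <= k)%N ->
      mean P (fun x => `|A j x| `^ (q - 2) * S j x ^+ 2) <= m * nn^-1 + sigma * Q.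
    move=> jk; have b1 := bAq j q q00.
    apply: (@le_trans _ _ (mean P (fun x => nn^-1 * `|A j x| `^ q +
        nn `^ (q / 2 - 1) * `|S j x| `^ q))).
      apply: le_mean => //; first by apply: bddmD; exact: bddmZ.
      by move=> x; rewrite [nn^-1 * _]mulrC; exact: powR_sqr_le.
    rewrite meanD ?meanZ //; [|exact: bddmZ..].
    rewrite [nn^-1 * _]mulrC; apply: lerD; first exact: HmV.
    apply: (@le_trans _ _ (nn `^ (q / 2 - 1) * (sigma * nn `^ (q / 2)))).
      rewrite ler_wpM2l ?powR_ge0 //; apply: HS; exact: leq_trans jk (ltnW kn).
    by rewrite mulrCA eQ.
  have step : mean P (fun x => `|A k.+1 x| `^ q) <=
      mean P (fun x => `|A k x| `^ q)
      + q * mean P (fun x => V x * (signed_powR q (A k (F x)) * S k (F x)))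
      + C1 * (c * (m * nn^-1 + L * Q)).
    pose g x := `|A k x| `^ (q - 2) * S k x ^+ 2 + `|S k x| `^ q.
    have bg : bddm g by exact: bddmD.
    have g0 x : 0 <= g x.
      rewrite /g; apply: addr_ge0; last exact: powR_ge0.
      by apply: mulr_ge0; [exact: powR_ge0|exact: sqr_ge0].
    have bsg : bddm (fun x => V x * (signed_powR q (A k (F x)) * S k (F x))).
      by apply: bddmM => //; apply: bddmM => //; apply: bddm_signed_powR.
    have b1 := bAq k q q00.
    have b1F : bddm (fun x => `|A k (F x)| `^ q) by exact: bddm_comp mF b1.
    have bVS : bddm (fun x => V x * S k (F x)) by exact: bddmM.
    have bt : bddm (fun x => `|A k (F x)| `^ (q - 2) * (V x * S k (F x)) ^+ 2
                             + `|V x * S k (F x)| `^ q).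
      apply: bddmD; last exact: bddm_norm_powR.
      apply: bddmM; last exact: bddmX.
      exact: bddm_comp mF (bAq k _ q20).
    apply: (@le_trans _ _ (mean P (fun x => `|A k (F x)| `^ q +
       q * (V x * (signed_powR q (A k (F x)) * S k (F x))) +
       C1 * (`|A k (F x)| `^ (q - 2) * (V x * S k (F x)) ^+ 2
             + `|V x * S k (F x)| `^ q)))).
      apply: le_mean => //; first exact: bAq.
        by apply: bddmD; [apply: bddmD => //; exact: bddmZ|exact: bddmZ].
      move=> x; rewrite {1}/A /=; apply: le_trans (HC1 _ _) _.
      by rewrite -/(A k) -/(S k) -mulrA [signed_powR _ _ * _]mulrCA.
    rewrite meanD; last 2 first.
      by apply: bddmD => //; exact: bddmZ.
      exact: bddmZ.
    rewrite meanD; last 2 first.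
      by [].
      exact: bddmZ.
    rewrite !meanZ // (mean_comp mF invF b1) lerD2l ler_pM2l //.
    apply: (@le_trans _ _ (c * mean P g)).
      apply: (@mean_quasi _ _ _ _ _ mF _ _ _ _ _ _ wd a0 q) => //.
      move=> x; rewrite /g mulrDr lerD //.
        rewrite exprMn [leLHS]mulrCA; apply: ler_wpM2r.
          by apply: mulr_ge0; [exact: powR_ge0|exact: sqr_ge0].
        apply: (@le_trans _ _ (U x ^+ 2)).
          rewrite -(real_normK (num_real (V x))).
          by apply: lerXn2r; rewrite ?nnegrE.
        by rewrite -powR_mulrn // ler_powR // ltW.
      rewrite normrM powRM // ler_wpM2r ?powR_ge0 //.
      exact: ler_powR2l.
    rewrite ler_wpM2l // /g meanD //.
    have h1 := as2 k (leqnn k); have h2 := HSk k (leqnn k).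
    apply: (le_trans (lerD h1 h2)); rewrite -addrA lerD2l /L.
    by clear -sg0 Q1; nra.
  have cross : mean P (fun x => V x * (signed_powR q (A k (F x)) * S k (F x))) <=
      D * (c * ((2 * C2 + 1) * (m * nn^-1 + L * Q))).
    pose g j x := C2 * (`|A j x| `^ (q - 2) * S j x ^+ 2 + `|A j x| `^ (q - 2)
              + `|S j x| `^ q + 1) + `|A j x| `^ (q - 1).
    have b1 j : bddm (fun x => `|A j x| `^ (q - 2) * S j x ^+ 2
              + `|A j x| `^ (q - 2)) by apply: bddmD; [exact: bAS|exact: bAq].
    have b2 j : bddm (fun x => `|A j x| `^ (q - 2) * S j x ^+ 2
              + `|A j x| `^ (q - 2) + `|S j x| `^ q) by exact: bddmD.
    have b3 j : bddm (fun x => `|A j x| `^ (q - 2) * S j x ^+ 2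
              + `|A j x| `^ (q - 2) + `|S j x| `^ q + 1).
      by apply: bddmD => //; exact: bddm_cst.
    have bg j : bddm (g j) by apply: bddmD; [exact: bddmZ|exact: bAq].
    have g0 j x : 0 <= g j x.
      rewrite /g; apply: addr_ge0; last exact: powR_ge0.
      apply: mulr_ge0; first exact: ltW.
      do 3?[apply: addr_ge0 => //; try exact: powR_ge0].
      by apply: mulr_ge0; [exact: powR_ge0|exact: sqr_ge0].
    apply: (@mean_telescope_le _ _ _ _ _ mF _ _ _ _ _ _ wd
              (fun j x => signed_powR q (A j x) * S j x)) => //.
    - exact: leq_trans kn (leq_trans nN _).
    - by apply/funext => x; rewrite /S birkhoff0 mulr0.
    - by move=> j; apply: bddmM => //; apply: bddm_signed_powR.
    - move=> j jk; apply: (@le_trans _ _ (c * mean P (g j))).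
        apply: (@mean_quasi _ _ _ _ _ mF _ _ _ _ _ _ wd a0 q) => //.
          apply: bddm_norm; apply: bddmB; apply: bddmM => //;
            exact: bddm_signed_powR.
        move=> x; rewrite /S birkhoffS -/(S j) {1}/A /= -/(A j) -/(S j).
        exact: HC2.
      rewrite ler_wpM2l // /g meanD; [|exact: bddmZ|exact: bAq].
      rewrite meanZ // meanD //; last exact: bddm_cst.
      rewrite meanD // meanD; [|exact: bAS|exact: bAq].
      rewrite mean_cst.
      have h1 := as2 j (ltnW jk); have h2 := HSk j (ltnW jk).
      have h3 := mean_powR_lower P q20 r2 nn0 (bA j).
      have h4 := mean_powR_lower P q10 r1 nn0 (bA j).
      have h5 := HmV j (ltnW jk).
      have E : nn `^ (q - 1 - q) = nn^-1.
        have -> : q - 1 - q = - 1 by ring.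
        by rewrite powR_inv1 // ltW.
      have E2 : nn `^ (q - 2 - q) <= nn^-1.
        by rewrite -E; apply: ler_powR.
      rewrite E in h4.
      have h6 : mean P (fun x => `|A j x| `^ (q - 2)) <= m * nn^-1 + Q.
        apply: le_trans h3 _; apply: lerD; last exact: ler_powR.
        apply: le_trans h5; apply: ler_wpM2l => //.
        by apply: mean_ge0 => x; exact: powR_ge0.
      have h7 : mean P (fun x => `|A j x| `^ (q - 1)) <= m * nn^-1 + Q by apply: le_trans h4 _; rewrite lerD2r.
      apply: (@le_trans _ _ (C2 * (m * nn^-1 + sigma * Q + (m * nn^-1 + Q) + sigma * Q + Q)
         + (m * nn^-1 + Q))).
        by rewrite lerD // ler_pM2l // !lerD.
      have SQ : 0 <= sigma * Q by rewrite mulr_ge0 // (le_trans _ Q1).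
      clear h1 h2 h3 h4 h5 h6 h7 E E2.
      have -> : (2 * C2 + 1) * (m * nn^-1 + L * Q) = C2 * (2 * (m * nn^-1 + L * Q))
        + (m * nn^-1 + L * Q) by ring.
      have Q0 : 0 <= Q by exact: le_trans Q1.
      rewrite /L; move: (m * nn^-1) mn0 Q Q0 SQ {Q1 eQ hQ Hm HmV HSk as2 step} => X X0 Z Z0 SZ.
      apply: lerD; last by lra.
      rewrite ler_pM2l //; lra.
    - by apply: mulr_ge0 => //; apply: mulr_ge0 => //; apply: addr_ge0 => //;
        apply: mulr_ge0 => //; exact: le_trans Q1.
  apply: (le_trans step); rewrite -addrA -[leRHS]addrA lerD2l.
  have -> : m * nn^-1 * (K * c) + K * (c * (L * Q)) = K * (c * (m * nn^-1 + L * Q)).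
    by ring.
  rewrite /K [leRHS]mulrDl lerD2r.
  have -> : q * D * (2 * C2 + 1) * (c * (m * nn^-1 + L * Q)) =
      q * (D * (c * ((2 * C2 + 1) * (m * nn^-1 + L * Q)))) by ring.
  by rewrite ler_pM2l.
have := @discrete_gronwall R n.+1 (K * c) (K * (c * (L * Q)))
  (fun k => mean P (fun x => `|A k x| `^ q)) (ltn0Sn _).
move=> h; apply: le_trans (h _ _ _ rec) _.
- by rewrite mulr_ge0 // ltW.
- by rewrite !mulr_ge0 ?powR_ge0 // ltW.
- by rewrite /A A0.
have -> : nn `^ q = nn * Q by rewrite /Q powRS1 //; clear -q2; lra.
rewrite -/nn.
have -> : nn * (K * (c * (L * Q))) * expR (K * c) =
  (K * c * L * expR (K * c)) * (nn * Q) by ring.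
rewrite ler_wpM2r; [by []| |by clear; lra].
by rewrite mulr_ge0 ?powR_ge0 // ltW.
Qed.

Lemma powRD_le_linear q : 2 < q -> exists2 C : R, 0 < C &
  forall x y, 0 <= x -> 0 <= y ->
    (x + y) `^ q <= x `^ q + C * (x `^ (q - 1) * y + y `^ q).
Proof.
move=> q2; have [C1 C10 HC1] := powR_norm_taylor q2.
exists (q + 2 * C1); first lra.
move=> x y x0 y0; have := HC1 x y; rewrite /signed_powR !ger0_norm ?addr_ge0 //.
move=> h; apply: (le_trans h).
have e1 : x `^ (q - 1) = x `^ (q - 2) * x.
  by rewrite mulrC (@powRS1 _ _ (q - 1)) //; [congr (_ * _ `^ _); lra|lra].
have e2 : x `^ (q - 2) * y ^+ 2 <= x `^ (q - 1) * y + y `^ q.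
  have [xy|yx] := leP x y.
    apply: ler_wpDl; first by rewrite mulr_ge0 ?powR_ge0.
    rewrite (@powRS2 _ y q) //; last lra.
    rewrite mulrC ler_wpM2l ?sqr_ge0 // ler_powR2l //; lra.
  apply: ler_wpDr; first exact: powR_ge0.
  by rewrite e1 expr2 mulrA !ler_wpM2r ?ler_wpM2l ?powR_ge0 // ltW.
have e3 : 0 <= x `^ (q - 1) * y by rewrite mulr_ge0 ?powR_ge0.
have e4 : 0 <= y `^ q by exact: powR_ge0.
rewrite -e1 -[in leLHS]addrA lerD2l.
have := ler_wpM2l (ltW C10) e2.
have e5 : 0 <= q * y `^ q by rewrite mulr_ge0 //; lra.
have e6 : 0 <= C1 * (x `^ (q - 1) * y) by rewrite mulr_ge0 // ltW.
nra.
Qed.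

(** All terms are positive, so there is no cancellation to exploit: an expansion to first order and
    quasi-independence suffice. The threshold in the passage from order [q - 1] to order [q] is [n],
    in accordance with the growth [n^q]. *)
Lemma moment_birkhoff_sqr q c D : 2 < q -> 0 <= c ->
  exists2 C : R, 0 < C &
  forall d (T : measurableType d) (P : probability T R) (F : T -> T),
    measurable_fun setT F ->
    (forall A, measurable A -> P (F @^-1` A) = P A) ->
  forall a N U V, 2 <= a -> weakly_dependent P F a c D N U V ->
  forall n, mean P (fun x => birkhoff F (fun y => U y ^+ 2) n x `^ q) <=
    C * (n%:R `^ q + n%:R * mean P (fun x => U x `^ (2 * q))).
Proof.
move=> q2 c0; have [C1 C10 HC1] := powRD_le_linear q2.
exists (C1 * (c + 1) * expR (C1 * c)).
  by rewrite !mulr_gt0 ?expR_gt0 //; lra.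
move=> d T P F mF invF a N U V a2 wd.
pose Q := birkhoff F (fun y => U y ^+ 2).
have bU := wd_bddU wd; have U1 := wd_U1 wd.
have U0 x : 0 <= U x by apply: le_trans (U1 x).
have bU2 : bddm (fun y => U y ^+ 2) by exact: bddmX.
have Q0 : mean P (fun x => Q 0%N x `^ q) = 0.
  rewrite -[RHS](mean_cst P); congr mean; apply/funext => x.
  by rewrite /Q birkhoff0 powR0 // gt_eqF //; lra.
move=> [|n].
  rewrite Q0 mul0r addr0 !mulr_ge0 ?powR_ge0 ?expR_ge0 //; lra.
have a0 : 0 <= a by lra.
set nn : R := n.+1%:R; have nn0 : 0 < nn by rewrite ltr0n.
pose b := mean P (fun x => U x `^ (2 * q)).
have q10 : 0 <= q - 1 by lra.
have q00 : 0 <= q by lra.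
have Qge0 k x : 0 <= Q k x by apply: sumr_ge0 => i _; exact: sqr_ge0.
have bQ k : bddm (Q k) by exact: bddm_birkhoff.
have bQr k r : 0 <= r -> bddm (fun x => Q k x `^ r).
  by move=> r0; apply: bddm_powR.
have bQF k r : 0 <= r -> bddm (fun x => Q k (F x) `^ r).
  by move=> r0; exact: bddm_comp mF (bQr k r r0).
have b0 : 0 <= b by apply: mean_ge0 => x; exact: powR_ge0.
have bUq : bddm (fun x => U x `^ (2 * q)) by apply: bddm_powR => //; lra.
pose e := nn `^ (q - 1); have e0 : 0 <= e by exact: powR_ge0.
have rec k m : (k < n.+1)%N ->
    (forall j, (j <= k)%N -> mean P (fun x => Q j x `^ q) <= m) ->
    mean P (fun x => Q k.+1 x `^ q) <=
    mean P (fun x => Q k x `^ q) + m * nn^-1 * (C1 * c) + C1 * (c * e + b).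
  move=> _ Hm.
  have bt : bddm (fun x => Q k (F x) `^ (q - 1) * U x ^+ 2 + U x `^ (2 * q)).
    by apply: bddmD => //; apply: bddmM => //; exact: bQF.
  apply: (@le_trans _ _ (mean P (fun x => Q k (F x) `^ q +
      C1 * (Q k (F x) `^ (q - 1) * U x ^+ 2 + U x `^ (2 * q))))).
    apply: le_mean; first exact: bQr.
      by apply: bddmD; [exact: bQF|exact: bddmZ].
    move=> x; rewrite /Q birkhoffS -/(Q k) addrC.
    apply: le_trans (HC1 _ _ (Qge0 _ _) (sqr_ge0 _)) _.
    by rewrite -powR_mulrn // -powRrM.
  rewrite meanD; [|exact: bQF|exact: bddmZ].
  rewrite (mean_comp mF invF (bQr k _ q00)) -addrA lerD2l meanZ //.
  have -> : m * nn^-1 * (C1 * c) + C1 * (c * e + b) = C1 * (c * (m * nn^-1 + e) + b).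
    by ring.
  rewrite ler_pM2l // meanD //; last by apply: bddmM => //; exact: bQF.
  rewrite lerD2r; apply: (@le_trans _ _ (c * mean P (fun x => Q k x `^ (q - 1)))).
    apply: (@mean_quasi _ _ _ _ _ mF _ _ _ _ _ _ wd a0 2) => //.
    - exact: bQr.
    - by move=> x; exact: powR_ge0.
    - by apply: bddmM => //; exact: bQF.
    - by move=> x; rewrite mulrC powR_mulrn.
  rewrite ler_wpM2l //.
  have r1 : q - 1 <= q by lra.
  have := mean_powR_lower P q10 r1 nn0 (bQ k).
  have -> : (fun x => `|Q k x| `^ (q - 1)) = (fun x => Q k x `^ (q - 1)).
    by apply/funext => x; rewrite ger0_norm.
  have -> : (fun x => `|Q k x| `^ q) = (fun x => Q k x `^ q).
    by apply/funext => x; rewrite ger0_norm.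
  have -> : q - 1 - q = - 1 by ring.
  rewrite powR_inv1 ?(ltW nn0) // => h; apply: le_trans h _.
  by rewrite lerD2r ler_wpM2r ?invr_ge0 ?(ltW nn0) //; exact: Hm.
have := @discrete_gronwall R n.+1 (C1 * c) (C1 * (c * e + b))
  (fun k => mean P (fun x => Q k x `^ q)) (ltn0Sn _).
move=> h; apply: le_trans (h _ _ _ rec) _.
- by rewrite mulr_ge0 // ltW.
- apply: mulr_ge0; first exact: ltW.
  by rewrite addr_ge0 ?mulr_ge0.
- by rewrite Q0.
have -> : nn `^ q = nn * e by rewrite /e powRS1 //; clear -q2; lra.
rewrite -/nn -/b.
have -> : nn * (C1 * (c * e + b)) * expR (C1 * c) =
  C1 * expR (C1 * c) * (nn * (c * e + b)) by ring.
have -> : C1 * (c + 1) * expR (C1 * c) * (nn * e + nn * b) =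
  C1 * expR (C1 * c) * (nn * ((c + 1) * (e + b))) by ring.
rewrite ler_pM2l; last by rewrite mulr_gt0 ?expR_gt0.
rewrite ler_pM2l //; have cb : 0 <= c * b by rewrite mulr_ge0.
clear -cb e0; lra.
Qed.

End MomentBounds2.

(** * Maximal inequalities *)

Section MaximalInequalities.
Context {R : realType}.
Implicit Types (a q c D B delta : R).

(* Doubling the time horizon multiplies the [q]-th moment of the running maximum by
   at most [1 + 2 `^ delta < 2 `^ (1 + delta)], up to the error [h]. *)
Lemma mean_runmax_dyadic q delta : 0 < q -> 0 < delta ->
  exists2 C : R, 0 < C &
  forall d (T : measurableType d) (P : probability T R) (F : T -> T),
    measurable_fun setT F ->
    (forall A, measurable A -> P (F @^-1` A) = P A) ->
  forall (f h : nat -> T -> R) (L : R) (r0 : nat),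
    (forall k, bddm (f k)) -> (forall k, bddm (h k)) ->
    (forall k x, 0 <= h k x) ->
    (forall r x j, (r < r0)%N -> (j <= 2 ^ r)%N ->
       `|f (2 ^ r + j)%N x| <= h r x + `|f j (iter (2 ^ r) F x)|) ->
    (forall r, (r < r0)%N ->
       mean P (fun x => h r x `^ q) <= L * (2 ^ r)%:R `^ (1 + delta)) ->
    mean P (fun x => runmax f 1 x `^ q) <= L ->
  mean P (fun x => runmax f (2 ^ r0) x `^ q) <= C * L * (2 ^ r0)%:R `^ (1 + delta).
Proof.
move=> q0 delta0; pose t : R := 2 `^ delta.
have t1 : 1 < t.
  by rewrite /t /powR gt_eqF // expR_gt1 mulr_gt0 // ln_gt0 //; lra.
have [C1 C10 HC1] := powRD_le_weighted q0 t1.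
(* The recursion requires [X * (1 + t) + C1 <= 2 * t * X], that is [C1 <= X * (t - 1)]; the summand
   1 makes [X >= 1], which starts the induction. *)
pose X := C1 / (t - 1) + 1; exists X.
  by rewrite /X addr_gt0 // divr_gt0 //; lra.
move=> d T P F mF invF f h L r0 bf bh h0 fh hL f1.
have L0 : 0 <= L.
  by apply: le_trans f1; apply: mean_ge0 => x; exact: powR_ge0.
have q00 : 0 <= q by exact: ltW.
have bM n : bddm (runmax f n) by exact: bddm_runmax.
have M0 n x : 0 <= runmax f n x by exact: runmax_ge0.
have bMq n : bddm (fun x => runmax f n x `^ q) by exact: bddm_powR.
have bhq n : bddm (fun x => h n x `^ q) by exact: bddm_powR.
suff claim r : (r <= r0)%N -> mean P (fun x => runmax f (2 ^ r) x `^ q)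
    <= X * L * (2 ^ r)%:R `^ (1 + delta) by exact: claim.
elim: r => [_|r IH rr0].
  rewrite expn0 powR1 mulr1; apply: le_trans f1 _.
  by rewrite ler_peMl // /X lerDr divr_ge0 //; lra.
have {}IH := IH (ltnW rr0).
pose Y := (2 ^ r)%:R `^ (1 + delta) : R.
have Y0 : 0 <= Y by exact: powR_ge0.
have -> : (2 ^ r.+1)%:R `^ (1 + delta) = 2 * t * Y :> R.
  rewrite expnS natrM powRM // powRD ?powRr1 //.
  by rewrite pnatr_eq0 implybT.
have step x : runmax f (2 ^ r.+1) x `^ q <= runmax f (2 ^ r) x `^ q +
    (t * runmax f (2 ^ r) (iter (2 ^ r) F x) `^ q + C1 * h r x `^ q).
  have hm : runmax f (2 ^ r.+1) x <= Num.max (runmax f (2 ^ r) x)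
      (h r x + runmax f (2 ^ r) (iter (2 ^ r) F x)).
    apply: runmax_le => i; rewrite expnS mul2n -addnn => ir.
    have [ir2|ir2] := leqP i (2 ^ r); first by rewrite le_max runmax_ge.
    have -> : i = (2 ^ r + (i - 2 ^ r))%N by rewrite subnKC // ltnW.
    have ji : (i - 2 ^ r <= 2 ^ r)%N by rewrite leq_subLR.
    rewrite le_max; apply/orP; right.
    apply: (le_trans (fh _ _ _ rr0 ji)); rewrite lerD2l.
    exact: runmax_ge.
  have p0 n y : 0 <= runmax f n y `^ q by exact: powR_ge0.
  have p1 : 0 <= h r x `^ q by exact: powR_ge0.
  apply: le_trans (ler_powR2l q00 (M0 _ _) hm) _.
  have [_|_] := leP (runmax f (2 ^ r) x) _.
    rewrite ler_wpDl //; exact: HC1.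
  by rewrite lerDl addr_ge0 // mulr_ge0 // ltW // (lt_trans _ t1).
have bMF : bddm (fun x => runmax f (2 ^ r) (iter (2 ^ r) F x) `^ q).
  exact: bddm_iter mF _ _ (bMq _).
have b1 : bddm (fun x => t * runmax f (2 ^ r) (iter (2 ^ r) F x) `^ q
    + C1 * h r x `^ q) by apply: bddmD; exact: bddmZ.
apply: (le_trans (le_mean P (bMq _) (bddmD (bMq _) b1) step)).
rewrite meanD // meanD; [|exact: bddmZ..].
rewrite !meanZ //.
rewrite (mean_iter mF invF (2 ^ r)%N (bMq (2 ^ r)%N)).
have h1 := hL r rr0; rewrite -/Y in h1 IH.
have h2 : C1 * mean P (fun x => h r x `^ q) <= C1 * (L * Y) by rewrite ler_pM2l.
have t0 : 0 < t by exact: lt_trans t1.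
have h3 : t * mean P (fun x => runmax f (2 ^ r) x `^ q) <= t * (X * L * Y).
  by rewrite ler_pM2l.
apply: (le_trans (lerD IH (lerD h3 h2))).
have e1 : C1 = (X - 1) * (t - 1).
  by rewrite /X addrK divfK // gt_eqF // subr_gt0.
have LY : 0 <= (t - 1) * (L * Y) by rewrite mulr_ge0 ?mulr_ge0 // subr_ge0 ltW.
rewrite -subr_ge0.
have -> : X * L * (2 * t * Y) - (X * L * Y + (t * (X * L * Y) + C1 * (L * Y))) =
  (t - 1) * (L * Y) by rewrite e1; ring.
exact: LY.
Qed.

(** Growth faster than [k^(1+delta)] is brought to the exponent of the dyadic argument, the excess
    being charged to the final horizon [N]. *)
Lemma powR_interpolate (k N : R) (e delta : R) : 1 <= k -> k <= N -> 1 + delta <= e ->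
  k `^ e <= N `^ (e - 1 - delta) * k `^ (1 + delta).
Proof.
move=> k1 kN de; have k0 : 0 < k by lra.
have -> : e = (e - 1 - delta) + (1 + delta) by ring.
rewrite powRD; last by rewrite (gt_eqF k0) implybT.
have -> : e - 1 - delta + (1 + delta) - 1 - delta = e - 1 - delta by ring.
by rewrite ler_wpM2r ?powR_ge0 // ler_powR2l //; lra.
Qed.

(** The dyadic error at scale [2^r] is the sum over the first block, estimated by [moment_birkhoff].
    The hypothesis on [U] refers to the horizon [2^r0] but serves every smaller scale; at [r = r0]
    the bound [Z] is the expected [N^(q/2)]. *)
Lemma moment_runmax_birkhoff q c D B delta : 2 < q -> 0 <= c -> 0 <= D -> 0 <= B ->
  0 < delta -> 1 + delta <= q / 2 ->
  exists2 C : R, 0 < C &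
  forall d (T : measurableType d) (P : probability T R) (F : T -> T),
    measurable_fun setT F ->
    (forall A, measurable A -> P (F @^-1` A) = P A) ->
  forall a r0 U V, 2 <= a -> weakly_dependent P F a c D (2 ^ r0) U V ->
  mean P (fun x => U x `^ q) <= B * (2 ^ r0)%:R `^ (q / 2 - 1 - delta) ->
  forall r, (r <= r0)%N ->
    let Z := (2 ^ r0)%:R `^ (q / 2 - 1 - delta) * (2 ^ r)%:R `^ (1 + delta) in
    mean P (fun x => `|birkhoff F V (2 ^ r) x| `^ q) <= C * Z /\
    mean P (fun x => runmax (birkhoff F V) (2 ^ r) x `^ q) <= C * Z.
Proof.
move=> q2 c0 D0 B0 delta0 deltaq.
have [C1 C10 HC1] := moment_birkhoff q2 c0 D0.
have q0 : 0 < q by lra.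
have [C2 C20 HC2] := mean_runmax_dyadic q0 delta0.
pose L := C1 * (1 + B); have L0 : 0 < L by rewrite mulr_gt0 //; lra.
exists (L + C2 * L); first by rewrite addr_gt0 // mulr_gt0.
move=> d T P F mF invF a r0 U V a2 wd HU.
set N : R := (2 ^ r0)%:R in HU *; set K := N `^ (q / 2 - 1 - delta) in HU *.
have K0 : 0 <= K by exact: powR_ge0.
have S_bound r : (r <= r0)%N ->
    mean P (fun x => `|birkhoff F V (2 ^ r) x| `^ q) <=
    L * K * (2 ^ r)%:R `^ (1 + delta).
  move=> rr0; apply: le_trans (HC1 _ _ _ _ mF invF _ _ _ _ a2 wd _ _) _.
    by rewrite leq_exp2l.
  rewrite /L -!mulrA ler_pM2l //.
  have k1 : 1 <= (2 ^ r)%:R :> R by rewrite ler1n expn_gt0.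
  have kN : (2 ^ r)%:R <= N by rewrite ler_nat leq_exp2l.
  have h1 := powR_interpolate k1 kN deltaq; rewrite -/K in h1.
  rewrite [leRHS]mulrDl mul1r lerD //.
  have h2 : (2 ^ r)%:R <= (2 ^ r)%:R `^ (1 + delta) :> R.
    by apply: le1r_powR => //; lra.
  rewrite mulrA [leRHS]mulrC; apply: ler_pM => //.
  by apply: mean_ge0 => x; exact: powR_ge0.
move=> r rr0 Z; have Z0 : 0 <= Z by rewrite mulr_ge0 ?powR_ge0.
have bV := wd_bddV wd.
split.
  apply: le_trans (S_bound r rr0) _; rewrite -mulrA -/Z ler_wpM2r // lerDl.
  by rewrite mulr_ge0 // ltW.
apply: (@le_trans _ _ (C2 * (L * K) * (2 ^ r)%:R `^ (1 + delta))); last first.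
  have -> : C2 * (L * K) * (2 ^ r)%:R `^ (1 + delta) = C2 * L * Z.
    by rewrite /Z; ring.
  by rewrite ler_wpM2r // lerDr ltW.
apply: (HC2 _ _ _ _ mF invF _ (fun r x => `|birkhoff F V (2 ^ r) x|)).
- by move=> k; exact: bddm_birkhoff.
- by move=> k; apply: bddm_norm; exact: bddm_birkhoff.
- by [].
- by move=> s x j sr _; rewrite birkhoffD ler_normD.
- by move=> s sr; apply: S_bound; exact: leq_trans (ltnW sr) rr0.
- have Sb := S_bound 0%N (leq0n _); rewrite expn0 powR1 mulr1 in Sb.
  apply: le_trans Sb; rewrite le_eqVlt; apply/orP; left; apply/eqP.
  by congr mean; apply/funext => x /=; rewrite birkhoff0 normr0 max_r.
Qed.

(** The power of the maximum is at most the sum of the powers; [N + 1 <= 2 * N] explains the factor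
    2. *)
Lemma moment_runmax_comp q (B e : R) : 0 < q -> 0 <= B -> 0 <= e ->
  forall d (T : measurableType d) (P : probability T R) (F : T -> T),
    measurable_fun setT F ->
    (forall A, measurable A -> P (F @^-1` A) = P A) ->
  forall N U, (0 < N)%N -> bddm U -> mean P (fun x => `|U x| `^ q) <= B * N%:R `^ (e - 1) ->
  mean P (fun x => runmax (fun k y => U (iter k F y)) N x `^ q) <= 2 * B * N%:R `^ e.
Proof.
move=> q0 B0 e0 d T P F mF invF N U N0 bU HU.
have q00 : 0 <= q by exact: ltW.
have bUq : bddm (fun x => `|U x| `^ q) by exact: bddm_norm_powR.
have bUF k : bddm (fun x => `|U (iter k F x)| `^ q) by exact: (bddm_iter mF _ bUq).
apply: (@le_trans _ _ (mean P (fun x => \sum_(k < N.+1) `|U (iter k F x)| `^ q))).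
  apply: le_mean.
  - apply: bddm_powR => //; last by move=> x; exact: runmax_ge0.
    by apply: bddm_runmax => k; exact: bddm_iter.
  - exact: bddm_sum.
  - move=> x; have : forall n, runmax (fun k y => U (iter k F y)) n x `^ q <=
        \sum_(k < n.+1) `|U (iter k F x)| `^ q.
      elim=> [|n IH]; first by rewrite big_ord1.
      rewrite big_ord_recr /= maxEle; case: ifP => _.
        by rewrite ler_wpDl // sumr_ge0 // => i _; exact: powR_ge0.
      by apply: le_trans IH _; rewrite lerDl powR_ge0.
    exact.
rewrite mean_sum //.
under eq_bigr => i _ do rewrite (mean_iter mF invF i bUq).
rewrite sumr_const card_ord -[leLHS]mulr_natl.
have N0' : 0 < N%:R :> R by rewrite ltr0n.
apply: (@le_trans _ _ (N.+1%:R * (B * N%:R `^ (e - 1)))); first by rewrite ler_wpM2l.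
have [e1|e1] := eqVneq e 0.
  rewrite e1 powRr0 mulr1 sub0r powR_inv1 //.
  rewrite mulrCA [leRHS]mulrC ler_wpM2l // ler_pdivrMr // -natrM ler_nat.
  by rewrite mul2n -addnn -addn1 leq_add2l.
have egt0 : 0 < e by rewrite lt_neqAle eq_sym e1.
rewrite (@powRS1 _ N%:R e) // !mulrA ler_wpM2r ?powR_ge0 //.
rewrite [leRHS]mulrAC ler_wpM2r // -natrM ler_nat.
by rewrite mul2n -addnn -addn1 leq_add2l.
Qed.

(** By Chen's relation, a product of simple sums over two consecutive blocks appears at every
    doubling. Its [q]-th moment is controlled by moments of order [2 * q] of the simple sums, whence
    the second hypothesis on [U]. *)
Lemma moment_runmax_birkhoff2 q c D B delta : 2 < q -> 0 <= c -> 0 <= D -> 0 <= B ->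
  0 < delta -> 1 + delta <= q ->
  exists2 C : R, 0 < C &
  forall d (T : measurableType d) (P : probability T R) (F : T -> T),
    measurable_fun setT F ->
    (forall A, measurable A -> P (F @^-1` A) = P A) ->
  forall a r0 U V W, q <= a -> weakly_dependent P F a c D (2 ^ r0) U V ->
  weakly_dependent P F a c D (2 ^ r0) U W ->
  mean P (fun x => U x `^ q) <= B ->
  mean P (fun x => U x `^ (2 * q)) <= B * (2 ^ r0)%:R `^ (q - 1 - delta) ->
  mean P (fun x => runmax (birkhoff2 F V W) (2 ^ r0) x `^ q) <= C * (2 ^ r0)%:R `^ q.
Proof.
move=> q2 c0 D0 B0 delta0 deltaq.
have q0 : 0 < q by lra.
have qq2 : 2 < 2 * q by lra.
have hd : 1 + delta <= 2 * q / 2 by lra.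
have [C1 C10 HC1] := moment_birkhoff q2 c0 D0.
have [C2 C20 HC2] := mean_runmax_dyadic q0 delta0.
have [C3 C30 HC3] := moment_runmax_birkhoff qq2 c0 D0 B0 delta0 hd.
have sg0 : 0 <= C1 * (1 + B) by rewrite mulr_ge0 // ?addr_ge0 // ltW.
have [C4 C40 HC4] := moment_birkhoff2 q2 c0 D0 sg0.
pose L := 2 `^ q * (C4 + 2 * C3).
have L0 : 0 < L by rewrite mulr_gt0 ?powR_gt0 //; lra.
exists (C2 * L); first by rewrite mulr_gt0.
move=> d T P F mF invF a r0 U V W qa wdV wdW HU HU2.
have a2 : 2 <= a by exact: le_trans (ltW q2) qa.
set N : R := (2 ^ r0)%:R in HU2 *; set K := N `^ (q - 1 - delta) in HU2 *.
have K0 : 0 <= K by exact: powR_ge0.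
have N1 : 1 <= N by rewrite ler1n expn_gt0.
have e2q : 2 * q / 2 = q by field.
have HU2' : mean P (fun x => U x `^ (2 * q)) <= B * N `^ (2 * q / 2 - 1 - delta).
  by rewrite e2q.
have bU := wd_bddU wdV; have bV := wd_bddV wdV; have bW := wd_bddV wdW.
have VU := wd_VU wdV; have WU := wd_VU wdW.
have q00 : 0 <= q by exact: ltW.
have qq00 : 0 <= 2 * q by exact: mulr_ge0.
have b0 : 0 <= mean P (fun x => U x `^ q) by apply: mean_ge0 => x; exact: powR_ge0.
have A_bound n : (0 < n <= 2 ^ r0)%N ->
    mean P (fun x => `|birkhoff2 F V W n x| `^ q) <= C4 * n%:R `^ q.
  move=> /andP[n0 nN]; apply: (HC4 _ _ _ _ mF invF _ _ _ _ _ qa wdV bW WU _ nN) => j jn.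
  apply: le_trans (HC1 _ _ _ _ mF invF _ _ _ _ a2 wdW _ (leq_trans jn nN)) _.
  rewrite -mulrA ler_pM2l // mulrDl mul1r.
  have jn' : j%:R <= n%:R :> R by rewrite ler_nat.
  apply: lerD; first by apply: ler_powR2l => //; clear -q2; lra.
  rewrite mulrC; apply: ler_pM => //.
  apply: le_trans jn' _; apply: le1r_powR; first by rewrite ler1n.
  by clear -q2; lra.
have r0_pow r : (r <= r0)%N -> 1 <= (2 ^ r)%:R :> R /\ (2 ^ r)%:R <= N.
  by move=> rr0; rewrite ler1n expn_gt0 ler_nat leq_exp2l.
have -> : C2 * L * N `^ q = C2 * (L * K) * N `^ (1 + delta).
  have -> : N `^ q = K * N `^ (1 + delta).
    rewrite /K -powRD; first by congr (_ `^ _); ring.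
    by apply/implyP => _; rewrite gt_eqF // (lt_le_trans _ N1).
  by ring.
have bS k X : bddm X -> bddm (birkhoff F X k) by move=> bX; exact: bddm_birkhoff.
have bA k : bddm (birkhoff2 F V W k) by exact: bddm_birkhoff2.
have bM k : bddm (runmax (birkhoff F W) k) by apply: bddm_runmax => i; exact: bS.
(* What [birkhoff2D] adds to the iterated sum over the second block; the maximum makes it
   independent of the length of that block. *)
pose h r x := `|birkhoff2 F V W (2 ^ r) x| +
  `|birkhoff F V (2 ^ r) x| * runmax (birkhoff F W) (2 ^ r) (iter (2 ^ r) F x).
have bMF r : bddm (fun x => runmax (birkhoff F W) (2 ^ r) (iter (2 ^ r) F x)).
  exact: bddm_iter mF _ _ (bM _).
apply: (HC2 _ _ _ _ mF invF _ h).
- exact: bA.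
- move=> r; apply: bddmD; first exact: bddm_norm.
  by apply: bddmM => //; apply: bddm_norm; exact: bS.
- by move=> r x; rewrite addr_ge0 // mulr_ge0 // runmax_ge0.
- move=> r x j rr0 jr; rewrite birkhoff2D /h.
  rewrite addrAC; apply: le_trans (ler_normD _ _) _; rewrite lerD2r.
  apply: le_trans (ler_normD _ _) _; rewrite lerD2l normrM ler_wpM2l //.
  exact: runmax_ge.
- move=> r rr0; have [k1 kN] := r0_pow r (ltnW rr0).
  have [Sb _] := HC3 _ _ _ _ mF invF _ _ _ _ a2 wdV HU2' r (ltnW rr0).
  have [_ Mb] := HC3 _ _ _ _ mF invF _ _ _ _ a2 wdW HU2' r (ltnW rr0).
  rewrite e2q -/K -/N in Sb Mb.
  have Ab : mean P (fun x => `|birkhoff2 F V W (2 ^ r) x| `^ q) <=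
      C4 * (K * (2 ^ r)%:R `^ (1 + delta)).
    apply: le_trans (A_bound _ _) _; first by rewrite expn_gt0 leq_exp2l //= (ltnW rr0).
    by rewrite ler_pM2l //; exact: powR_interpolate.
  have b1 : bddm (fun x => `|birkhoff2 F V W (2 ^ r) x| `^ q).
    exact: bddm_norm_powR.
  have b2 : bddm (fun x => `|birkhoff F V (2 ^ r) x| `^ (2 * q)).
    by apply: bddm_norm_powR => //; exact: bS.
  have b3 : bddm (fun x => runmax (birkhoff F W) (2 ^ r) x `^ (2 * q)).
    by apply: bddm_powR => // x; exact: runmax_ge0.
  have b3F : bddm (fun x =>
      runmax (birkhoff F W) (2 ^ r) (iter (2 ^ r) F x) `^ (2 * q)).
    exact: (bddm_iter mF _ b3).
  apply: (@le_trans _ _ (mean P (fun x => 2 `^ q *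
      (`|birkhoff2 F V W (2 ^ r) x| `^ q + (`|birkhoff F V (2 ^ r) x| `^ (2 * q)
       + runmax (birkhoff F W) (2 ^ r) (iter (2 ^ r) F x) `^ (2 * q)))))).
    apply: le_mean.
    + apply: bddm_powR => //.
        apply: bddmD; first exact: bddm_norm.
        by apply: bddmM => //; apply: bddm_norm; exact: bS.
      by move=> x; rewrite addr_ge0 // mulr_ge0 // runmax_ge0.
    + by apply: bddmZ; apply: bddmD => //; exact: bddmD.
    + move=> x; set s := `|birkhoff F V (2 ^ r) x|.
      set m := runmax _ _ _; have m0 : 0 <= m by exact: runmax_ge0.
      have s0 : 0 <= s by exact: normr_ge0.
      apply: le_trans (powRD_le q00 _ _) _ => //; first by rewrite mulr_ge0.
      rewrite ler_wpM2l ?powR_ge0 // lerD2l.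
      have sq y : 0 <= y -> y `^ (2 * q) = (y * y) `^ q.
        by move=> y0; rewrite powRrM powR_mulrn.
      rewrite !sq //; have [sm|ms] := leP s m.
        rewrite ler_wpDl ?powR_ge0 // ler_powR2l ?mulr_ge0 //.
        by rewrite ler_wpM2r.
      rewrite ler_wpDr ?powR_ge0 // ler_powR2l ?mulr_ge0 //.
      by rewrite ler_wpM2l // ltW.
  rewrite meanZ; last by apply: bddmD => //; exact: bddmD.
  rewrite meanD //; last exact: bddmD.
  rewrite meanD // (mean_iter mF invF (2 ^ r)%N b3).
  rewrite /L -!mulrA ler_wpM2l ?powR_ge0 //.
  apply: (le_trans (lerD Ab (lerD Sb Mb))).
  by rewrite le_eqVlt; apply/orP; left; apply/eqP; ring.
- have [k1 kN] := r0_pow 0%N (leq0n _).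
  have Ab : mean P (fun x => `|birkhoff2 F V W 1 x| `^ q) <= C4 * K.
    apply: le_trans (A_bound 1%N _) _; first by rewrite expn_gt0.
    rewrite powR1 mulr1 ler_peMr ?(ltW C40) //.
    by rewrite -[leLHS](powRr0 N); apply: ler_powR => //; clear -deltaq; lra.
  apply: (@le_trans _ _ (C4 * K)); last first.
    rewrite ler_wpM2r // /L.
    have t1 : 1 <= 2 `^ q :> R.
      by rewrite -[leLHS](powRr0 2); apply: ler_powR => //; rewrite ler1n.
    have C34 : 0 <= C4 + 2 * C3 by rewrite addr_ge0 ?mulr_ge0 // ltW.
    have := ler_wpM2r C34 t1; clear -C30 C40; lra.
  apply: le_trans Ab; rewrite le_eqVlt; apply/orP; left; apply/eqP.
  by congr mean; apply/funext => x /=; rewrite normr0 max_r.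
Qed.

End MaximalInequalities.

(** * Cylinders of the induced map *)

Section Cylinders.
Context {dM : measure_display} {M : measurableType dM}.
Variables (Y : set M) (F : M -> M) (I : set nat) (Yj : nat -> set M).
Hypothesis mY : measurable Y.
Hypothesis FY : forall y, Y y -> Y (F y).
Hypothesis part : is_partition Y I Yj.
Hypothesis mF : forall A, measurable A -> measurable (Y `&` F @^-1` A).

(** Indices outside [I] yield the empty set, so that letters and words range over all natural
    numbers and countable unions need no subtype. *)
Definition branch_preimage j (A : set M) : set M :=
  if `[< I j >] then Yj j `&` F @^-1` A else set0.

Fixpoint wcyl (w : seq nat) : set M :=
  if w is j :: w' then branch_preimage j (wcyl w') else Y.

Definition cyl_eq k (y y' : M) : Prop :=
  exists w, [/\ size w = k, wcyl w y & wcyl w y'].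

Lemma piece_sub j : I j -> Yj j `<=` Y.
Proof. by have [h _ _] := part => Ij; have [] := h j Ij. Qed.

Lemma branch_preimage_sub j A : branch_preimage j A `<=` Y.
Proof.
by rewrite /branch_preimage; case: asboolP => [Ij y [/(piece_sub Ij)]|_ y []].
Qed.

Lemma measurable_branch_preimage j A :
  measurable A -> measurable (branch_preimage j A).
Proof.
move=> mA; rewrite /branch_preimage; case: asboolP => // Ij.
have -> : Yj j `&` F @^-1` A = Yj j `&` (Y `&` F @^-1` A).
  by rewrite setIA (setIidl (piece_sub Ij)).
by apply: measurableI; [case: part => h _ _; case: (h j Ij)|exact: mF].
Qed.

Lemma wcyl_sub w : wcyl w `<=` Y.
Proof. by case: w => // j w; exact: branch_preimage_sub. Qed.

Lemma measurable_wcyl w : measurable (wcyl w).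
Proof. by elim: w => // j w IH; exact: measurable_branch_preimage. Qed.

Lemma branch_preimageS j (A B : set M) :
  A `<=` B -> branch_preimage j A `<=` branch_preimage j B.
Proof.
by move=> AB; rewrite /branch_preimage; case: asboolP => [_ y [Yy /AB]|_ y []].
Qed.

Lemma bigcup_branch_preimage A :
  \bigcup_j branch_preimage j A = Y `&` F @^-1` A.
Proof.
apply/seteqP; split => [y [j _]|y [Yy FyA]].
  rewrite /branch_preimage; case: asboolP => [Ij [Yjy FyA]|_ []].
  by split => //; exact: piece_sub Yjy.
case: (part) => _ _ YE; have := Yy; rewrite YE => -[j Ij Yjy].
by exists j => //; rewrite /branch_preimage asboolT.
Qed.

Lemma trivIset_branch_preimage A :
  trivIset setT (fun j => branch_preimage j A).
Proof.
move=> i j _ _ [y []]; rewrite /branch_preimage.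
case: asboolP => [Ii|_ []//]; case: asboolP => [Ij|_ ? []//] [Yi _] [Yjy _].
apply: contrapT => ij; case: part => _ dis _.
by have : (Yj i `&` Yj j) y by []; rewrite (dis i j Ii Ij ij).
Qed.

Lemma wcyl_exists k y : Y y -> exists2 w, size w = k & wcyl w y.
Proof.
elim: k y => [|k IH] y Yy; first by exists [::].
have [w wk wFy] := IH _ (FY Yy).
have : (\bigcup_j branch_preimage j (wcyl w)) y.
  by rewrite bigcup_branch_preimage.
by move=> [j _ yj]; exists (j :: w) => //=; rewrite wk.
Qed.

(* Sets that are open for the topology of cylinders are countable unions of cylinders. *)
Lemma measurable_cylinder_open (U : set M) : U `<=` Y ->
  (forall y, U y -> exists k, forall y', cyl_eq k y y' -> U y') -> measurable U.
Proof.
move=> UY openU.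
have -> : U = \bigcup_(w in [set w | wcyl w `<=` U]) wcyl w.
  apply/seteqP; split => [y Uy|y [w wU wy]]; last exact: wU.
  have [k kU] := openU y Uy; have [w wk wy] := wcyl_exists k (UY _ Uy).
  by exists w => // y' wy'; apply: kU; exists w.
rewrite bigcup_mkcond; apply: countable_bigcupT_measurable => // w.
by case: ifP => // _; exact: measurable_wcyl.
Qed.

Lemma cyl_eq_sub k y y' : cyl_eq k y y' -> Y y /\ Y y'.
Proof. by move=> [w [_ /wcyl_sub ? /wcyl_sub]]. Qed.

Lemma cyl_eqS k y y' : cyl_eq k.+1 y y' ->
  same_piece I Yj y y' /\ cyl_eq k (F y) (F y').
Proof.
move=> [[|j w] [//= [wk]]]; rewrite /branch_preimage.
case: asboolP => [Ij|_ []//] [Yjy Fy] [Yjy' Fy']; split; first by exists j.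
by exists w.
Qed.

Lemma cyl_eq_same_piece k y y' : cyl_eq k y y' ->
  forall i, (i < k)%N -> same_piece I Yj (iter i F y) (iter i F y').
Proof.
elim: k y y' => [//|k IH] y y' /cyl_eqS[yy' /IH h] [|i] ik //.
by rewrite !iterSr; exact: h.
Qed.

Lemma cyl_eq_le k l y y' : (l <= k)%N -> cyl_eq k y y' -> cyl_eq l y y'.
Proof.
elim: l k y y' => [|l IH] k y y'.
  by move=> _ /cyl_eq_sub[Yy Yy']; exists [::].
case: k => // k lk /cyl_eqS[[j [Ij yj yj']]] /(IH k _ _ lk)[w [wl Fy Fy']].
by exists (j :: w); split => //=; rewrite ?wl // /branch_preimage asboolT.
Qed.

Lemma cyl_eq_sym k y y' : cyl_eq k y y' -> cyl_eq k y' y.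
Proof. by move=> [w [? ? ?]]; exists w. Qed.

Lemma cyl_eq_refl k y : Y y -> cyl_eq k y y.
Proof. by move=> Yy; have [w ? ?] := wcyl_exists k Yy; exists w. Qed.

Lemma wcyl_inj w w' y : size w = size w' -> wcyl w y -> wcyl w' y -> w = w'.
Proof.
elim: w w' y => [|j w IH] [|j' w'] y //= [ww'].
rewrite /branch_preimage; case: asboolP => [Ij|_ []//] [Yjy Fy].
case: asboolP => [Ij'|_ []//] [Yjy' Fy'].
rewrite (IH _ _ ww' Fy Fy'); congr cons; apply: contrapT => jj'.
case: part => _ dis _.
by have : (Yj j `&` Yj j') y by []; rewrite (dis j j' Ij Ij' jj').
Qed.

Lemma cyl_eq_trans k y1 y2 y3 : cyl_eq k y1 y2 -> cyl_eq k y2 y3 -> cyl_eq k y1 y3.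
Proof.
move=> [w [wk wy1 wy2]] [w' [wk' wy2' wy3]]; exists w; split => //.
by rewrite (wcyl_inj _ wy2 wy2') // wk.
Qed.

(** Continuity along cylinders suffices for measurability; this is how the roof and the induced
    observables are seen to be measurable on [Y]. *)
Lemma measurable_cylinder_continuous {R : realType} (f : M -> R) :
  (forall y e, Y y -> 0 < e -> exists k, forall y', cyl_eq k y y' -> `|f y - f y'| < e) ->
  measurable_fun Y f.
Proof.
move=> cf; apply: (measurability _ (RGenOInfty.measurableE R)) => //.
move=> _ [_ [a ->] <-]; apply: measurable_cylinder_open => [y []//|y [Yy]].
rewrite /= in_itv /= andbT => fa.
have e0 : 0 < f y - a by rewrite subr_gt0.
have [k hk] := cf y _ Yy e0; exists k => y' yy'.
split; first by case: (cyl_eq_sub yy').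
rewrite /= in_itv /= andbT; have := hk _ yy'; rewrite ltr_norml.
by case/andP; lra.
Qed.

End Cylinders.

(** * Bounded distortion and mixing *)

Section LogHolderMeasures.
Context {R : realType} {dM : measure_display} {M : measurableType dM}.
Variables (Y : set M) (F : M -> M) (I : set nat) (Yj : nat -> set M).
Hypothesis mY : measurable Y.
Hypothesis FY : forall y, Y y -> Y (F y).
Hypothesis part : is_partition Y I Yj.
Hypothesis mF : forall A, measurable A -> measurable (Y `&` F @^-1` A).
Variable gam : R.
Hypothesis gam0 : 0 < gam.
Hypothesis gam1 : gam < 1.

Local Notation cyl := (wcyl Y F I Yj).
Local Notation bpre := (branch_preimage F I Yj).
Implicit Types (nu m : set M -> R) (A B : set M).

(** Real-valued set functions, because the coupling argument subtracts a multiple of one measure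
    from another. *)
Definition finite_measure_on nu := [/\ nu set0 = 0,
  forall A, measurable A -> A `<=` Y -> 0 <= nu A &
  forall E : nat -> set M, (forall i, measurable (E i) /\ E i `<=` Y) ->
    trivIset setT E -> (fun n => \sum_(i < n) nu (E i)) @ \oo --> nu (\bigcup_i E i)].

(* [nu] has, with respect to [m], a density whose logarithm oscillates by at most
   [L * gam ^+ k] on every cylinder of length [k >= l]. *)
Definition log_holder m nu (l : nat) (L : R) := forall w A A',
  (l <= size w)%N -> measurable A -> measurable A' -> A `<=` cyl w -> A' `<=` cyl w ->
  nu A * m A' <= expR (L * gam ^+ size w) * (m A * nu A').

(** Bounded distortion of the inverse branches, cross-multiplied so that no Jacobian appears and no
    division is made; the first clause supplies what division by null masses would lose. The
    exponent [(size w).+1] is the length of the word [j :: w] on which the branch acts. *)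
Definition distortion_le m (C0 : R) :=
  (forall j A, I j -> measurable A -> A `<=` Y -> m A = 0 <-> m (bpre j A) = 0) /\
  (forall j w A A', I j -> measurable A -> measurable A' ->
     A `<=` cyl w -> A' `<=` cyl w ->
     m (bpre j A) * m A' <=
       expR (C0 * gam ^+ (size w).+1) * (m (bpre j A') * m A)).

Definition push nu : set M -> R := fun A => nu (Y `&` F @^-1` A).

Lemma finite_measure_on_push nu : finite_measure_on nu -> finite_measure_on (push nu).
Proof.
move=> [nu0 nuge0 nusig]; split.
- by rewrite /push preimage_set0 setI0.
- by move=> A mA AY; apply: nuge0; [exact: mF|exact: subIsetl].
- move=> E mE tE; rewrite /push preimage_bigcup setI_bigcupr.
  apply: nusig; first by move=> i; split; [apply: mF; case: (mE i)|exact: subIsetl].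
  move=> i j _ _ [y [[_ Ei] [_ Ej]]]; apply: tE => //.
  by exists (F y).
Qed.

Lemma finite_measure_on_lin nu m (c : R) : finite_measure_on nu -> finite_measure_on m ->
  (forall A, measurable A -> A `<=` Y -> c * m A <= nu A) ->
  finite_measure_on (fun A => nu A - c * m A).
Proof.
move=> [nu0 nuge0 nusig] [m0 mge0 msig] mnu; split.
- by rewrite nu0 m0 mulr0 subrr.
- by move=> A mA AY; rewrite subr_ge0; exact: mnu.
- move=> E mE tE.
  have -> : (fun n => \sum_(i < n) (nu (E i) - c * m (E i))) =
      (fun n => \sum_(i < n) nu (E i) - c * \sum_(i < n) m (E i)).
    by apply/funext => n; rewrite sumrB mulr_sumr.
  by apply: cvgB; [exact: nusig|apply: cvgMr; exact: msig].
Qed.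

Lemma le_finite_measure_on nu A B : finite_measure_on nu -> measurable A -> measurable B ->
  A `<=` B -> B `<=` Y -> nu A <= nu B.
Proof.
move=> [nu0 nuge0 nusig] mA mB AB BY.
pose E i := if i is 0%N then A else if i is 1%N then B `\` A else set0.
have mE i : measurable (E i) /\ E i `<=` Y.
  case: i => [|[|i]] /=; split => //.
  - exact: subset_trans BY.
  - exact: measurableD.
  - by apply: subset_trans BY; exact: subDsetl.
have tE : trivIset setT E.
  move=> [|[|i]] [|[|j]] _ _ [y []] //=; first by move=> Ay [].
  by move=> [_ nAy].
have UE : \bigcup_i E i = B.
  apply/seteqP; split => [y [[|[|i]] _] //=|y By]; first exact: AB.
    by case.
  by have [Ay|nAy] := pselect (A y); [exists 0%N|exists 1%N].
have := nusig E mE tE; rewrite UE => /cvg_lim <- //.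
apply: limr_ge; first by apply/cvg_ex; exists (nu B); rewrite -{1}UE; exact: nusig.
exists 2%N => // n /= n2.
case: n n2 => [|[|n]] // _.
rewrite big_ord_recl /= lerDl sumr_ge0 // => i _.
by have [mEi EiY] := mE (bump 0 i); apply: nuge0.
Qed.

(** On a branch, a word of length [k] becomes one of length [k + 1], which gains the factor [gam],
    while the distortion of the branch adds [C0]. Summing over the branches preserves the
    inequality. *)
Lemma log_holder_push m nu l C0 L : finite_measure_on m -> finite_measure_on nu ->
  distortion_le m C0 -> log_holder m nu l.+1 L ->
  log_holder m (push nu) l ((L + C0) * gam).
Proof.
move=> fm fnu [mnull mdist] Lnu w A A' lw mA mA' Aw A'w.
have [_ mge0 _] := fm; have [nu0 nuge0 nusig] := fnu.
have AY : A `<=` Y by apply: subset_trans Aw _; exact: wcyl_sub.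
have A'Y : A' `<=` Y by apply: subset_trans A'w _; exact: wcyl_sub.
set c := expR _.
have c0 : 0 < c by exact: expR_gt0.
have bsub j B : bpre j B `<=` Y by exact: branch_preimage_sub.
have bmes j B : measurable B -> measurable (bpre j B).
  exact: measurable_branch_preimage part mF _ _.
have term j : nu (bpre j A) * m A' <= c * (m A * nu (bpre j A')).
  have [Ij|nIj] := pselect (I j); last first.
    by rewrite /branch_preimage asboolF // nu0 mul0r !mulr0.
  have h1 := Lnu (j :: w) (bpre j A) (bpre j A') lw (bmes _ _ mA) (bmes _ _ mA')
               (branch_preimageS Aw) (branch_preimageS A'w).
  have h2 := mdist j w A A' Ij mA mA' Aw A'w.
  have a0 := mge0 _ mA AY; have a'0 := mge0 _ mA' A'Y.
  have b0 := mge0 _ (bmes j _ mA) (bsub j A).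
  have b'0 := mge0 _ (bmes j _ mA') (bsub j A').
  have n0 := nuge0 _ (bmes j _ mA) (bsub j A).
  have n'0 := nuge0 _ (bmes j _ mA') (bsub j A').
  have rhs0 : 0 <= c * (m A * nu (bpre j A')) by rewrite mulr_ge0 ?mulr_ge0 // ltW.
  (* The inequalities [h1] and [h2] are multiplied and the masses of the two preimages cancelled. If
     the second mass vanishes, the null-set clause gives [m A' = 0]; if only the first does, [h1]
     forces [nu] to vanish there. *)
  have [bA'0|bA'0] := eqVneq (m (bpre j A')) 0.
    have -> : m A' = 0 by apply/(mnull j A' Ij mA' A'Y).
    by rewrite mulr0.
  have bA'gt : 0 < m (bpre j A') by rewrite lt_neqAle eq_sym bA'0.
  have [bA0|bA0] := eqVneq (m (bpre j A)) 0.
    move: h1; rewrite bA0 mul0r mulr0 pmulr_lle0 // => h1.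
    have -> : nu (bpre j A) = 0 by apply/eqP; rewrite eq_le h1.
    by rewrite mul0r.
  have bAgt : 0 < m (bpre j A) by rewrite lt_neqAle eq_sym bA0.
  have := ler_pM (mulr_ge0 n0 b'0) (mulr_ge0 b0 a'0) h1 h2.
  have -> : c = expR (L * gam ^+ size (j :: w)) * expR (C0 * gam ^+ (size w).+1).
    by rewrite /c -expRD; congr expR; rewrite /= exprS; ring.
  set c1 := expR (L * _); set c2 := expR (C0 * _) => h.
  rewrite -(ler_pM2l (mulr_gt0 bAgt bA'gt)).
  by apply: le_trans (le_trans h _); rewrite le_eqVlt; apply/orP; left; apply/eqP; ring.
have cvA B : measurable B -> (fun n => \sum_(i < n) nu (bpre i B)) @ \oo --> push nu B.
  move=> mB; rewrite /push -(bigcup_branch_preimage _ part); apply: nusig.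
    by move=> i; split; [exact: bmes|exact: bsub].
  exact: trivIset_branch_preimage part _.
have c1 : (fun n => (\sum_(i < n) nu (bpre i A)) * m A') @ \oo --> push nu A * m A'.
  by apply: cvgMl; exact: cvA.
have c2 : (fun n => c * (m A * \sum_(i < n) nu (bpre i A'))) @ \oo -->
     c * (m A * push nu A').
  by apply: cvgMr; apply: cvgMr; exact: cvA.
apply: (ler_cvg_to c1 c2); near=> n.
by rewrite mulr_suml !mulr_sumr; apply: ler_sum => i _; exact: term.
Unshelve. all: by end_near. Qed.

Lemma log_holder_weaken m nu l l' L L' : finite_measure_on m -> finite_measure_on nu ->
  (l <= l')%N -> L <= L' -> log_holder m nu l L -> log_holder m nu l' L'.
Proof.
move=> [_ mge0 _] [_ nuge0 _] ll LL Lnu w A A' lw mA mA' Aw A'w.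
have Yw : cyl w `<=` Y by exact: wcyl_sub.
apply: le_trans (Lnu w A A' (leq_trans ll lw) mA mA' Aw A'w) _.
rewrite ler_wpM2r ?ler_expR ?ler_wpM2r ?exprn_ge0 ?(ltW gam0) //.
by apply: mulr_ge0; [exact: mge0 _ mA (subset_trans Aw Yw)|exact: nuge0 _ mA' (subset_trans A'w Yw)].
Qed.

Section Contraction.
Variables (mu : set M -> R) (C0 L : R).
Hypothesis fmu : finite_measure_on mu.
Hypothesis muY1 : mu Y = 1.
Hypothesis invmu : forall A, measurable A -> A `<=` Y -> push mu A = mu A.
Hypothesis dmu : distortion_le mu C0.
Hypothesis L0 : 0 <= L.
Hypothesis LC : (L + 1 + C0) * gam <= L.

(** The fraction split off, [expR (- (2 * L + 1)) / (L + 1)], is such that its removal raises the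
    regularity constant from [L] to at most [L + 1]; by [LC], one push-forward brings it back to
    [L]. *)
Definition contraction_rate : R := 1 - expR (- (2 * L + 1)) / (L + 1).

Lemma contraction_rate_bounds : 0 <= contraction_rate < 1.
Proof.
have L0' := L0; have L1 : 0 < L + 1 by lra.
rewrite /contraction_rate subr_ge0 ltrBlDr ltrDl divr_gt0 ?expR_gt0 // andbT.
rewrite ler_pdivrMr // mul1r.
apply: (@le_trans _ _ 1); last lra.
by rewrite expR_le1; lra.
Qed.

Lemma log_holder_mass nu A : finite_measure_on nu -> log_holder mu nu 0 L ->
  measurable A -> A `<=` Y ->
  nu A <= expR L * (nu Y * mu A) /\ nu Y * mu A <= expR L * nu A.
Proof.
move=> fnu Lnu mA AY; split.
- have := Lnu [::] A Y (leq0n _) mA mY AY (@subset_refl _ _).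
  by rewrite muY1 mulr1 /= expr0 mulr1 [mu A * _]mulrC.
- have := Lnu [::] Y A (leq0n _) mY mA (@subset_refl _ _) AY.
  by rewrite muY1 mul1r /= expr0 mulr1.
Qed.

(* Subtracting a small multiple of [mu] costs a bit of regularity, which pushing
   forward by [F] restores; only the fraction [contraction_rate] of the mass remains. *)
Lemma log_holder_contract nu : finite_measure_on nu -> log_holder mu nu 0 L ->
  [/\ finite_measure_on (fun A => push nu A - (1 - contraction_rate) * nu Y * mu A),
      push nu Y - (1 - contraction_rate) * nu Y * mu Y = contraction_rate * nu Y &
      log_holder mu (fun A => push nu A - (1 - contraction_rate) * nu Y * mu A) 0 L].
Proof.
move=> fnu Lnu; set kap := 1 - contraction_rate.
have L0' := L0; have L1 : 0 < L + 1 by lra.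
have kapE : kap = expR (- (2 * L + 1)) / (L + 1).
  by rewrite /kap /contraction_rate opprB addrC subrK.
have kap0 : 0 < kap by rewrite kapE divr_gt0 ?expR_gt0.
have [_ muge0 _] := fmu; have [_ nuge0 _] := fnu.
have nY0 : 0 <= nu Y by exact: nuge0.
pose nt A := nu A - kap * nu Y * mu A.
have kapL : kap * expR L <= 1.
  rewrite kapE mulrAC -expRD ler_pdivrMr // mul1r.
  by apply: (@le_trans _ _ 1); [rewrite expR_le1; lra|lra].
have small A : measurable A -> A `<=` Y -> kap * nu Y * mu A <= nu A.
  move=> mA AY; have [_ h] := log_holder_mass fnu Lnu mA AY.
  rewrite -mulrA; apply: (@le_trans _ _ (kap * (expR L * nu A))).
    by rewrite ler_wpM2l // ltW.
  by rewrite mulrA ler_piMl // nuge0.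
have fnt : finite_measure_on nt by exact: finite_measure_on_lin.
have Lnt : log_holder mu nt 0 (L + 1).
  move=> w A A' _ mA mA' Aw A'w; rewrite /nt.
  have Yw : cyl w `<=` Y by exact: wcyl_sub.
  have AY := subset_trans Aw Yw; have A'Y := subset_trans A'w Yw.
  have h1 := Lnu w A A' (leq0n _) mA mA' Aw A'w.
  have [_ h2] := log_holder_mass fnu Lnu mA' A'Y.
  set g := gam ^+ size w in h1 *.
  have g0 : 0 < g by exact: exprn_gt0.
  have g1 : g <= 1 by apply: exprn_ile1; exact: ltW.
  set E1 := expR (L * g) in h1; set E2 := expR ((L + 1) * g).
  have mA0 := muge0 _ mA AY; have mA'0 := muge0 _ mA' A'Y.
  (* [expR ((L+1) g) - expR (L g)] is bounded below by [g], and
     [expR ((L+1) g) - 1] above by a multiple of [g]. *)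
  have e1 : g <= E2 - E1.
    have -> : E2 = E1 * expR g by rewrite /E2 /E1 -expRD; congr expR; ring.
    have : 1 <= E1 by apply: le_trans (expR_ge1Dx _); rewrite lerDl mulr_ge0 // ltW.
    have := expR_ge1Dx g; nra.
  have e2 : E2 - 1 <= (L + 1) * g * expR (L + 1).
    have h : E2 * (1 - (L + 1) * g) <= 1.
      rewrite -[leRHS](expRxMexpNx_1 ((L + 1) * g)).
      by rewrite ler_wpM2l ?expR_ge0 //; exact: expR_ge1Dx.
    apply: (@le_trans _ _ ((L + 1) * g * E2)); first by lra.
    rewrite ler_wpM2l ?mulr_ge0 ?(ltW g0) ?(ltW L1) // ler_expR.
    by rewrite ler_piMr // ltW.
  have e3 : kap * expR L * (E2 - 1) <= E2 - E1.
    apply: le_trans e1; apply: (@le_trans _ _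
        (kap * expR L * ((L + 1) * g * expR (L + 1)))).
      by rewrite ler_wpM2l // mulr_ge0 ?expR_ge0 // ltW.
    rewrite kapE.
    have -> : expR (- (2 * L + 1)) / (L + 1) * expR L * ((L + 1) * g * expR (L + 1))
      = g * (expR (- (2 * L + 1)) * (expR L * expR (L + 1))).
      by field; rewrite gt_eqF.
    rewrite -!expRD.
    have -> : - (2 * L + 1) + (L + (L + 1)) = 0 by ring.
    by rewrite expR0 mulr1.
  have E21 : 0 <= E2 - 1.
    rewrite subr_ge0; apply: le_trans (expR_ge1Dx _).
    by rewrite lerDl mulr_ge0 // ltW.
  have h3 : kap * (E2 - 1) * (nu Y * mu A') <= (E2 - E1) * nu A'.
    apply: (@le_trans _ _ (kap * (E2 - 1) * (expR L * nu A'))).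
      by rewrite ler_wpM2l // mulr_ge0 // ltW.
    have -> : kap * (E2 - 1) * (expR L * nu A') = kap * expR L * (E2 - 1) * nu A'.
      by ring.
    by rewrite ler_wpM2r // nuge0.
  have h4 := ler_wpM2l mA0 h3.
  rewrite -subr_ge0 in h1; rewrite -subr_ge0 in h4; rewrite -subr_ge0.
  have -> : E2 * (mu A * (nu A' - kap * nu Y * mu A')) -
     (nu A - kap * nu Y * mu A) * mu A' =
     (E1 * (mu A * nu A') - nu A * mu A') +
     (mu A * ((E2 - E1) * nu A') - mu A * (kap * (E2 - 1) * (nu Y * mu A'))).
    by ring.
  by rewrite addr_ge0.
have pE A : measurable A -> A `<=` Y -> push nu A - kap * nu Y * mu A = push nt A.
  by move=> mA AY; rewrite /push /nt -[mu (Y `&` _)]/(push mu A) invmu.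
have pshort : push nu Y = nu Y.
  rewrite /push; congr nu; apply/seteqP; split => [y []//|y Yy].
  by split => //; exact: FY.
have [f1 f2 f3] := finite_measure_on_push fnt.
have nt_eq : forall w A A', (0 <= size w)%N -> measurable A -> measurable A' ->
    A `<=` cyl w -> A' `<=` cyl w -> push nt A * mu A' <=
    expR (L * gam ^+ size w) * (mu A * push nt A').
  have := log_holder_push fmu fnt dmu
    (log_holder_weaken fmu fnt (leq0n 1) (lexx (L + 1)) Lnt).
  by move/(log_holder_weaken fmu (finite_measure_on_push fnt) (leqnn 0) LC).
split.
- split.
  + have [mu0 _ _] := fmu; have [nu0 _ _] := fnu.
    by rewrite /push preimage_set0 setI0 nu0 mu0 mulr0 subrr.
  + by move=> A mA AY; rewrite pE //; exact: f2.
  + move=> E mE tE; rewrite pE; last 2 first.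
    * by apply: bigcupT_measurable => i; case: (mE i).
    * by move=> y [i _]; case: (mE i) => _; apply.
    under eq_fun => n do under eq_bigr => i _ do
      rewrite (pE _ (mE i).1 (mE i).2).
    exact: f3.
- by rewrite muY1 mulr1 pshort /kap; ring.
- move=> w A A' w0 mA mA' Aw A'w; have Yw : cyl w `<=` Y by exact: wcyl_sub.
  rewrite (pE _ mA (subset_trans Aw Yw)) (pE _ mA' (subset_trans A'w Yw)).
  exact: nt_eq.
Qed.

(** After [n] splittings the residual part has mass [contraction_rate ^+ n * nu Y] and is still
    log-Hoelder, hence at most [expR L] times its mass times [mu]. The error is thus relative to
    [mu A], which is stronger than a bound in total variation and is what permits unbounded test
    functions later. *)
Lemma iter_push_mixing nu n : finite_measure_on nu -> log_holder mu nu 0 L ->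
  forall A, measurable A -> A `<=` Y ->
  `|iter n push nu A - nu Y * mu A| <= expR L * contraction_rate ^+ n * (nu Y * mu A).
Proof.
move=> fnu Lnu; set s := contraction_rate.
have /andP[s0 s1] := contraction_rate_bounds.
have [_ muge0 _] := fmu.
have [_ nuge0 _] := fnu.
have claim k : exists nk : set M -> R, [/\ finite_measure_on nk, log_holder mu nk 0 L,
    nk Y = s ^+ k * nu Y & forall A, measurable A -> A `<=` Y ->
      iter k push nu A = nk A + (1 - s ^+ k) * nu Y * mu A].
  elim: k => [|k [nk [fk Lk massk Ek]]].
    exists nu; split => //; first by rewrite expr0 mul1r.
    by move=> A _ _; rewrite expr0 subrr !mul0r addr0.
  have [f' m' L'] := log_holder_contract fk Lk.
  exists (fun A => push nk A - (1 - s) * nk Y * mu A); split => //.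
    by rewrite m' massk exprS mulrA.
  move=> A mA AY; rewrite iterS /= {1}/push Ek; last 2 first.
    exact: mF.
    exact: subIsetl.
  rewrite -[mu (Y `&` _)]/(push mu A) (invmu mA AY) -[nk (Y `&` _)]/(push nk A).
  by rewrite massk exprS; ring.
move=> A mA AY; have [nk [fk Lk massk Ek]] := claim n.
have [h1 h2] := log_holder_mass fk Lk mA AY.
have nk0 : 0 <= nk A by have [_ h _] := fk; exact: h.
have E1 : 1 <= expR L by apply: le_trans (expR_ge1Dx _); rewrite lerDl.
rewrite Ek //; set a := nu Y * mu A.
have a0 : 0 <= a by rewrite mulr_ge0 ?muge0 ?nuge0.
have -> : nk A + (1 - s ^+ n) * nu Y * mu A - a = nk A - s ^+ n * a.
  by rewrite /a; ring.
have h3 : nk A <= expR L * s ^+ n * a.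
  by apply: le_trans h1 _; rewrite massk /a !mulrA.
have sn0 : 0 <= s ^+ n * a by rewrite mulr_ge0 // exprn_ge0.
have h4 : s ^+ n * a <= expR L * s ^+ n * a by rewrite -mulrA ler_peMl.
by rewrite ler_norml; apply/andP; split; lra.
Qed.

End Contraction.
End LogHolderMeasures.

(** * Set functions given by densities *)

Section Densities.
Context {R : realType} {dM : measure_display} {M : measurableType dM}.
Variables (Y : set M) (F : M -> M) (I : set nat) (Yj : nat -> set M).
Hypothesis mY : measurable Y.
Hypothesis FY : forall y, Y y -> Y (F y).
Hypothesis part : is_partition Y I Yj.
Hypothesis mF : forall A, measurable A -> measurable (Y `&` F @^-1` A).
Variable mu : {finite_measure set M -> \bar R}.
Local Notation cyl := (wcyl Y F I Yj).
Implicit Types (f g s : M -> R) (A B : set M).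

Definition msr A : R := fine (mu A).
Definition dens f A : R := \int[mu]_(y in A) f y.

Lemma integrable_restr f A B : measurable A -> measurable B -> A `<=` B ->
  mu.-integrable B (EFin \o f) -> mu.-integrable A (EFin \o f).
Proof. by move=> mA mB AB; exact: integrableS. Qed.

Lemma finite_measure_on_dens f : (forall y, Y y -> 0 <= f y) ->
  mu.-integrable Y (EFin \o f) -> finite_measure_on Y (dens f).
Proof.
move=> f0 intf; split.
- by rewrite /dens Rintegral_set0.
- by move=> A mA AY; apply: Rintegral_ge0 => y /AY; exact: f0.
- move=> E mE tE; have UY : \bigcup_i E i `<=` Y.
    by move=> y [i _]; have [_] := mE i; apply.
  have mU : measurable (\bigcup_i E i).
    by apply: bigcupT_measurable => i; have [] := mE i.
  have intU := integrable_restr mU mY UY intf.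
  have h : (fun n => \sum_(0 <= i < n) \int[mu]_(y in E i) (f y)%:E)%E @ \oo -->
      (\int[mu]_(y in \bigcup_i E i) (f y)%:E)%E.
    have -> : (\int[mu]_(y in \bigcup_i E i) (f y)%:E =
        \sum_(i <oo) \int[mu]_(y in E i) (f y)%:E)%E.
      apply: ge0_integral_bigcup => //.
      + by move=> k; have [] := mE k.
      + exact: measurable_int intU.
      + by move=> y Uy; rewrite lee_fin f0 //; exact: UY.
    apply: is_cvg_nneseries => n _ _; apply: integral_ge0 => y Ey.
    by rewrite lee_fin f0 //; have [_] := mE n; apply.
  have fin B : measurable B -> B `<=` Y -> (\int[mu]_(y in B) (f y)%:E)%E \is a fin_num.
    by move=> mB BY; apply: integrable_fin_num => //; exact: integrable_restr intf.
  rewrite -[(\int[mu]_(y in \bigcup_i E i) _)%E]fineK in h; last exact: fin.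
  rewrite (_ : (fun n => _) = fine \o
    (fun n => \sum_(0 <= i < n) \int[mu]_(y in E i) (f y)%:E)%E); last first.
    apply/funext => n /=; rewrite -sum_fine.
      by rewrite big_mkord.
    by move=> i _; apply: fin; have [] := mE i.
  exact: fine_cvg h.
Qed.

Lemma msrE A : measurable A -> msr A = dens (fun=> 1) A.
Proof. by move=> mA; rewrite /dens Rintegral_cst // mul1r. Qed.

Lemma finite_measure_on_msr : finite_measure_on Y msr.
Proof.
have i1 : mu.-integrable Y (EFin \o (fun=> 1 : R)).
  apply: (integrable_restr mY measurableT) => //.
  by apply: bddm_integrable; exact: bddm_cst.
have [h1 h2 h3] := @finite_measure_on_dens (fun=> 1) (fun _ _ => ler01) i1.
split; first by rewrite /msr measure0.
- by move=> A mA AY; exact: fine_ge0.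
- move=> E mE tE; have -> : msr (\bigcup_i E i) = dens (fun=> 1) (\bigcup_i E i).
    by rewrite msrE //; apply: bigcupT_measurable => i; have [] := mE i.
  rewrite (_ : (fun n => _) = fun n => \sum_(i < n) dens (fun=> 1) (E i)).
    exact: h3.
  apply/funext => n.
  by apply: eq_bigr => i _; rewrite msrE //; have [] := mE i.
Qed.

(** The pointwise inequality is integrated in [y] over [A], and the result in [y'] over [A']. *)
Lemma dens_ratio f A A' (c : R) : measurable A -> measurable A' ->
  mu.-integrable A (EFin \o f) -> mu.-integrable A' (EFin \o f) ->
  (forall y y', A y -> A' y' -> f y <= c * f y') ->
  dens f A * msr A' <= c * (msr A * dens f A').
Proof.
move=> mA mA' iA iA' fc.
have cstint B : measurable B -> forall r : R, mu.-integrable B (EFin \o (fun=> r)).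
  move=> mB r; apply: (integrable_restr mB measurableT) => //.
  by apply: bddm_integrable; exact: bddm_cst.
have h y' : A' y' -> dens f A <= msr A * c * f y'.
  move=> Ay'; rewrite -mulrA [leRHS]mulrC -Rintegral_cst //.
  apply: le_Rintegral => //; first exact: cstint.
  by move=> y Ay; exact: fc.
have := @le_Rintegral _ _ _ mu A' (fun=> dens f A) (fun y => msr A * c * f y) mA'.
rewrite Rintegral_cst // RintegralZl // => h2.
rewrite mulrA [c * _]mulrC; apply: h2 => //; first exact: cstint.
have := integrableZl mA' (msr A * c) iA'; congr (_.-integrable _ _).
Qed.

Lemma log_holder_dens (gam : R) f l (L : R) : mu.-integrable Y (EFin \o f) ->
  (forall w y y', (l <= size w)%N -> cyl w y -> cyl w y' ->
     f y <= expR (L * gam ^+ size w) * f y') ->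
  log_holder Y F I Yj gam msr (dens f) l L.
Proof.
move=> intf fc w A A' lw mA mA' Aw A'w.
have Yw : cyl w `<=` Y by exact: wcyl_sub.
apply: dens_ratio => //.
- exact: integrable_restr mA mY (subset_trans Aw Yw) intf.
- exact: integrable_restr mA' mY (subset_trans A'w Yw) intf.
- by move=> y y' Ay A'y'; apply: fc => //; [exact: Aw|exact: A'w].
Qed.

End Densities.

(** * Distortion of the reference measure *)

Section GibbsMarkov.
Context {R : realType} {dM : measure_display} {M : measurableType dM}.
Variables (dist : M -> M -> R) (Y : set M) (F : M -> M) (tau : M -> nat).
Variables (I : set nat) (Yj : nat -> set M) (lam C eta gam B : R).
Variable mu0 : {finite_measure set M -> \bar R}.
Hypothesis dist0 : forall x y, 0 <= dist x y.
Hypothesis distB : forall x y, dist x y <= B.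
Hypothesis mY : measurable Y.
Hypothesis FY : forall y, Y y -> Y (F y).
Hypothesis mF : forall A, measurable A -> measurable (Y `&` F @^-1` A).
Hypothesis lam1 : 1 < lam.
Hypothesis C1 : 1 <= C.
Hypothesis eta0 : 0 < eta.
Hypothesis gam0 : 0 < gam.
Hypothesis lamgam : lam `^ (- eta) <= gam.
Hypothesis GM : gibbs_markov dist mu0 Y F tau I Yj lam C eta.

Local Notation cyl := (wcyl Y F I Yj).
Local Notation bpre := (branch_preimage F I Yj).

Lemma wcyl_diam w y y' : cyl w y -> cyl w y' -> lam ^+ size w * dist y y' <= B.
Proof.
have l0 := lam1.
have [_ _ _ expand _] := GM.
elim: w y y' => [|j w IH] y y' /=; first by rewrite expr0 mul1r.
rewrite /branch_preimage; case: asboolP => [Ij|_ []//] [Yjy Fy] [Yjy' Fy'].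
rewrite exprSr -mulrA; apply: le_trans (IH _ _ Fy Fy').
by rewrite ler_wpM2l ?exprn_ge0 //; [lra|exact: expand Ij _ _ _ _].
Qed.

Lemma wcyl_diam_powR w y y' : cyl w y -> cyl w y' ->
  dist y y' `^ eta <= B `^ eta * gam ^+ size w.
Proof.
move=> wy wy'; have l0 : 0 < lam by exact: lt_trans lam1.
have B0 : 0 <= B by apply: le_trans (distB y y).
have lk : 0 < lam ^+ size w by exact: exprn_gt0.
have h : dist y y' <= B * (lam ^+ size w)^-1.
  by rewrite ler_pdivlMr // mulrC; exact: wcyl_diam.
apply: le_trans (ler_powR2l (ltW eta0) (dist0 _ _) h) _.
rewrite powRM ?invr_ge0 ?(ltW lk) // ler_wpM2l ?powR_ge0 //.
apply: (@le_trans _ _ ((lam `^ (- eta)) ^+ size w)); last first.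
  by apply: lerXn2r; rewrite ?nnegrE ?powR_ge0 ?(ltW gam0).
rewrite le_eqVlt; apply/orP; left; apply/eqP.
rewrite -(powR_inv1 (ltW lk)) -(powR_mulrn _ (ltW l0)) -(powR_mulrn _ (powR_ge0 _ _)).
by rewrite -2![LHS]powRrM -[RHS]powRrM; congr (_ `^ _); ring.
Qed.

(** The function [g] is the inverse of [zeta], the Jacobian of [F]. A branch fills [Y] only up to a
    null set, so the part of [A] outside the image is discarded before the change of variables. *)
Lemma gibbs_markov_branch : exists g : M -> R, [/\ forall y, Y y -> 0 < g y,
  (forall j, I j -> mu0.-integrable (Yj j) (EFin \o g)),
  (forall j A, I j -> measurable A -> A `<=` Y ->
     mu0 A = \int[mu0]_(y in bpre j A) (g y)%:E)%E &
  (forall j y y', I j -> Yj j y -> Yj j y' ->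
     g y <= expR (C * dist (F y) (F y') `^ eta) * g y')].
Proof.
have [part _ full _ [zeta [zpos mzeta zint zlog]]] := GM.
exists (fun y => (zeta y)^-1).
have image_bpre j A : I j -> F @` bpre j A = A `&` F @` Yj j.
  move=> Ij; rewrite /branch_preimage asboolT //; apply/seteqP; split.
    by move=> _ [y [Yjy FyA] <-]; split => //; exists y.
  by move=> x [Ax [y Yjy Fyx]]; exists y => //; split => //; rewrite /= Fyx.
have zE j A : I j -> measurable A -> A `<=` Y ->
    (mu0 A = \int[mu0]_(y in bpre j A) ((zeta y)^-1)%:E)%E.
  move=> Ij mA AY; have [mim null] := full j Ij.
  have [mYj _] : measurable (Yj j) /\ Yj j `<=` Y by case: part => h _ _; exact: h.
  have mFYj : measurable (F @` Yj j) by exact: mim.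
  have bsub : bpre j A `<=` Yj j.
    by rewrite /branch_preimage asboolT // => y [].
  have mb : measurable (bpre j A) by exact: (measurable_branch_preimage part mF).
  rewrite -(zint j Ij) //.
  rewrite image_bpre // (measureDI mu0 mA mFYj) /=.
  suff -> : mu0 (A `\` F @` Yj j) = 0%E by rewrite add0e.
  apply/eqP; rewrite eq_le measure_ge0 andbT -null; apply: le_measure.
  - by apply: mem_set; exact: measurableD.
  - by apply: mem_set; exact: measurableD.
  - by move=> y [Ay nFy]; split => //; exact: AY.
have bpreY j : I j -> bpre j Y = Yj j.
  move=> Ij; rewrite /branch_preimage asboolT //; apply/seteqP; split => [y []//|y Yjy].
  split => //; apply: FY.
  by case: part => h _ _; have [_] := h j Ij; exact.
split => //.
- by move=> y /zpos; rewrite invr_gt0.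
- move=> j Ij; have [mYj YjY] : measurable (Yj j) /\ Yj j `<=` Y.
    by case: part => h _ _; exact: h.
  apply/integrableP; split.
    apply/measurable_EFinP.
    have h : Yj j = Y `&` Yj j by rewrite setIidr.
    have mz : measurable_fun (Yj j) zeta by exact: measurable_funS mzeta.
    apply: (eq_measurable_fun (fun y => (zeta y) `^ (-1))).
      by move=> y /set_mem/YjY /zpos z0; rewrite powR_inv1 // ltW.
    by apply: (measurableT_comp (measurable_powR (-1))).
  rewrite (eq_integral (fun y => ((zeta y)^-1)%:E)); last first.
    move=> y /set_mem/YjY /zpos z0.
    by rewrite gee0_abs // lee_fin invr_ge0 ltW.
  rewrite -bpreY // -zE // -ge0_fin_numE ?measure_ge0 //.
  exact: fin_num_measure.
- move=> j y y' Ij Yjy Yjy'.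
  have YjY : Yj j `<=` Y by case: part => h _ _; have [] := h j Ij.
  have z0 := zpos _ (YjY _ Yjy); have z0' := zpos _ (YjY _ Yjy').
  have := zlog j Ij y y' Yjy Yjy'; rewrite ler_norml => /andP[h _].
  have h2 : ln (zeta y') <= C * dist (F y) (F y') `^ eta + ln (zeta y) by lra.
  rewrite -(lnK z0) -(lnK z0') -!expRN -expRD ler_expR; lra.
Qed.

(** The images [F y] and [F y'] lie in a cylinder of word [w], where [dist^eta] is at most
    [B^eta * gam ^+ size w]. The division by [gam] accounts for the exponent [(size w).+1] in
    [distortion_le]. *)
Lemma gibbs_markov_distortion : distortion_le Y F I Yj gam (msr mu0) (C * B `^ eta / gam).
Proof.
have [part _ _ _ _] := GM.
have [g [gpos gint gE gdist]] := gibbs_markov_branch.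
have bsub j A : I j -> bpre j A `<=` Yj j.
  by move=> Ij; rewrite /branch_preimage asboolT // => y [].
have YjY j : I j -> measurable (Yj j) /\ Yj j `<=` Y.
  by case: part => h _ _; exact: h.
have mb j A : measurable A -> measurable (bpre j A).
  exact: (measurable_branch_preimage part mF).
have fin A : measurable A -> mu0 A \is a fin_num by move=> mA; exact: fin_num_measure.
have msr0 A : measurable A -> msr mu0 A = 0 <-> mu0 A = 0%E.
  move=> mA; rewrite /msr; split => [h|->//].
  by rewrite -(fineK (fin A mA)) h.
split.
- move=> j A Ij mA AY; rewrite !msr0 //; last exact: mb.
  have mg : measurable_fun (bpre j A) (EFin \o g).
    apply: measurable_int (integrable_restr (mb j A mA) (YjY j Ij).1 (bsub j A Ij) (gint j Ij)).
  have gge y : bpre j A y -> (0 <= (g y)%:E)%E.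
    by move=> /(bsub j A Ij)/((YjY j Ij).2)/gpos h; rewrite lee_fin ltW.
  rewrite (gE j A) //; split => [h|h].
    have : ae_eq mu0 (bpre j A) (EFin \o g) (cst 0%E).
      apply/ae_eq_integral_abs => //; first exact: mb.
      by rewrite -[RHS]h; apply: eq_integral => y /set_mem yb; rewrite gee0_abs // gge.
    move=> [N [mN N0 hN]]; apply/eqP; rewrite eq_le measure_ge0 andbT -N0.
    apply: le_measure; [exact/mem_set/mb|exact: mem_set|].
    move=> y yb; apply: hN => /(_ yb) [] g0.
    by have := gpos y ((YjY j Ij).2 _ (bsub j A Ij _ yb)); rewrite g0 ltxx.
  by apply: null_set_integral => //; exact: mb.
- move=> j w A A' Ij mA mA' Aw A'w.
  have Yw : cyl w `<=` Y by exact: wcyl_sub.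
  have gA D : measurable D -> D `<=` cyl w -> msr mu0 D = dens mu0 g (bpre j D).
    by move=> mD Dw; rewrite /msr (gE j D) //; exact: subset_trans Yw.
  rewrite (gA A') // (gA A) // [leLHS]mulrC.
  apply: dens_ratio; [exact: mb|exact: mb| | |].
  + exact: integrable_restr (mb j _ mA') (YjY j Ij).1 (bsub j _ Ij) (gint j Ij).
  + exact: integrable_restr (mb j _ mA) (YjY j Ij).1 (bsub j _ Ij) (gint j Ij).
  + move=> y y' yA' y'A.
    have Yjy := bsub j A' Ij _ yA'; have Yjy' := bsub j A Ij _ y'A.
    apply: (le_trans (gdist j y y' Ij Yjy Yjy')).
    rewrite ler_wpM2r ?(ltW (gpos _ _)) //; first exact: (YjY j Ij).2 _ Yjy'.
    rewrite ler_expR exprS mulrA divfK ?gt_eqF // -mulrA ler_pM2l; last first.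
      by apply: lt_le_trans C1.
    apply: wcyl_diam_powR.
      by apply: A'w; move: yA'; rewrite /branch_preimage asboolT // => -[].
    by apply: Aw; move: y'A; rewrite /branch_preimage asboolT // => -[].
Qed.

End GibbsMarkov.

(** * Approximation of integrable functions by functions constant on cylinders *)

Section CylinderApproximation.
Context {R : realType} {dM : measure_display} {M : measurableType dM}.
Variables (dist : M -> M -> R) (Y : set M) (F : M -> M) (I : set nat) (Yj : nat -> set M).
Hypothesis borel : borel_wrt dist.
Hypothesis mY : measurable Y.
Hypothesis FY : forall y, Y y -> Y (F y).
Hypothesis part : is_partition Y I Yj.
Hypothesis mF : forall A, measurable A -> measurable (Y `&` F @^-1` A).
Hypothesis small : forall e, 0 < e -> exists k, forall y y',
  cyl_eq Y F I Yj k y y' -> dist y y' < e.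
Variable mu : {finite_measure set M -> \bar R}.
Implicit Types (f g s : M -> R) (A : set M).

Local Notation intY f := (mu.-integrable Y (EFin \o f)).
Local Notation cylE := (cyl_eq Y F I Yj).

Definition l1 f g : R := dens mu (fun y => `|f y - g y|) Y.

Definition approximable f := forall e, 0 < e -> exists k s,
  [/\ forall y y', cylE k y y' -> s y = s y', intY s & l1 f s <= e].

Lemma intYB f g : intY f -> intY g -> intY (fun y => f y - g y).
Proof. by move=> hf hg; exact: (integrableB mY hf hg). Qed.

Lemma intYD f g : intY f -> intY g -> intY (fun y => f y + g y).
Proof. by move=> hf hg; exact: (integrableD mY hf hg). Qed.

Lemma intYZ f (c : R) : intY f -> intY (fun y => c * f y).
Proof. by move=> hf; exact: (integrableZl mY c hf). Qed.

Lemma intY_norm f : intY f -> intY (fun y => `|f y|).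
Proof. by move=> hf; exact: (integrable_abse hf). Qed.

Lemma intY_indic A : measurable A -> intY \1_A.
Proof.
by move=> mA; apply: (integrable_restr mY measurableT) => //; exact: integrable_indic.
Qed.

Lemma l1_triangle f g h : intY f -> intY g -> intY h -> l1 f h <= l1 f g + l1 g h.
Proof.
move=> If Ig Ih; rewrite /l1 /dens -RintegralD //; last 2 first.
- by apply: intY_norm; exact: intYB.
- by apply: intY_norm; exact: intYB.
apply: le_Rintegral => //.
- by apply: intY_norm; exact: intYB.
- by apply: intYD; apply: intY_norm; exact: intYB.
- by move=> y _; have := ler_normD (f y - g y) (g y - h y); rewrite addrA subrK.
Qed.

Lemma l1C f g : l1 f g = l1 g f.
Proof. by apply: eq_Rintegral => y _; rewrite distrC. Qed.

Lemma approximable_lim f : intY f ->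
  (forall e, 0 < e -> exists g, [/\ intY g, approximable g & l1 f g <= e]) ->
  approximable f.
Proof.
move=> If H e e0; have e2 : 0 < e / 2 by rewrite divr_gt0.
have [g [Ig ag fg]] := H _ e2; have [k [s [sk Is gs]]] := ag _ e2.
exists k, s; split => //; apply: le_trans (l1_triangle If Ig Is) _.
by rewrite [e]splitr lerD.
Qed.

Lemma approximable_saturated k s : intY s -> (forall y y', cylE k y y' -> s y = s y') ->
  approximable s.
Proof.
move=> Is sk e e0; exists k, s; split => //.
rewrite /l1 /dens (@eq_Rintegral _ _ _ mu Y (fun=> 0)); last by move=> y _; rewrite subrr normr0.
by rewrite Rintegral_cst // mul0r ltW.
Qed.

Lemma approximableD f g : intY f -> intY g -> approximable f -> approximable g ->
  approximable (fun y => f y + g y).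
Proof.
move=> If Ig af ag e e0; have e2 : 0 < e / 2 by rewrite divr_gt0.
have [k [s [sk Is fs]]] := af _ e2; have [l [t [tl It gt]]] := ag _ e2.
exists (maxn k l), (fun y => s y + t y); split.
- move=> y y' yy'; congr (_ + _).
    by apply: sk; apply: (cyl_eq_le part _ yy'); rewrite leq_maxl.
  by apply: tl; apply: (cyl_eq_le part _ yy'); rewrite leq_maxr.
- exact: intYD.
- apply: (@le_trans _ _ (l1 f s + l1 g t)); last by rewrite [e]splitr lerD.
  rewrite /l1 /dens -RintegralD //; [|exact/intY_norm/intYB..].
  apply: le_Rintegral => //.
  + by apply/intY_norm/intYB; exact: intYD.
  + by apply: intYD; exact/intY_norm/intYB.
  + move=> y _; apply: le_trans (ler_normD _ _).
    by rewrite le_eqVlt; apply/orP; left; apply/eqP; congr (`|_|); ring.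
Qed.

Lemma approximableZ f (c : R) : intY f -> approximable f -> approximable (fun y => c * f y).
Proof.
move=> If af e e0; pose c1 := `|c| + 1; have c10 : 0 < c1 by rewrite ltr_wpDl.
have [|k [s [sk Is fs]]] := af (e / c1); first exact: divr_gt0.
exists k, (fun y => c * s y); split; first by move=> y y' /sk ->.
  exact: intYZ.
apply: (@le_trans _ _ (`|c| * l1 f s)).
  rewrite /l1 /dens -RintegralZl //; last exact/intY_norm/intYB.
  apply: le_Rintegral => //.
  - by apply/intY_norm/intYB; exact: intYZ.
  - by apply: intYZ; exact/intY_norm/intYB.
  - by move=> y _; rewrite -mulrBr normrM.
apply: (@le_trans _ _ (c1 * (e / c1))); last by rewrite mulrC divfK // gt_eqF.
apply: ler_pM => //; last by rewrite /c1 lerDl.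
by apply: Rintegral_ge0.
Qed.

Lemma approximable_cst (c : R) : approximable (fun=> c).
Proof.
apply: (@approximable_saturated 0%N) => //.
by have := intYZ c (intY_indic measurableT); congr (_.-integrable _ _);
  apply/funext => y /=; rewrite indicT mulr1.
Qed.

Lemma intY_cst (c : R) : intY (fun=> c).
Proof.
by have := intYZ c (intY_indic measurableT); congr (_.-integrable _ _);
  apply/funext => y /=; rewrite indicT mulr1.
Qed.

Lemma intY_sum n (f : 'I_n -> M -> R) : (forall i, intY (f i)) ->
  intY (fun y => \sum_(i < n) f i y).
Proof.
elim: n f => [|n IH] f If.
  by have := intY_cst 0; congr (_.-integrable _ _); apply/funext => y /=; rewrite big_ord0.
have := intYD (IH _ (fun i => If (widen_ord (leqnSn n) i))) (If ord_max).
by congr (_.-integrable _ _); apply/funext => y /=; rewrite big_ord_recr.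
Qed.

Lemma approximable_sum n (f : 'I_n -> M -> R) : (forall i, intY (f i)) ->
  (forall i, approximable (f i)) -> approximable (fun y => \sum_(i < n) f i y).
Proof.
elim: n f => [|n IH] f If af.
  have -> : (fun y => \sum_(i < 0) f i y) = fun=> 0.
    by apply/funext => y; rewrite big_ord0.
  exact: approximable_cst.
have -> : (fun y => \sum_(i < n.+1) f i y) =
    (fun y => (\sum_(i < n) f (widen_ord (leqnSn n) i) y) + f ord_max y).
  by apply/funext => y; rewrite big_ord_recr.
apply: approximableD => //; last exact: IH.
exact: intY_sum.
Qed.

Lemma l1_indic_sub A B : measurable A -> measurable B -> A `<=` B ->
  l1 \1_B \1_A = fine (mu (B `&` Y)) - fine (mu (A `&` Y)).
Proof.
move=> mA mB AB.
have intE D : measurable D -> \int[mu]_(y in Y) \1_D y = fine (mu (D `&` Y)).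
  by move=> mD; rewrite /Rintegral integral_indic.
rewrite -!intE // -RintegralB //; [|exact: intY_indic..].
apply: eq_Rintegral => y _; rewrite ger0_norm // subr_ge0 !indicE.
have [Ay|nAy] := boolP (y \in A); last by case: (y \in B).
by have -> : y \in B by apply/mem_set/AB/set_mem.
Qed.

Lemma approximable_indic_nd (E : nat -> set M) : (forall k, measurable (E k)) ->
  nondecreasing_seq E -> (forall k, approximable \1_(E k)) ->
  approximable \1_(\bigcup_k E k).
Proof.
move=> mE ndE aE; have mU : measurable (\bigcup_k E k) by exact: bigcupT_measurable.
apply: approximable_lim; first exact: intY_indic.
move=> e e0.
have mEY k : measurable (E k `&` Y) by exact: measurableI.
have h : mu \o (fun k => E k `&` Y) @ \oo --> mu (\bigcup_k (E k `&` Y)).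
  apply: nondecreasing_cvg_mu => //; first exact: bigcupT_measurable.
  by move=> m n mn; apply/subsetPset; apply: setSI; apply/subsetPset; exact: ndE.
rewrite -setI_bigcupl -[mu (_ `&` Y)]fineK ?fin_num_measure // in h; last exact: measurableI.
have {}h : fine \o (mu \o (fun k => E k `&` Y)) @ \oo --> fine (mu (\bigcup_k E k `&` Y)).
  exact: fine_cvg.
move/cvgrPdist_le : h => /(_ e e0)[k _ /(_ k (leqnn k))] /= hk.
exists \1_(E k); split => //; first exact: intY_indic.
rewrite l1_indic_sub //; last exact: bigcup_sup.
by apply: le_trans hk; exact: ler_norm.
Qed.

(** Dynkin induction starting from the open sets, which are stable under intersection and generate
    the measurable sets by [borel]. *)
Lemma approximable_indic A : measurable A -> approximable \1_A.
Proof.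
have sigE : @measurable _ M = <<s [set U | dopen dist U] >>.
  by apply/funext => B; apply/propext; exact: borel.
move=> mA; have : <<s [set U | dopen dist U] >> A by rewrite -sigE.
move: A {mA}; apply: dynkin_induction => //.
- move=> U V oU oV x [Ux Vx]; have [e [e0 eU]] := oU x Ux; have [e' [e0' eV]] := oV x Vx.
  exists (Num.min e e'); rewrite lt_min e0 e0'; split => // y /=.
  by rewrite lt_min => /andP[h h']; split; [exact: eU|exact: eV].
- have -> : \1_[set: M] = (fun=> 1) :> (M -> R) by apply/funext => y; rewrite indicT.
  exact: approximable_cst.
- move=> U oU.
  have mU : measurable U by apply/borel; exact: sub_sigma_algebra.
  (* The points whose whole cylinder of length [k] lies in [U]. As cylinders become small in the
     metric, these sets increase to the trace of [U] on [Y]. *)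
  pose E k := [set y | Y y /\ forall y', cylE k y y' -> U y'].
  have mE k : measurable (E k).
    apply: (measurable_cylinder_open mY FY part mF) => [y []//|y [Yy h]].
    exists k => y' yy'; split; first by have [] := cyl_eq_sub part yy'.
    by move=> y'' /(cyl_eq_trans part yy'); exact: h.
  have ndE : nondecreasing_seq E.
    apply/nondecreasing_seqP => k; apply/subsetPset => y [Yy h]; split => // y' yy'.
    by apply: h; exact: (cyl_eq_le part (leqnSn k) yy').
  have UE : \bigcup_k E k = U `&` Y.
    apply/seteqP; split => [y [k _ [Yy h]]|y [Uy Yy]].
      by split => //; apply: h; exact: cyl_eq_refl.
    have [e [e0 eU]] := oU y Uy; have [k hk] := small e0.
    by exists k => //; split => // y' yy'; apply: eU; exact: hk.
  have : approximable \1_(\bigcup_k E k).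
    apply: approximable_indic_nd => // k.
    apply: (@approximable_saturated k); first exact: intY_indic.
    move=> y y' yy'; rewrite !indicE; congr (nat_of_bool _)%:R.
    have sat z z' : cylE k z z' -> E k z -> E k z'.
      move=> zz' [Yz h]; split; first by have [] := cyl_eq_sub part zz'.
      by move=> z'' /(cyl_eq_trans part zz'); exact: h.
    by apply/idP/idP => /set_mem h; apply: mem_set; move: h; apply: sat => //; exact: cyl_eq_sym.
  rewrite UE => aUY e e0; have [k [s [sk Is hs]]] := aUY e e0.
  exists k, s; split => //; apply: le_trans hs; rewrite le_eqVlt; apply/orP; left; apply/eqP.
  apply: eq_Rintegral => y Yy; congr (`|_ - _|); rewrite !indicE in_setI.
  by rewrite Yy andbT.
- move=> B mB aB; have -> : \1_(~` B) = (fun y => 1 + (-1) * \1_B y) :> (M -> R).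
    by apply/funext => y; rewrite !indicE in_setC; case: (y \in B) => /=; rewrite ?mulr1 ?mulr0 ?subrr ?addr0.
  apply: approximableD; [exact: intY_cst|exact/intYZ/intY_indic|exact: approximable_cst|].
  by apply: approximableZ => //; exact: intY_indic.
- move=> E mE tE aE.
  pose G n := \bigcup_(k < n) E k.
  have mG n : measurable (G n).
    by rewrite /G bigcup_mkord; apply: bigsetU_measurable => i _.
  have -> : \bigcup_k E k = \bigcup_n G n.
    apply/seteqP; split => [y [k _ Eky]|y [n _ [k _ Eky]]]; last by exists k.
    by exists k.+1 => //; exists k => //=.
  apply: approximable_indic_nd => //.
    apply/nondecreasing_seqP => n; apply/subsetPset => y [k kn Eky]; exists k => //=.
    exact: ltnW.
  move=> n; have -> : \1_(G n) = (fun y => \sum_(i < n) \1_(E i) y) :> (M -> R).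
    apply/funext => y; rewrite indicE.
    have [Gy|nGy] := boolP (y \in G n).
      move: Gy => /set_mem[k /= kn Eky].
      rewrite (bigD1 (Ordinal kn)) //= indicE mem_set // big1 ?addr0 // => i ik.
      rewrite indicE memNset // => Eiy; move/eqP: ik; apply; apply/val_inj => /=.
      by apply: tE => //; exists y.
    rewrite big1 // => i _; rewrite indicE memNset // => Eiy.
    by move: nGy; rewrite notin_setE; apply; exists (val i) => /=.
  by apply: approximable_sum => i //; exact: intY_indic.
Qed.

Import HBSimple.

Lemma approximable_integrable f : intY f -> approximable f.
Proof.
move=> If; apply: approximable_lim => // e e0.
have [g [Ig _ hg]] := approximation_sfun_integrable mY If.
have {}hg : fine \o (fun n => \int[mu]_(z in Y) `|(f z)%:E - (g n z)%:E|)%E @ \oo --> (0 : R).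
  exact: fine_cvg.
move/cvgrPdist_le : hg => /(_ e e0)[n _ /(_ n (leqnn n))] /=.
rewrite sub0r normrN => hn; exists (g n); split; first exact: Ig.
- have := fimfunEord (g n); rewrite /=; set r := fset_set _ => gE.
  rewrite (funext gE : (g n : M -> R) = _).
  have mg (x : R) : measurable (g n @^-1` [set x]).
    exact: (measurable_sfunP (g n)).
  apply: approximable_sum => i.
    exact: (intYZ _ (intY_indic (mg _))).
  exact: (approximableZ _ (intY_indic (mg _)) (approximable_indic (mg _))).
- by apply: le_trans (le_trans (ler_norm _) hn).
Qed.

End CylinderApproximation.

(** * Regularity of the invariant measure *)

Section InvariantDensity.
Context {R : realType} {dM : measure_display} {M : measurableType dM}.
Variables (dist : M -> M -> R) (Y : set M) (F : M -> M) (I : set nat) (Yj : nat -> set M).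
Variables (gam C0 L : R).
Hypothesis borel : borel_wrt dist.
Hypothesis mY : measurable Y.
Hypothesis FY : forall y, Y y -> Y (F y).
Hypothesis part : is_partition Y I Yj.
Hypothesis mF : forall A, measurable A -> measurable (Y `&` F @^-1` A).
Hypothesis small : forall e, 0 < e -> exists k, forall y y',
  cyl_eq Y F I Yj k y y' -> dist y y' < e.
Hypothesis gam0 : 0 < gam.
Hypothesis gam1 : gam < 1.
Hypothesis L0 : 0 <= L.
Hypothesis LC : (L + C0) * gam <= L.
Variables (mu0 : {finite_measure set M -> \bar R}) (nu : {finite_measure set M -> \bar R}).
Hypothesis dist0 : distortion_le Y F I Yj gam (msr mu0) C0.
Implicit Types (A : set M).

Local Notation cyl := (wcyl Y F I Yj).
Local Notation bpre := (branch_preimage F I Yj).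
Local Notation push := (push Y F).
Local Notation log_holder := (log_holder Y F I Yj gam).

Lemma iter_push_preimage k A : measurable A -> A `<=` Y ->
  exists B, [/\ measurable B, B `<=` Y & forall m : set M -> R, iter k push m A = m B].
Proof.
elim: k A => [|k IH] A mA AY; first by exists A.
have [B [mB BY hB]] := IH _ (mF mA) (@subIsetl _ _ _).
by exists B; split => // m; rewrite iterS /push hB.
Qed.

Lemma finite_measure_on_iter_push k (m : set M -> R) :
  finite_measure_on Y m -> finite_measure_on Y (iter k push m).
Proof. by move=> fm; elim: k => // k IH; exact: finite_measure_on_push. Qed.

Lemma log_holder_iter_push (m : set M -> R) k l : finite_measure_on Y m ->
  log_holder (msr mu0) m (k + l) L -> log_holder (msr mu0) (iter k push m) l L.
Proof.
move=> fm; have fmu := finite_measure_on_msr mY mu0.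
elim: k l => [//|k IH] l h.
have := IH l.+1; rewrite addnS => /(_ h) h'.
have fk := finite_measure_on_iter_push k fm.
have h2 := log_holder_push part mF fmu fk dist0 h'.
exact: (log_holder_weaken part gam0 fmu (finite_measure_on_push mF fk) (leqnn l) LC h2).
Qed.

(** The density is only known to be integrable, so it is approximated in the mean by a function
    constant on cylinders of some length [k]. Such a function is regular with any constant on words
    of length at least [k], and [k] push-forwards make it regular on all words, the constant staying
    below [L] by [LC]. Invariance keeps the result close to [f], and the error tends to zero. *)
Lemma log_holder_invariant_dens f : (forall y, Y y -> 0 <= f y) ->
  mu0.-integrable Y (EFin \o f) ->
  (forall A, measurable A -> A `<=` Y -> push (dens mu0 f) A = dens mu0 f A) ->
  log_holder (msr mu0) (dens mu0 f) 0 L.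
Proof.
move=> f0 If inv w A A' w0 mA mA' Aw A'w.
have Yw : cyl w `<=` Y by exact: wcyl_sub.
have AY := subset_trans Aw Yw; have A'Y := subset_trans A'w Yw.
set c := expR _; have c0 : 0 < c by exact: expR_gt0.
have [_ mge0 _] := finite_measure_on_msr mY mu0.
(* Approximating within [e / K] makes the total error of the cross-multiplied inequality at most
   [e]. *)
pose K := msr mu0 A' + c * msr mu0 A + 1.
have K0 : 0 < K by rewrite ltr_wpDl // addr_ge0 ?mge0 // mulr_ge0 ?mge0 // ltW.
apply/ler_addgt0Pr => e e0.
have [|k [s [sk Is fs]]] := approximable_integrable borel mY FY part mF small If (e := e / K).
  exact: divr_gt0.
pose t y := `|s y|; have It : mu0.-integrable Y (EFin \o t) by exact: intY_norm.
have ft : l1 Y mu0 f t <= e / K.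
  apply: le_trans fs; apply: le_Rintegral => //.
  - by apply: intY_norm; apply: intYB.
  - by apply: intY_norm; apply: intYB.
  - move=> y Yy; rewrite -{1}(ger0_norm (f0 y Yy)); exact: ler_dist_dist.
have fmt : finite_measure_on Y (dens mu0 t).
  by apply: finite_measure_on_dens => // y _; exact: normr_ge0.
have Lt : log_holder (msr mu0) (dens mu0 t) (k + 0) L.
  rewrite addn0; apply: log_holder_dens => // v y y' kv vy vy'.
  have -> : t y = t y'.
    rewrite /t; congr (`|_|); apply: sk.
    by apply: (cyl_eq_le part kv); exists v.
  rewrite ler_peMl ?normr_ge0 //; apply: le_trans (expR_ge1Dx _).
  by rewrite lerDl mulr_ge0 // exprn_ge0 // ltW.
(* An iterated push-forward evaluates at a preimage, so it does not increase the distance in the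
   mean, and it fixes the invariant density. *)
have close D : measurable D -> D `<=` Y ->
    `|iter k push (dens mu0 t) D - dens mu0 f D| <= e / K.
  move=> mD DY; have [B [mB BY hB]] := iter_push_preimage k mD DY.
  have <- : iter k push (dens mu0 f) D = dens mu0 f D.
    elim: k D mD DY {sk Lt B mB BY hB} => [//|k IH] D mD DY.
    rewrite iterS /= {1}/push IH //; last exact: mF.
    exact: inv.
  rewrite !hB /dens; have IfB := integrable_restr mB mY BY If.
  have ItB := integrable_restr mB mY BY It.
  rewrite -RintegralB //; apply: le_trans ft.
  have Id : mu0.-integrable Y (EFin \o (fun y => `|t y - f y|)).
    by apply: intY_norm => //; exact: intYB.
  have IdB := integrable_restr mB mY BY Id.
  apply: le_trans (le_normr_Rintegral mB _) _.
    exact: (integrableB mB ItB IfB).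
  rewrite l1C.
  have [_ h2 h3] := finite_measure_on_dens mY (fun y _ => normr_ge0 (t y - f y)) Id.
  exact: (le_finite_measure_on (And3 (Rintegral_set0 _ _) h2 h3) mB mY BY).
have h := log_holder_iter_push fmt Lt (leq0n _) mA mA' Aw A'w.
rewrite -/c in h.
have hA := close A mA AY; have hA' := close A' mA' A'Y.
move: hA hA'; rewrite !ler_norml => /andP[hA1 hA2] /andP[hA'1 hA'2].
have mA0 := mge0 _ mA AY; have mA'0 := mge0 _ mA' A'Y.
have q1 : dens mu0 f A * msr mu0 A' <=
    (iter k push (dens mu0 t) A + e / K) * msr mu0 A'.
  by rewrite ler_wpM2r //; lra.
have q2 : c * (msr mu0 A * iter k push (dens mu0 t) A') <=
    c * (msr mu0 A * (dens mu0 f A' + e / K)).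
  by rewrite ler_pM2l // ler_wpM2l //; lra.
have q3 : (e / K) * (msr mu0 A' + c * msr mu0 A) <= e.
  rewrite -[leRHS](divfK (x := K)) ?gt_eqF //.
  by rewrite ler_pM2l ?divr_gt0 // /K lerDl.
nra.
Qed.

Hypothesis numu : nu `<< mu0.
Hypothesis invnu : forall A, measurable A -> A `<=` Y -> nu (Y `&` F @^-1` A) = nu A.
Hypothesis mu0Y : (0 < mu0 Y)%E.
Hypothesis nuY : nu Y = 1%E.

Lemma invariant_dens_exists : exists f, [/\ forall y, 0 <= f y,
  mu0.-integrable Y (EFin \o f) &
  forall A, measurable A -> A `<=` Y -> msr nu A = dens mu0 f A].
Proof.
exists (fun y => fine (Radon_Nikodym_SigmaFinite.f nu mu0 y)); split.
- by move=> y; apply: fine_ge0; exact: Radon_Nikodym_SigmaFinite.f_ge0.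
- have := Radon_Nikodym_SigmaFinite.f_integrable numu.
  move=> /(integrableS measurableT mY (@subsetT _ _)).
  congr (_.-integrable _ _); apply/funext => y /=.
  by rewrite fineK //; exact: Radon_Nikodym_SigmaFinite.f_fin_num.
- move=> A mA AY; rewrite /msr /dens /Rintegral.
  rewrite (Radon_Nikodym_SigmaFinite.f_integral numu) //; congr fine.
  apply: eq_integral => y _; rewrite fineK //.
  exact: Radon_Nikodym_SigmaFinite.f_fin_num.
Qed.

Lemma log_holder_invariant : log_holder (msr mu0) (msr nu) 0 L.
Proof.
have [f [f0 If fE]] := invariant_dens_exists.
have h : log_holder (msr mu0) (dens mu0 f) 0 L.
  apply: log_holder_invariant_dens => // A mA AY.
  rewrite /push -(fE _ (mF mA) (@subIsetl _ _ _)) -(fE _ mA AY).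
  by rewrite /msr invnu.
move=> w A A' w0 mA mA' Aw A'w; have Yw : cyl w `<=` Y by exact: wcyl_sub.
rewrite (fE _ mA (subset_trans Aw Yw)) (fE _ mA' (subset_trans A'w Yw)).
exact: h.
Qed.

(** The passage between [nu] and [mu0] is made twice: on the word [j :: w], which costs [L], and on
    [w], which costs [L / gam] because that word is one letter shorter. *)
Lemma distortion_invariant : distortion_le Y F I Yj gam (msr nu) (C0 + L + L / gam).
Proof.
have fmu := finite_measure_on_msr mY mu0; have fnu := finite_measure_on_msr mY nu.
have [_ mge0 _] := fmu; have [_ nge0 _] := fnu.
have [mnull mdist] := dist0.
have Lnu := log_holder_invariant.
have nuY1 : msr nu Y = 1 by rewrite /msr nuY.
have m0Y : 0 < msr mu0 Y.
  by rewrite /msr fine_gt0 // mu0Y /= -ge0_fin_numE // fin_num_measure.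
have bmes j A : measurable A -> measurable (bpre j A).
  exact: (measurable_branch_preimage part mF).
have bsub j A : bpre j A `<=` Y by exact: branch_preimage_sub.
have null A : measurable A -> A `<=` Y -> msr nu A = 0 <-> msr mu0 A = 0.
  move=> mA AY; split => h0.
    have := Lnu [::] Y A (leq0n _) mY mA (@subset_refl _ _) AY.
    rewrite nuY1 mul1r h0 !mulr0 => h1.
    by apply/eqP; rewrite eq_le h1 mge0.
  have := Lnu [::] A Y (leq0n _) mA mY AY (@subset_refl _ _).
  rewrite h0 mul0r mulr0 pmulr_lle0 // => h1.
  by apply/eqP; rewrite eq_le h1 nge0.
split => [j A Ij mA AY|j w A A' Ij mA mA' Aw A'w].
  by rewrite null // [X in _ <-> X]null //; [exact: mnull|exact: bmes].
have Yw : cyl w `<=` Y by exact: wcyl_sub.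
have AY := subset_trans Aw Yw; have A'Y := subset_trans A'w Yw.
have h1 := Lnu (j :: w) (bpre j A) (bpre j A') (leq0n _) (bmes _ _ mA) (bmes _ _ mA')
               (branch_preimageS Aw) (branch_preimageS A'w).
have h2 := mdist j w A A' Ij mA mA' Aw A'w.
have h3 := Lnu w A' A (leq0n _) mA' mA A'w Aw.
have e1 : expR ((C0 + L + L / gam) * gam ^+ (size w).+1) =
  expR (L * gam ^+ size (j :: w)) * expR (C0 * gam ^+ (size w).+1)
  * expR (L * gam ^+ size w).
  rewrite -!expRD; congr expR; rewrite /= exprS.
  by field; rewrite gt_eqF.
rewrite e1; move: h1 h2 h3.
set E1 := expR (L * gam ^+ size (j :: w)); set E2 := expR (C0 * _); set E3 := expR (L * _).
move=> h1 h2 h3.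
have E10 : 0 < E1 by exact: expR_gt0.
have E20 : 0 < E2 by exact: expR_gt0.
have E30 : 0 < E3 by exact: expR_gt0.
have rhs0 : 0 <= E1 * E2 * E3 * (msr nu (bpre j A') * msr nu A).
  by rewrite !mulr_ge0 ?(ltW E10) ?(ltW E20) ?(ltW E30) // nge0 //; exact: bmes.
have pos D : measurable D -> D `<=` Y -> msr mu0 D != 0 -> 0 < msr mu0 D.
  by move=> mD DY D0; rewrite lt_neqAle eq_sym D0 mge0.
have [z1|/(pos _ (bmes j _ mA) (bsub j A)) p1] := eqVneq (msr mu0 (bpre j A)) 0.
  by rewrite (null _ (bmes j _ mA) (bsub j A)).2 // mul0r.
have [z2|/(pos _ mA' A'Y) p2] := eqVneq (msr mu0 A') 0.
  by rewrite (null _ mA' A'Y).2 // mulr0.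
have p3 : 0 < msr mu0 (bpre j A').
  apply: pos; [exact: bmes|exact: bsub|apply/eqP => z].
  by have := (mnull j A' Ij mA' A'Y).2 z; move/eqP; rewrite (gt_eqF p2).
have p4 : 0 < msr mu0 A.
  apply: pos => //; apply/eqP => z.
  by have := (mnull j A Ij mA AY).1 z; move/eqP; rewrite (gt_eqF p1).
have n1 := nge0 _ (bmes j _ mA) (bsub j A).
have n2 := nge0 _ mA' A'Y.
have h12 := ler_pM (mulr_ge0 n1 (ltW p3)) (mulr_ge0 (ltW p1) (ltW p2)) h1 h2.
have h123 := ler_pM (mulr_ge0 (mulr_ge0 n1 (ltW p3)) (mulr_ge0 (ltW p1) (ltW p2)))
  (mulr_ge0 n2 (ltW p4)) h12 h3.
have P : 0 < msr mu0 (bpre j A) * msr mu0 A' * (msr mu0 (bpre j A') * msr mu0 A).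
  by rewrite !mulr_gt0.
rewrite -(ler_pM2l P).
apply: le_trans (le_trans h123 _); rewrite le_eqVlt; apply/orP; left; apply/eqP; ring.
Qed.

End InvariantDensity.

(** * From inequalities on sets to inequalities on functions *)

Section WeightedComposition.
Context {R : realType} {d : measure_display} {T : measurableType d}.
Variable mu : {measure set T -> \bar R}.
Implicit Types (f g : T -> R) (G : T -> T) (B : set T).

Import HBNNSimple.

Lemma integral_weighted_nnsfun (h : {nnsfun T >-> R}) : exists r : seq R,
  (forall i : 'I_(size r), 0 <= r`_i) /\
  forall f G, measurable_fun setT f -> (forall x, 0 <= f x) -> measurable_fun setT G ->
  (\int[mu]_x (f x * h (G x))%:E = \sum_(i < size r)
     (r`_i)%:E * \int[mu]_(x in G @^-1` (h @^-1` [set r`_i])) (f x)%:E)%E.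
Proof.
pose r : seq R := finmap.enum_fset (fset_set (range h)); exists r.
have r0 (i : 'I_(size r)) : 0 <= r`_i.
  have : r`_i \in fset_set (range h) by exact: mem_nth.
  by rewrite in_fset_set // => /set_mem[x _ <-].
split => // f G mf f0 mG.
have mh (z : R) : measurable (h @^-1` [set z]) by exact: (measurable_sfunP h).
have mGh (z : R) : measurable (G @^-1` (h @^-1` [set z])).
  by rewrite -[G @^-1` _]setTI; exact: mG.
have E x : (f x * h (G x))%:E = (\sum_(i < size r)
    (r`_i)%:E * ((f x)%:E * (\1_(G @^-1` (h @^-1` [set r`_i])) x)%:E))%E.
  rewrite fimfunEord -/r mulr_sumr -sumEFin; apply: eq_bigr => i _.
  by rewrite mulrCA -!EFinM.
have mi (z : R) : measurable_fun setT
    (fun x => ((f x)%:E * (\1_(G @^-1` (h @^-1` [set z])) x)%:E)%E).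
  under eq_fun do rewrite -EFinM.
  apply/measurable_EFinP; apply: measurable_funM => //.
under eq_integral do rewrite E.
rewrite ge0_integral_sum //; last 2 first.
- by move=> i; apply: measurable_funeM.
- by move=> i x _; rewrite -!EFinM lee_fin !mulr_ge0.
apply: eq_bigr => i _; rewrite ge0_integralZl //; last 2 first.
- by move=> x _; rewrite -EFinM lee_fin mulr_ge0.
- by rewrite lee_fin.
congr (_ * _)%E; rewrite [RHS]integral_mkcond; apply: eq_integral => x _.
rewrite patchE indicE; case: (x \in _); first by rewrite mule1.
by rewrite mule0.
Qed.

(* It suffices to compare two weighted compositions on indicator functions. *)
Lemma le_integral_weighted f1 f2 G1 G2 :
  measurable_fun setT f1 -> measurable_fun setT f2 ->
  (forall x, 0 <= f1 x) -> (forall x, 0 <= f2 x) ->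
  measurable_fun setT G1 -> measurable_fun setT G2 ->
  (forall B, measurable B -> (\int[mu]_(x in G1 @^-1` B) (f1 x)%:E <=
                              \int[mu]_(x in G2 @^-1` B) (f2 x)%:E)%E) ->
  forall g, measurable_fun setT g -> (forall x, 0 <= g x) ->
  (\int[mu]_x (f1 x * g (G1 x))%:E <= \int[mu]_x (f2 x * g (G2 x))%:E)%E.
Proof.
move=> mf1 mf2 f10 f20 mG1 mG2 H g mg g0.
have mg' : measurable_fun setT (EFin \o g) by exact/measurable_EFinP.
pose h := nnsfun_approx measurableT mg'.
have cvh f G x : (f x * g (G x))%:E = limn (fun n => (f x * h n (G x))%:E).
  apply/esym/cvg_lim => //; under eq_fun do rewrite EFinM.
  rewrite EFinM; apply: cvgeZl => //.
  by apply: cvg_nnsfun_approx => // y _; rewrite lee_fin.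
have cvI f G : measurable_fun setT f -> (forall x, 0 <= f x) -> measurable_fun setT G ->
   (fun n => \int[mu]_x (f x * h n (G x))%:E)%E @ \oo --> (\int[mu]_x (f x * g (G x))%:E)%E.
  move=> mf f0 mG; under [X in _ --> X]eq_integral do rewrite cvh.
  apply: cvg_monotone_convergence => //.
  - move=> n; apply/measurable_EFinP; apply: measurable_funM => //.
    exact: measurableT_comp.
  - by move=> n x _; rewrite lee_fin mulr_ge0.
  - move=> x _ m n mn; rewrite lee_fin ler_wpM2l //.
    by apply/lefP; exact: nd_nnsfun_approx.
have c1 := cvI f1 G1 mf1 f10 mG1; have c2 := cvI f2 G2 mf2 f20 mG2.
rewrite -(cvg_lim _ c1) // -(cvg_lim _ c2) //.
apply: lee_lim; [by apply/cvg_ex; eexists; exact: c1|by apply/cvg_ex; eexists; exact: c2|].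
apply: nearW => n; have [r [r0 hr]] := integral_weighted_nnsfun (h n).
rewrite !hr //; apply: lee_sum => i _; apply: lee_wpmul2l; first by rewrite lee_fin.
by apply: H; exact: (measurable_sfunP (h n)).
Qed.

End WeightedComposition.

(** * Mixing in terms of functions *)

Section Mixing.
Context {R : realType} {dM : measure_display} {M : measurableType dM}.
Variables (Y : set M) (F : M -> M) (I : set nat) (Yj : nat -> set M) (gam C0 : R).
Hypothesis mY : measurable Y.
Hypothesis FY : forall y, Y y -> Y (F y).
Hypothesis part : is_partition Y I Yj.
Hypothesis mF : forall A, measurable A -> measurable (Y `&` F @^-1` A).
Hypothesis gam0 : 0 < gam.
Hypothesis gam1 : gam < 1.
Hypothesis C00 : 0 <= C0.
Variable mu : probability M R.
Hypothesis muY : mu Y = 1%E.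
Hypothesis invmu : forall A, measurable A -> A `<=` Y -> mu (Y `&` F @^-1` A) = mu A.
Hypothesis dmu : distortion_le Y F I Yj gam (msr mu) C0.
Implicit Types (f g : M -> R) (A B : set M).

(** [F] is controlled on [Y] only. Extended by the identity it is measurable on all of [M] and
    preserves [mu], which is carried by [Y]; the moment bounds require such a map. *)
Definition extend_id y := if y \in Y then F y else y.
Local Notation Ft := extend_id.

Lemma extend_idE y : Y y -> Ft y = F y.
Proof. by move=> Yy; rewrite /Ft mem_set. Qed.

Lemma iter_extend_id k y : Y y -> iter k Ft y = iter k F y /\ Y (iter k F y).
Proof.
move=> Yy; elim: k => [//|k [IH1 IH2]] /=.
by rewrite IH1 extend_idE //; split => //; exact: FY.
Qed.

Lemma measurable_extend_id : measurable_fun setT Ft.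
Proof.
move=> _ A mA; rewrite setTI.
have -> : Ft @^-1` A = (Y `&` F @^-1` A) `|` (~` Y `&` A).
  apply/seteqP; split => y; rewrite /preimage /= /Ft; case: ifPn.
  - by move=> /set_mem Yy FyA; left.
  - by rewrite notin_setE => nYy Ay; right.
  - by move=> /set_mem Yy [[_ //]|[nYy]].
  - by rewrite notin_setE => nYy [[Yy]|[_ //]].
by apply: measurableU; [exact: mF|apply: measurableI => //; exact: measurableC].
Qed.

Lemma null_compl : mu (~` Y) = 0%E.
Proof. by rewrite probability_setC // muY subee. Qed.

Lemma measure_restr A : measurable A -> mu A = mu (A `&` Y).
Proof.
move=> mA; rewrite (measureDI mu mA mY) /=.
have -> : mu (A `\` Y) = 0%E.
  apply/eqP; rewrite eq_le measure_ge0 andbT -null_compl; apply: le_measure.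
  - by apply/mem_set; exact: measurableD.
  - by apply/mem_set; exact: measurableC.
  - by move=> y [].
by rewrite add0e.
Qed.

Lemma invariant_extend_id A : measurable A -> mu (Ft @^-1` A) = mu A.
Proof.
move=> mA.
have mFA : measurable (Ft @^-1` A).
  by rewrite -[_ @^-1` _]setTI; exact: measurable_extend_id.
rewrite measure_restr // (measure_restr mA) -(invmu (A := A `&` Y)); last 2 first.
- exact: measurableI.
- exact: subIsetr.
congr (mu _); apply/seteqP; split => y.
- by move=> [/= h Yy]; rewrite extend_idE // in h; split => //; split => //; exact: FY.
- by move=> [Yy [FA FYy]]; split => //=; rewrite extend_idE.
Qed.

Lemma ge0_integral_restr (f : M -> \bar R) A : measurable A -> measurable_fun setT f ->
  (forall x, 0 <= f x)%E ->
  (\int[mu]_(x in A) f x = \int[mu]_(x in A `&` Y) f x)%E.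
Proof.
move=> mA mf f0; rewrite (@ge0_negligible_integral _ _ _ mu A (~` Y)) //.
- by rewrite setDE setCK.
- exact: measurableC.
- exact: measurable_funTS.
- exact: null_compl.
Qed.

(** The regularity of [f] is assumed on nonempty words only, since it may jump between partition
    elements. One push-forward extends it to the empty word, after which [iter_push_mixing] applies;
    hence the shift from [n] to [n.+1]. *)
Lemma mixing_dens (R1 : R) : 0 <= R1 -> exists K s : R, [/\ 0 <= K, 0 <= s < 1 &
  forall f, measurable_fun setT f -> (forall x, 0 <= f x) ->
  mu.-integrable setT (EFin \o f) ->
  (forall w y y', (0 < size w)%N -> wcyl Y F I Yj w y -> wcyl Y F I Yj w y' ->
     f y <= expR (R1 * gam ^+ size w) * f y') ->
  forall n B, measurable B ->
    `|\int[mu]_(x in iter n.+1 Ft @^-1` B) f x - mean mu f * msr mu B| <=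
    K * s ^+ n * (mean mu f * msr mu B)].
Proof.
move=> R10; have g0 := gam0; have g1 := gam1; have c0 := C00.
(* The first summand solves [(L + 1 + C0) * gam = L]; the second dominates the constant of [f] after
   one push-forward. *)
pose L := (1 + C0) * gam / (1 - gam) + (R1 + C0) * gam.
have L00 : 0 <= (1 + C0) * gam / (1 - gam).
  by rewrite divr_ge0 ?mulr_ge0 //; lra.
have L01 : 0 <= (R1 + C0) * gam by rewrite mulr_ge0 //; lra.
have L0 : 0 <= L by rewrite /L addr_ge0.
have LR : (R1 + C0) * gam <= L by rewrite /L lerDr.
have LC : (L + 1 + C0) * gam <= L.
  have : (1 + C0) * gam <= L * (1 - gam).
    by rewrite /L [leRHS]mulrDl divfK ?gt_eqF ?subr_gt0 // lerDl mulr_ge0 // subr_ge0 ltW.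
  lra.
have nuY1 : msr mu Y = 1 by exact: (congr1 fine muY).
have fmu := finite_measure_on_msr mY mu.
have inv' A : measurable A -> A `<=` Y -> push Y F (msr mu) A = msr mu A.
  by move=> mA AY; exact: (congr1 fine (invmu mA AY)).
have sb := contraction_rate_bounds L0.
exists (expR L), (contraction_rate L); split => //.
move=> f mf f0 If fdist n B mB.
have IfY : mu.-integrable Y (EFin \o f) by exact: integrable_restr If.
have fmd := @finite_measure_on_dens _ _ _ _ mY mu f (fun y _ => f0 y) IfY.
have Ld : log_holder Y F I Yj gam (msr mu) (dens mu f) 1 R1.
  by apply: log_holder_dens.
have Lp := log_holder_push part mF fmu fmd dmu Ld.
have fmp := finite_measure_on_push mF fmd.
have Lp' := log_holder_weaken part gam0 fmu fmp (leqnn 0) LR Lp.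
have mBY : measurable (B `&` Y) by exact: measurableI.
have := iter_push_mixing mY FY part mF gam0 gam1 fmu nuY1 inv' dmu L0 LC n fmp Lp' mBY
  (@subIsetr _ _ _).
have mfE : measurable_fun setT (EFin \o f) by exact/measurable_EFinP.
have f0E x : (0 <= (EFin \o f) x)%E by rewrite lee_fin.
have massE : push Y F (dens mu f) Y = mean mu f.
  rewrite /push /mean /dens /Rintegral; congr fine.
  rewrite [RHS](ge0_integral_restr measurableT mfE f0E).
  congr (integral _ _ _); apply/seteqP; split => y; first by case.
  by move=> [_ Yy]; split => //; exact: FY.
have -> : msr mu (B `&` Y) = msr mu B by exact/esym/(congr1 fine (measure_restr mB)).
rewrite massE -iterSr.
have pushE k A : A `<=` Y ->
    iter k (push Y F) (dens mu f) A = dens mu f (Y `&` iter k F @^-1` A).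
  elim: k A => [|k IH] A AY; first by rewrite /= setIidr.
  rewrite iterS {1}/push IH; last exact: subIsetl.
  congr (dens _ _ _); apply/seteqP; split => y; first by move=> [Yy [_ h]].
  by move=> [Yy h]; split => //; split => //; have [_] := iter_extend_id k Yy.
rewrite pushE; last exact: subIsetr.
have mG : measurable (iter n.+1 Ft @^-1` B).
  by rewrite -[_ @^-1` _]setTI; exact: (measurable_iter measurable_extend_id).
suff -> : dens mu f (Y `&` iter n.+1 F @^-1` (B `&` Y)) =
    \int[mu]_(x in iter n.+1 Ft @^-1` B) f x by [].
rewrite /dens /Rintegral; congr fine.
rewrite [RHS](ge0_integral_restr mG mfE f0E).
congr (integral _ _ _); apply/seteqP; split => y.
- move=> [Yy [h _]]; split => //; rewrite /preimage [iter]lock /= -lock.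
  by have [-> _] := iter_extend_id n.+1 Yy.
- move=> [h Yy]; split => //; have [e Yi] := iter_extend_id n.+1 Yy; split => //.
  by rewrite /preimage [iter]lock /= -lock -e.
Qed.

(** Stated with extended integrals so that [f] may be unbounded: the roof function itself will be
    used as a density. *)
Lemma mixing_fun (R1 : R) : 0 <= R1 -> exists K s : R, [/\ 0 <= K, 0 <= s < 1 &
  forall f, measurable_fun setT f -> (forall x, 0 <= f x) ->
  mu.-integrable setT (EFin \o f) ->
  (forall w y y', (0 < size w)%N -> wcyl Y F I Yj w y -> wcyl Y F I Yj w y' ->
     f y <= expR (R1 * gam ^+ size w) * f y') ->
  forall n g, measurable_fun setT g -> (forall x, 0 <= g x) ->
   (\int[mu]_x (f x * g (iter n.+1 Ft x))%:E <=
      \int[mu]_x ((1 + K * s ^+ n) * mean mu f * g x)%:E)%E /\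
   (0 <= 1 - K * s ^+ n ->
     (\int[mu]_x ((1 - K * s ^+ n) * mean mu f * g x)%:E <=
      \int[mu]_x (f x * g (iter n.+1 Ft x))%:E)%E)].
Proof.
move=> R10; have [K [s [K0 /andP[s0 s1] H]]] := mixing_dens R10.
exists K, s; split => //; first by rewrite s0.
move=> f mf f0 If fdist n g mg g0; have {}H := H f mf f0 If fdist n.
have mFt := measurable_iter measurable_extend_id n.+1.
have mG B : measurable B -> measurable (iter n.+1 Ft @^-1` B).
  by move=> mB; rewrite -[_ @^-1` _]setTI; exact: mFt.
have E B : measurable B -> (\int[mu]_(x in iter n.+1 Ft @^-1` B) (f x)%:E =
    (\int[mu]_(x in iter n.+1 Ft @^-1` B) f x)%:E)%E.
  move=> mB; rewrite /Rintegral fineK //; apply: integrable_fin_num; first exact: mG.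
  exact: (integrable_restr (mG B mB) measurableT (@subsetT _ _) If).
have m0 : 0 <= mean mu f by exact: mean_ge0.
have cE (c : R) B : measurable B -> 0 <= c ->
    (\int[mu]_(x in id @^-1` B) c%:E = (c * msr mu B)%:E)%E.
  move=> mB c0; rewrite integral_cst // EFinM /msr fineK //; exact: fin_num_measure.
split => [|c0].
- apply: (@le_integral_weighted _ _ _ mu f (fun=> (1 + K * s ^+ n) * mean mu f)
            (iter n.+1 Ft) id) => //.
  + by move=> x; rewrite !mulr_ge0 // addr_ge0 // mulr_ge0 // exprn_ge0.
  + move=> B mB; rewrite E // cE //; last first.
      by rewrite !mulr_ge0 // addr_ge0 // mulr_ge0 // exprn_ge0.
    by rewrite lee_fin; have := H B mB; rewrite ler_norml => /andP[]; lra.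
- apply: (@le_integral_weighted _ _ _ mu (fun=> (1 - K * s ^+ n) * mean mu f) f
            id (iter n.+1 Ft)) => //.
  + by move=> x; rewrite !mulr_ge0.
  + move=> B mB; rewrite E // cE //; last by rewrite !mulr_ge0.
    by rewrite lee_fin; have := H B mB; rewrite ler_norml => /andP[]; lra.
Qed.

Lemma mixing_mean (R1 : R) : 0 <= R1 -> exists K s : R, [/\ 0 <= K, 0 <= s < 1 &
  forall f, bddm f -> (forall x, 0 <= f x) ->
  (forall w y y', (0 < size w)%N -> wcyl Y F I Yj w y -> wcyl Y F I Yj w y' ->
     f y <= expR (R1 * gam ^+ size w) * f y') ->
  forall n g, bddm g -> (forall x, 0 <= g x) ->
   `|mean mu (fun x => f x * g (iter n.+1 Ft x)) - mean mu f * mean mu g| <=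
     K * s ^+ n * (mean mu f * mean mu g)].
Proof.
move=> R10; have [K [s [K0 /andP[s0 s1] H]]] := mixing_fun R10.
exists K, s; split => //; first by rewrite s0.
move=> f bf f0 fdist n g bg g0.
have mf := bf.1; have mg := bg.1.
have If := bddm_integrable mu bf.
have [h1 h2] := H f mf f0 If fdist n g mg g0.
have bfg : bddm (fun x => f x * g (iter n.+1 Ft x)).
  by apply: bddmM => //; exact: (bddm_iter measurable_extend_id).
have m0 : 0 <= mean mu f by exact: mean_ge0.
have mg0 : 0 <= mean mu g by exact: mean_ge0.
have m1 : 0 <= mean mu (fun x => f x * g (iter n.+1 Ft x)).
  by apply: mean_ge0 => x; exact: mulr_ge0.
have ks : 0 <= K * s ^+ n by rewrite mulr_ge0 // exprn_ge0.
rewrite -!EFin_mean // in h1 h2; try exact: bddmZ.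
rewrite !lee_fin !meanZ // in h1 h2.
have mm : 0 <= mean mu f * mean mu g by exact: mulr_ge0.
rewrite ler_norml; apply/andP; split; last by lra.
(* When the relative error exceeds 1 the lower bound is negative, and positivity of the mean is
   enough. *)
have [c0|c0] := leP 0 (1 - K * s ^+ n); first by have := h2 c0; lra.
have : 0 <= (K * s ^+ n - 1) * (mean mu f * mean mu g) by rewrite mulr_ge0 //; lra.
lra.
Qed.

End Mixing.

(** * Truncated observables *)

Lemma pos_neg_parts {R : realType} (y : R) :
  y = Num.max y 0 - Num.max (- y) 0 /\ `|y| = Num.max y 0 + Num.max (- y) 0.
Proof.
have [h|h] := leP y 0.
  by rewrite ler0_norm // max_l; [split; ring|lra].
by rewrite gtr0_norm // max_r; [split; ring|lra].
Qed.

Section Truncation.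
Context {R : realType} {dM : measure_display} {M : measurableType dM}.
Variables (Y : set M) (F : M -> M) (I : set nat) (Yj : nat -> set M) (gam C0 : R).
Hypothesis mY : measurable Y.
Hypothesis FY : forall y, Y y -> Y (F y).
Hypothesis part : is_partition Y I Yj.
Hypothesis mF : forall A, measurable A -> measurable (Y `&` F @^-1` A).
Hypothesis gam0 : 0 < gam.
Hypothesis gam1 : gam < 1.
Hypothesis C00 : 0 <= C0.
Variable mu : probability M R.
Hypothesis muY : mu Y = 1%E.
Hypothesis invmu : forall A, measurable A -> A `<=` Y -> mu (Y `&` F @^-1` A) = mu A.
Hypothesis dmu : distortion_le Y F I Yj gam (msr mu) C0.
Local Notation cylE := (cyl_eq Y F I Yj).
Local Notation Ft := (extend_id Y F).

Variables (H Hs : M -> R) (D : R).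
Hypothesis D1 : 1 <= D.
Hypothesis Hs_cyl : forall y y', cylE 1 y y' -> Hs y = Hs y'.
Hypothesis Hs0 : forall y, Y y -> 0 < Hs y.
Hypothesis HsH : forall y, Y y -> Hs y <= H y.
Hypothesis HHs : forall y, Y y -> H y <= (1 + D) * Hs y.
Hypothesis Hreg : forall k y y', (0 < k)%N -> cylE k y y' ->
  `|H y - H y'| <= D * gam ^+ k * Hs y.

(* The properties of [V y := \int_0^{H y} v (T_s y) ds] when [v] has Hoelder norm at most 1;
   [Hs] is the infimum of [H] on the partition element. *)
Record induced_observable (V : M -> R) : Prop := InducedObservable {
  io_le : forall y, Y y -> `|V y| <= H y;
  io_reg : forall k y y', (0 < k)%N -> cylE k y y' ->
    `|V y - V y'| <= D * gam ^+ k * Hs y;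
  io_mean0 : \int[mu]_(y in Y) V y = 0 }.

Lemma gam_expn_small (c e : R) : 0 < e -> exists k, (0 < k)%N /\ c * gam ^+ k < e.
Proof.
move=> e0; have [c0|c0] := leP c 0.
  exists 1%N; split => //; apply: le_lt_trans e0.
  by rewrite mulr_le0_ge0 // exprn_ge0 // ltW.
have h : (fun k => gam ^+ k) @ \oo --> (0 : R).
  by apply: cvg_expr; rewrite ger0_norm // ltW.
have ec0 : 0 < e / c by rewrite divr_gt0.
move/cvgrPdist_lt : h => /(_ _ ec0)[k _ /(_ k.+1)] /= hk.
exists k.+1; split => //; have := hk (leqnSn k).
rewrite sub0r normrN ger0_norm ?exprn_ge0 ?(ltW gam0) //.
by rewrite ltr_pdivlMr // mulrC.
Qed.

Lemma measurable_regular (V : M -> R) : (forall k y y', (0 < k)%N -> cylE k y y' ->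
    `|V y - V y'| <= D * gam ^+ k * Hs y) -> measurable_fun Y V.
Proof.
move=> Vreg; apply: (measurable_cylinder_continuous mY FY part mF) => y e Yy e0.
have [k [k0 hk]] := gam_expn_small (D * Hs y) e0; exists k => y' yy'.
by apply: le_lt_trans (Vreg k y y' k0 yy') _; rewrite mulrAC.
Qed.

(** Defined through [Hs], which is constant on partition elements, so that cutting off to this set
    does not affect regularity on cylinders. *)
Definition trunc_set (t0 : R) := [set y | Y y /\ Hs y <= t0].

Lemma measurable_trunc_set t0 : measurable (trunc_set t0).
Proof.
apply: (measurable_cylinder_open mY FY part mF) => [y []//|y [Yy h]].
exists 1%N => y' yy'; split; first by have [] := cyl_eq_sub part yy'.
by rewrite -(Hs_cyl yy').
Qed.

(** The factor [1 + D] compensates for truncating by [Hs]: on [trunc_set t0] one has [H <= (1 + D) *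
    Hs <= (1 + D) * min(H, t0)]. The summand 1 makes all powers of this function monotone in the
    exponent. *)
Definition truncU (t0 : R) y : R := 1 + (1 + D) * Num.min ((H \_ Y) y) t0.

Definition envelope y : R := 1 + (1 + D) * (H \_ Y) y.

Lemma H_ge0 y : Y y -> 0 <= H y.
Proof. by move=> Yy; apply: le_trans (HsH Yy); exact/ltW/Hs0. Qed.

Lemma HY_ge0 y : 0 <= (H \_ Y) y.
Proof. by rewrite patchE; case: ifPn => // /set_mem; exact: H_ge0. Qed.

Lemma measurable_patch (A : set M) (f : M -> R) : measurable A -> A `<=` Y ->
  measurable_fun Y f -> measurable_fun setT (f \_ A).
Proof.
move=> mA AY mf; apply/(measurable_restrictT _ mA).
exact: measurable_funS mf.
Qed.

Lemma mHY : measurable_fun setT (H \_ Y).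
Proof. by apply: measurable_patch => //; exact: measurable_regular. Qed.

Section FixT.
Variable t0 : R.
Hypothesis t00 : 0 < t0.

Lemma min_bounds y : 0 <= Num.min ((H \_ Y) y) t0 <= t0.
Proof. by rewrite le_min HY_ge0 (ltW t00) /= ge_min lexx orbT. Qed.

Lemma truncU1 y : 1 <= truncU t0 y.
Proof.
have /andP[h _] := min_bounds y; have d := D1.
by rewrite /truncU lerDl mulr_ge0 //; lra.
Qed.

Lemma bddm_truncU : bddm (truncU t0).
Proof.
split.
  apply: measurable_funD => //; apply: measurable_funM => //.
  by apply: measurable_minr => //; exact: mHY.
have d := D1.
exists (1 + (1 + D) * t0) => y; have /andP[h1 h2] := min_bounds y.
rewrite ger0_norm; last by apply: le_trans (truncU1 y).
by rewrite lerD2l ler_wpM2l //; lra.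
Qed.

Lemma truncU_ge_H y : Y y -> Num.min (H y) t0 <= truncU t0 y.
Proof.
move=> Yy; have /andP[h _] := min_bounds y; move: h; rewrite /truncU patchT ?mem_set //.
by move=> h; have d := D1; nra.
Qed.

Lemma truncU_ge_trunc y : trunc_set t0 y -> H y <= truncU t0 y.
Proof.
move=> [Yy Ht]; rewrite /truncU patchT ?mem_set //; have d := D1.
apply: (@le_trans _ _ ((1 + D) * Num.min (H y) t0)); last by rewrite lerDr.
apply: le_trans (HHs Yy) _; rewrite ler_wpM2l //; first by lra.
by rewrite le_min HsH.
Qed.

Lemma cyl_ratio_H k y y' : (0 < k)%N -> cylE k y y' ->
  H y <= expR (D * gam ^+ k) * H y'.
Proof.
move=> k0 yy'; have [Yy Yy'] := cyl_eq_sub part yy'.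
have := Hreg k0 yy'; rewrite ler_norml => /andP[_ h].
have e1 : Hs y = Hs y' by apply: Hs_cyl; exact: (cyl_eq_le part k0 yy').
have h2 := HsH Yy'; have h3 := H_ge0 Yy'.
have c0 : 0 <= D * gam ^+ k.
  by rewrite mulr_ge0 ?exprn_ge0 ?(ltW gam0) // (le_trans _ D1).
apply: (@le_trans _ _ ((1 + D * gam ^+ k) * H y')).
  rewrite e1 in h; have := ler_wpM2l c0 h2; lra.
by rewrite ler_wpM2r // expR_ge1Dx.
Qed.

Lemma cyl_ratio_truncU k y y' : (0 < k)%N -> cylE k y y' ->
  truncU t0 y <= expR (D * gam ^+ k) * truncU t0 y'.
Proof.
move=> k0 yy'; have [Yy Yy'] := cyl_eq_sub part yy'.
have h := cyl_ratio_H k0 yy'; have d := D1.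
have e1 : 1 <= expR (D * gam ^+ k).
  rewrite -expR0 ler_expR mulr_ge0 ?exprn_ge0 ?(ltW gam0) //; lra.
rewrite /truncU !patchT ?mem_set // mulrDr mulr1 lerD // mulrCA ler_wpM2l //; first lra.
have h3 := H_ge0 Yy'.
have [_|_] := leP (H y') t0; first by rewrite ge_min h.
by rewrite ge_min; apply/orP; right; rewrite ler_peMl // ltW.
Qed.

Lemma cyl_ratio_truncU_powR a w y y' : 0 <= a -> (0 < size w)%N ->
  wcyl Y F I Yj w y -> wcyl Y F I Yj w y' ->
  truncU t0 y `^ a <= expR (a * D * gam ^+ size w) * truncU t0 y' `^ a.
Proof.
move=> a0 w0 wy wy'.
have yy' : cylE (size w) y y' by exists w.
have U0 z : 0 <= truncU t0 z by apply: le_trans (truncU1 z).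
apply: le_trans (ler_powR2l a0 (U0 _) (cyl_ratio_truncU w0 yy')) _.
rewrite powRM ?expR_ge0 // -expRM le_eqVlt; apply/orP; left; apply/eqP.
by congr (expR _ * _); ring.
Qed.

Lemma trunc_set_cyl k y y' : (0 < k)%N -> cylE k y y' ->
  trunc_set t0 y -> trunc_set t0 y'.
Proof.
move=> k0 yy' [Yy h]; split; first by have [] := cyl_eq_sub part yy'.
by rewrite -(Hs_cyl (cyl_eq_le part k0 yy')).
Qed.

Lemma bddm_trunc (V : M -> R) : measurable_fun Y V -> (forall y, Y y -> `|V y| <= H y) ->
  bddm (V \_ (trunc_set t0)).
Proof.
move=> mV VH; split.
  by apply: measurable_patch => //; [exact: measurable_trunc_set|move=> y []].
have d := D1; exists ((1 + D) * t0) => y; rewrite patchE; case: ifPn => [/set_mem Qy|_].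
  have [Yy h] := Qy; apply: le_trans (VH y Yy) (le_trans (HHs Yy) _).
  by rewrite ler_wpM2l //; lra.
by rewrite normr0 mulr_ge0 ?(ltW t00) //; lra.
Qed.

(** Mixing concerns nonnegative densities, and [V] has no sign. Adding [2 * H] gives a function that
    is at least [H], hence at least [Hs], so the additive variation [3 * D * gam ^+ k * Hs] of the
    sum becomes a multiplicative one. *)
Lemma cyl_ratio_shifted V : induced_observable V ->
  forall w y y', (0 < size w)%N -> wcyl Y F I Yj w y -> wcyl Y F I Yj w y' ->
  (V \_ (trunc_set t0)) y + 2 * (H \_ (trunc_set t0)) y <=
    expR (3 * D * gam ^+ size w) *
    ((V \_ (trunc_set t0)) y' + 2 * (H \_ (trunc_set t0)) y').
Proof.
move=> [VH Vreg _] w y y' w0 wy wy'.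
have yy' : cylE (size w) y y' by exists w.
have y'y : cylE (size w) y' y by exists w.
have [Yy Yy'] := cyl_eq_sub part yy'.
rewrite !patchE; have [/set_mem Qy|nQy] := boolP (y \in trunc_set t0); last first.
  have /negPf -> : y' \notin trunc_set t0.
    apply: contra nQy => /set_mem Qy'; apply/mem_set.
    exact: trunc_set_cyl y'y Qy'.
  by rewrite !mulr0 addr0 mulr0.
rewrite (mem_set (trunc_set_cyl w0 yy' Qy)).
set g := gam ^+ size w.
have h1 := Vreg _ _ _ w0 yy'; have h2 := Hreg w0 yy'.
move: h1 h2; rewrite !ler_norml -/g => /andP[_ h1] /andP[_ h2].
have e1 : Hs y = Hs y' by apply: Hs_cyl; exact: (cyl_eq_le part w0 yy').
have h3 := HsH Yy'; rewrite e1 in h1 h2.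
have g0 : 0 <= g by rewrite exprn_ge0 // ltW.
have d := D1; have dg : 0 <= D * g by rewrite mulr_ge0 //; lra.
have h4 : H y' <= V y' + 2 * H y'.
  by have := VH y' Yy'; rewrite ler_norml => /andP[]; lra.
apply: (@le_trans _ _ ((1 + 3 * (D * g)) * (V y' + 2 * H y'))).
  have h5 : 3 * (D * g) * Hs y' <= 3 * (D * g) * (V y' + 2 * H y').
    by apply: ler_wpM2l; [exact: mulr_ge0|exact: le_trans h3 h4].
  lra.
have := H_ge0 Yy'; move=> h6.
rewrite ler_wpM2r //; first lra.
by apply: le_trans (expR_ge1Dx _); rewrite mulrA.
Qed.

End FixT.

Lemma le_mean_int (f g : M -> R) : bddm f -> mu.-integrable setT (EFin \o g) ->
  (forall x, f x <= g x) -> mean mu f <= mean mu g.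
Proof. by move=> bf ig fg; apply: le_Rintegral => //; exact: bddm_integrable. Qed.

Hypothesis int2 : mu.-integrable setT (EFin \o (fun y => envelope y `^ 2)).

Lemma envelope1 y : 1 <= envelope y.
Proof. by have d := D1; rewrite /envelope lerDl mulr_ge0 ?HY_ge0 //; lra. Qed.

Lemma envelope_ge_H y : Y y -> H y <= envelope y.
Proof.
move=> Yy; have := HY_ge0 y; rewrite /envelope patchT ?mem_set // => h.
by have d := D1; nra.
Qed.

Lemma truncU_le_envelope t0 y : truncU t0 y <= envelope y.
Proof.
rewrite /truncU /envelope lerD2l ler_wpM2l //; first by have d := D1; lra.
by rewrite ge_min lexx.
Qed.

Lemma measurable_envelope : measurable_fun setT envelope.
Proof. by apply: measurable_funD => //; apply: measurable_funM => //; exact: mHY. Qed.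

Lemma integrable_envelope a b : 0 <= a -> a <= b ->
  mu.-integrable setT (EFin \o (fun y => envelope y `^ b)) ->
  mu.-integrable setT (EFin \o (fun y => envelope y `^ a)).
Proof.
move=> a0 ab ib; apply: le_integrable ib => //.
  apply/measurable_EFinP; apply: (measurableT_comp (measurable_powR _)).
  exact: measurable_envelope.
move=> y _ /=; rewrite lee_fin !ger0_norm ?powR_ge0 // ler_powR //.
exact: envelope1.
Qed.

(** Since [V] has mean zero, the mean of the truncation is minus the mean of the part cut off. There
    [H > t0], so [|V| <= H] is at most the square of the envelope divided by [t0]. *)
Lemma mean_trunc_small V t0 : 0 < t0 -> induced_observable V ->
  `|mean mu (V \_ (trunc_set t0))| <= mean mu (fun y => envelope y `^ 2) / t0.
Proof.
move=> t00 [VH Vreg V0].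
have mV := measurable_regular Vreg.
have i1 : mu.-integrable setT (EFin \o envelope).
  have h12 : (1 : R) <= 2 by lra.
  have := integrable_envelope ler01 h12 int2; congr (_.-integrable _ _).
  apply/funext => y /=; rewrite powRr1 //; apply: le_trans (envelope1 y) => //.
have iY : mu.-integrable Y (EFin \o V).
  apply: (le_integrable mY _ _ (integrableS measurableT mY (@subsetT _ _) i1)).
    exact/measurable_EFinP.
  move=> y Yy /=; rewrite lee_fin (le_trans (VH y Yy)) // (le_trans (envelope_ge_H Yy)) //.
  exact: ler_norm.
pose Q := trunc_set t0; have mQ : measurable Q by exact: measurable_trunc_set.
have QY : Q `<=` Y by move=> y [].
have mN : measurable (Y `\` Q) by exact: measurableD.
have NY : Y `\` Q `<=` Y by move=> y [].
have split_int : \int[mu]_(y in Q) V y + \int[mu]_(y in Y `\` Q) V y = 0.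
  have YE : Y = Q `|` (Y `\` Q) by rewrite setDUK.
  rewrite -Rintegral_setU //.
  - by rewrite -YE.
  - by rewrite -YE.
  - by rewrite disj_set2E; apply/eqP/seteqP; split => // y [Qy [_ nQ]].
have -> : mean mu (V \_ Q) = - \int[mu]_(y in Y `\` Q) V y.
  rewrite /mean -Rintegral_mkcond; lra.
rewrite normrN.
have iN := integrable_restr mN mY NY iY.
apply: le_trans (le_normr_Rintegral mN iN) _.
have i2 : mu.-integrable setT (EFin \o (fun y => t0^-1 * envelope y `^ 2)).
  exact: (integrableZl measurableT t0^-1 int2).
apply: (@le_trans _ _ (\int[mu]_(y in Y `\` Q) (t0^-1 * envelope y `^ 2))).
  apply: le_Rintegral => //.
  - exact: (integrable_abse iN).
  - exact: (integrable_restr mN measurableT (@subsetT _ _) i2).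
  - move=> y [Yy nQ]; have Ht : t0 < H y.
      rewrite ltNge; apply/negP => h; apply: nQ; split => //.
      by apply: le_trans (HsH Yy) h.
    have e1 := envelope_ge_H Yy.
    have e0 : 0 <= envelope y by apply: le_trans (envelope1 y).
    apply: le_trans (VH y Yy) _; rewrite powR_mulrn // ler_pdivlMl //.
    by rewrite expr2; apply: ler_pM => //; [exact: ltW|apply: H_ge0|exact: le_trans (ltW Ht) e1].
rewrite -[leRHS]mulrC /mean -RintegralZl // Rintegral_mkcond.
apply: le_Rintegral => //.
  have := integrable_restr mN measurableT (@subsetT _ _) i2.
  by move/(integrable_mkcond _ mN); rewrite restrict_EFin.
move=> y _; rewrite patchE; case: ifPn => // _.
by rewrite mulr_ge0 ?powR_ge0 // invr_ge0 ltW.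
Qed.

(** Each correlation consists of the bias of the truncated mean, of order [1 / t0], and of a
    geometric mixing error. Over [N <= kappa * t0] steps the biases sum to at most [kappa * E2], so
    [c] and [D'] depend neither on [t0] nor on [V]. *)
Lemma truncated_weakly_dependent (a kappa : R) : 2 <= a -> 0 <= kappa ->
  mu.-integrable setT (EFin \o (fun y => envelope y `^ a)) ->
  exists c D' : R, [/\ 0 <= c, 0 <= D' &
  forall V, induced_observable V -> forall (t0 : R) N, 0 < t0 -> N%:R <= kappa * t0 ->
    weakly_dependent mu Ft a c D' N (truncU t0) (V \_ (trunc_set t0))].
Proof.
move=> a2 kap0 inta; have d := D1.
have a0 : 0 <= a by lra.
(* One regularity constant for all densities used below: [a * D] for the power of [U], [3 * D] for
   the shifted observable, [D] for [2 * H]. *)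
have R10 : 0 <= a * D + 3 * D by rewrite addr_ge0 // mulr_ge0 //; lra.
have [K [s [K0 /andP[s0 s1] mix]]] :=
  mixing_mean mY FY part mF gam0 gam1 C00 muY invmu dmu R10.
pose Ea := mean mu (fun y => envelope y `^ a).
pose E2 := mean mu (fun y => envelope y `^ 2).
pose E1 := mean mu envelope.
have Ea0 : 0 <= Ea by apply: mean_ge0 => y; exact: powR_ge0.
have E20 : 0 <= E2 by apply: mean_ge0 => y; exact: powR_ge0.
have i1 : mu.-integrable setT (EFin \o envelope).
  have h12 : (1 : R) <= 2 by lra.
  have := integrable_envelope ler01 h12 int2; congr (_.-integrable _ _).
  apply/funext => y /=; rewrite powRr1 //; exact: le_trans (envelope1 y).
have E10 : 0 <= E1 by apply: mean_ge0 => y; exact: le_trans (envelope1 y).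
have weaken (r : R) (w : seq nat) (y y' : M) (f : M -> R) : r <= a * D + 3 * D -> 0 <= f y' ->
    f y <= expR (r * gam ^+ size w) * f y' ->
    f y <= expR ((a * D + 3 * D) * gam ^+ size w) * f y' :> R.
  move=> ra fy h; apply: (le_trans h); rewrite ler_wpM2r // ler_expR ler_wpM2r //.
  by rewrite exprn_ge0 // ltW.
exists ((1 + K) * Ea), (kappa * E2 + 5 * K * E1 / (1 - s)); split.
- by rewrite mulr_ge0 // addr_ge0.
- by rewrite addr_ge0 ?mulr_ge0 // ?invr_ge0; lra.
move=> V ioV t0 N t00 Nt0; have [VH Vreg V0] := ioV.
pose Q := trunc_set t0.
have mV := measurable_regular Vreg.
have mH := measurable_regular Hreg.
have H0 := H_ge0.
have bV : bddm (V \_ Q) by exact: bddm_trunc.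
have bH : bddm (H \_ Q).
  by apply: bddm_trunc => // y Yy; rewrite ger0_norm // H0.
have bU := bddm_truncU t00; have U1 := truncU1 t00.
have U0 y : 0 <= truncU t0 y by apply: le_trans (U1 y).
have HQ0 y : 0 <= (H \_ Q) y.
  by rewrite patchE; case: ifPn => // /set_mem[Yy _]; exact: H0.
have VQH y : `|(V \_ Q) y| <= (H \_ Q) y.
  by rewrite !patchE; case: ifPn => [/set_mem[Yy _]|_]; [exact: VH|rewrite normr0].
have HQE : mean mu (H \_ Q) <= E1.
  apply: le_mean_int => // y; rewrite patchE; case: ifPn => [/set_mem[Yy _]|_].
    exact: envelope_ge_H.
  exact: le_trans (envelope1 y).
split => //.
- move=> y; rewrite patchE; case: ifPn => [/set_mem Qy|_]; last by rewrite normr0.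
  by apply: le_trans (VH y Qy.1) _; exact: truncU_ge_trunc.
- move=> g bg g0.
  have bUa : bddm (fun x => truncU t0 x `^ a) by exact: bddm_powR.
  have := mix (fun x => truncU t0 x `^ a) bUa (fun x => powR_ge0 _ _) _ 0%N g bg g0.
  rewrite expr0 mulr1 => h.
  have /ler_normlP[_ h'] : `|mean mu (fun x => truncU t0 x `^ a * g (Ft x)) -
      mean mu (fun x => truncU t0 x `^ a) * mean mu g| <=
      K * (mean mu (fun x => truncU t0 x `^ a) * mean mu g).
    apply: h => w y y' w0 wy wy'. apply: (weaken (a * D) _ _ _ (fun x => truncU t0 x `^ a)).
    + by rewrite lerDl mulr_ge0 //; lra.
    + exact: powR_ge0.
    + exact: cyl_ratio_truncU_powR.
  have mg : 0 <= mean mu g by exact: mean_ge0.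
  have UE : mean mu (fun x => truncU t0 x `^ a) <= Ea.
    apply: le_mean_int => // x; apply: ler_powR2l => //.
    exact: truncU_le_envelope.
  have h2 : (1 + K) * (mean mu (fun x => truncU t0 x `^ a) * mean mu g) <=
      (1 + K) * (Ea * mean mu g).
    by apply: ler_wpM2l; [exact: addr_ge0|exact: ler_wpM2r].
  lra.
(* The factor 5 arises from applying mixing to [V + 2 * H] and to [2 * H] and subtracting: the two
   means add up to at most [E1 + 4 * E1]. *)
- pose cc k := E2 / t0 + 5 * K * E1 * s ^+ k.-1.
  have cc0 k : 0 <= cc k.
    by rewrite addr_ge0 ?divr_ge0 ?(ltW t00) // !mulr_ge0 // exprn_ge0.
  exists cc; split => //; split.
  + move=> k g /andP[k0 _] bg.
    case: k k0 => // n _.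
    have bf : bddm (fun x => (V \_ Q) x + 2 * (H \_ Q) x).
      by apply: bddmD => //; exact: bddmZ.
    have f0 x : 0 <= (V \_ Q) x + 2 * (H \_ Q) x.
      by have := VQH x; rewrite ler_norml => /andP[h _]; have := HQ0 x; lra.
    have f'0 x : 0 <= 2 * (H \_ Q) x by rewrite mulr_ge0.
    have bf' : bddm (fun x => 2 * (H \_ Q) x) by exact: bddmZ.
    have m1 := mean_trunc_small t00 ioV; rewrite -/Q -/E2 in m1.
    have pos g' : bddm g' -> (forall x, 0 <= g' x) ->
        `|mean mu (fun x => (V \_ Q) x * g' (iter n.+1 Ft x))| <= cc n.+1 * mean mu g'.
      move=> bg' g'0; have mg : 0 <= mean mu g' by exact: mean_ge0.
      have h1 := mix _ bf f0 _ n g' bg' g'0.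
      have h2 := mix _ bf' f'0 _ n g' bg' g'0.
      have hV (w : seq nat) (y y' : M) : (0 < size w)%N -> wcyl Y F I Yj w y ->
          wcyl Y F I Yj w y' -> (V \_ Q) y + 2 * (H \_ Q) y <=
          expR ((a * D + 3 * D) * gam ^+ size w) * ((V \_ Q) y' + 2 * (H \_ Q) y').
        move=> w0 wy wy'; apply: (weaken (3 * D) _ _ _ (fun x => (V \_ Q) x + 2 * (H \_ Q) x)) => //.
          by rewrite lerDr mulr_ge0 //; lra.
        exact: cyl_ratio_shifted.
      have {}h1 := h1 hV.
      have hH (w : seq nat) (y y' : M) : (0 < size w)%N -> wcyl Y F I Yj w y -> wcyl Y F I Yj w y' ->
          2 * (H \_ Q) y <= expR ((a * D + 3 * D) * gam ^+ size w) * (2 * (H \_ Q) y').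
        move=> w0 wy wy'; apply: (weaken D _ _ _ (fun x => 2 * (H \_ Q) x)) => //.
          by rewrite ler_wpDl ?mulr_ge0 // ?ler_peMl // ?ler1n // (le_trans ler01).
        have yy' : cylE (size w) y y' by exists w.
        have y'y : cylE (size w) y' y by exists w.
        rewrite mulrCA ler_pM2l // !patchE.
        have [/set_mem Qy|nQy] := boolP (y \in Q).
          rewrite (mem_set (trunc_set_cyl w0 yy' Qy)).
          exact: cyl_ratio_H w0 yy'.
        by case: ifPn => [/set_mem[Yy' _]|_]; rewrite mulr_ge0 ?expR_ge0 // H0.
      have {}h2 := h2 hH.
      have bg'n : bddm (fun x => g' (iter n.+1 Ft x)).
        exact: (bddm_iter (measurable_extend_id mY mF)).
      have b1 : bddm (fun x => ((V \_ Q) x + 2 * (H \_ Q) x) * g' (iter n.+1 Ft x)).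
        exact: bddmM.
      have b2 : bddm (fun x => (2 * (H \_ Q) x) * g' (iter n.+1 Ft x)) by exact: bddmM.
      have E : mean mu (fun x => (V \_ Q) x * g' (iter n.+1 Ft x)) =
        mean mu (fun x => ((V \_ Q) x + 2 * (H \_ Q) x) * g' (iter n.+1 Ft x)) -
        mean mu (fun x => (2 * (H \_ Q) x) * g' (iter n.+1 Ft x)).
        by rewrite -meanB //; congr mean; apply/funext => x; ring.
      rewrite E; move: h1 h2; rewrite meanD // !meanZ // => /ler_normlP[h1 h1'] /ler_normlP[h2 h2'].
      have vh : mean mu (V \_ Q) <= mean mu (H \_ Q).
        by apply: le_mean => // x; apply: le_trans (VQH x); exact: ler_norm.
      move: m1; rewrite ler_norml => /andP[m1 m1'].
      have kb : K * s ^+ n * ((mean mu (V \_ Q) + 2 * mean mu (H \_ Q)) * mean mu g') +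
         K * s ^+ n * (2 * mean mu (H \_ Q) * mean mu g') <= 5 * K * E1 * s ^+ n * mean mu g'.
        have -> : K * s ^+ n * ((mean mu (V \_ Q) + 2 * mean mu (H \_ Q)) * mean mu g') +
         K * s ^+ n * (2 * mean mu (H \_ Q) * mean mu g') =
         (K * s ^+ n * mean mu g') * (mean mu (V \_ Q) + 4 * mean mu (H \_ Q)) by ring.
        have -> : 5 * K * E1 * s ^+ n * mean mu g' = (K * s ^+ n * mean mu g') * (5 * E1) by ring.
        rewrite ler_wpM2l ?mulr_ge0 ?exprn_ge0 //; lra.
      have mm1 : mean mu (V \_ Q) * mean mu g' <= E2 / t0 * mean mu g' by rewrite ler_wpM2r.
      have mm2 : - (E2 / t0) * mean mu g' <= mean mu (V \_ Q) * mean mu g' by rewrite ler_wpM2r.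
      by rewrite /cc /= mulrDl ler_norml; apply/andP; split; lra.
    (* Mixing is available for nonnegative test functions, so [g] is split into its positive and
       negative parts. *)
    pose gp x := Num.max (g x) 0; pose gm x := Num.max (- g x) 0.
    have bgp : bddm gp by apply: bddm_max => //; exact: bddm_cst.
    have bgm : bddm gm by apply: bddm_max; [exact: bddmN|exact: bddm_cst].
    have gp0 x : 0 <= gp x by rewrite /gp le_max lexx orbT.
    have gm0 x : 0 <= gm x by rewrite /gm le_max lexx orbT.
    have gE x : g x = gp x - gm x by have [] := pos_neg_parts (g x).
    have gN x : `|g x| = gp x + gm x by have [] := pos_neg_parts (g x).
    have mit := measurable_extend_id mY mF.
    have bp : bddm (fun x => (V \_ Q) x * gp (iter n.+1 Ft x)).
      by apply: bddmM => //; exact: (bddm_iter mit).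
    have bm : bddm (fun x => (V \_ Q) x * gm (iter n.+1 Ft x)).
      by apply: bddmM => //; exact: (bddm_iter mit).
    have -> : (fun x => (V \_ Q) x * g (iter n.+1 Ft x)) =
       (fun x => (V \_ Q) x * gp (iter n.+1 Ft x) - (V \_ Q) x * gm (iter n.+1 Ft x)).
      by apply/funext => x; rewrite gE mulrBr.
    rewrite meanB //; apply: le_trans (ler_normB _ _) _.
    have -> : mean mu (fun x => `|g x|) = mean mu gp + mean mu gm.
      by rewrite -meanD //; congr mean; apply/funext => x; exact: gN.
    by rewrite mulrDr lerD //; exact: pos.
  + have -> : \sum_(1 <= k < N.+1) cc k = \sum_(k < N) (E2 / t0 + 5 * K * E1 * s ^+ k).
      by rewrite big_add1 /= big_mkord.
    rewrite big_split /= sumr_const card_ord -mulr_sumr lerD //.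
      rewrite -[leLHS]mulr_natl mulrCA [leRHS]mulrC ler_wpM2l //.
      by rewrite ler_pdivrMr.
    rewrite ler_wpM2l ?mulr_ge0 //.
    have gs : (1 - s) * \sum_(i < N) s ^+ i = 1 - s ^+ N.
      by have := subrX1 s N; lra.
    rewrite -[leRHS]mul1r ler_pdivlMr ?subr_gt0 // mulrC gs gerBl exprn_ge0 //.
Qed.

End Truncation.

(** * Time integrals along the flow *)

Section TimeIntegral.
Context {R : realType}.
Notation leb := (@lebesgue_measure R).
Implicit Types (phi psi : R -> R) (a K s t : R).

Lemma holder_continuous phi K a : 0 < a ->
  (forall s s', `|phi s - phi s'| <= K * `|s - s'| `^ a) -> continuous phi.
Proof.
move=> a0 hphi s; apply/cvgrPdist_lt => e e0.
have K0 : 0 < `|K| + 1 by rewrite ltr_wpDl.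
pose del := (e / (`|K| + 1)) `^ a^-1.
have del0 : 0 < del by rewrite powR_gt0 // divr_gt0.
near=> s'; apply: le_lt_trans (hphi s s') _.
have hs : `|s - s'| < del by near: s'; exact: (@cvgr_dist_lt _ R^o).
apply: (@le_lt_trans _ _ ((`|K|) * `|s - s'| `^ a)).
  by rewrite ler_wpM2r ?powR_ge0 // ler_norm.
have h : `|s - s'| `^ a <= e / (`|K| + 1).
  apply: (@le_trans _ _ (del `^ a)); first by apply: ler_powR2l => //; exact: ltW.
  by rewrite /del -powRrM mulVf ?gt_eqF // powRr1 // ltW // divr_gt0.
apply: le_lt_trans (ler_wpM2l (normr_ge0 K) h) _.
rewrite mulrA ltr_pdivrMr // mulrDr mulr1 [e * _]mulrC; lra.
Unshelve. all: by end_near. Qed.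

Definition prim phi t : R := \int[leb]_(s in `[0, t]) phi s.

Lemma continuous_intergable_itv phi a t : continuous phi ->
  leb.-integrable `[a, t] (EFin \o phi).
Proof.
move=> cphi; apply: continuous_compact_integrable; first exact: segment_compact.
exact: continuous_subspaceT.
Qed.

Lemma eq_prim phi psi t : (forall s, 0 <= s -> s <= t -> phi s = psi s) ->
  prim phi t = prim psi t.
Proof.
move=> E; apply: eq_Rintegral => s /set_mem /=; rewrite in_itv /= => /andP[s0 st].
exact: E.
Qed.

Lemma Rintegral_shift phi a b t : continuous phi -> a <= b ->
  \int[leb]_(s in `[a + t, b + t]) phi s = \int[leb]_(s in `[a, b]) phi (s + t).
Proof.
move=> cphi ab; rewrite /Rintegral; congr fine.
have D1 (x : R) : is_derive x 1 (fun s : R => s + t) (1 : R).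
  by apply: is_derive_eq; rewrite addr0.
have dE : derive1 (fun s : R => s + t) = cst (1 : R).
  by apply/funext => x; rewrite derive1E derive_val.
rewrite (@integration_by_substitution_increasing _ (fun s => s + t)) //.
- by apply: eq_integral => s _; rewrite dE /= mulr1.
- by move=> x y _ _ xy; rewrite ltrD2r.
- by rewrite dE => x _; exact: cst_continuous.
- by rewrite dE; exact: is_cvg_cst.
- by rewrite dE; exact: is_cvg_cst.
- have cs : continuous (fun s : R => s + t).
    by move=> x; apply: cvgD; [exact: cvg_id|exact: cvg_cst].
  split; first by move=> x _; exact: ex_derive.
  + by apply: cvg_at_right_filter; exact: cs.
  + by apply: cvg_at_left_filter; exact: cs.
- exact: continuous_subspaceT.
Qed.

Lemma primD phi s t : continuous phi -> 0 <= s -> 0 <= t ->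
  prim phi (s + t) = prim phi s + prim (fun r => phi (s + r)) t.
Proof.
move=> cphi s0 t0; rewrite /prim.
have -> : \int[leb]_(r in `[0, t]) phi (s + r) = \int[leb]_(r in `[0 + s, t + s]) phi r.
  by rewrite Rintegral_shift //; apply: eq_Rintegral => r _; rewrite addrC.
rewrite add0r [t + s]addrC.
have i1 := continuous_intergable_itv 0 (s + t) cphi.
have sst : s <= s + t by rewrite lerDl.
have := @Rintegral_itvB R phi (BLeft 0) (BRight (s + t)) s i1.
rewrite !bnd_simp s0 sst => /(_ isT isT) h.
rewrite -[LHS](subrK (\int[leb]_(r in `[0, s]) phi r)) h [LHS]addrC.
rewrite Rintegral_itv_obnd_cbnd //; apply: (integrableS _ _ _ i1) => //.
by move=> r /=; rewrite !in_itv /= => /andP[sr ->]; rewrite (le_trans s0 (ltW sr)).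
Qed.

Lemma lebesgue_itv0 t : 0 <= t -> fine (leb `[0, t]) = t.
Proof.
move=> t0; have := lebesgue_measure_itv `[(0 : R), t] => /= ->.
rewrite lte_fin; case: ltP => /= [_|t1]; first by rewrite oppr0 addr0.
by apply: le_anti; rewrite t0 t1.
Qed.

Lemma prim_le phi K t : continuous phi -> 0 <= t ->
  (forall s, 0 <= s -> s <= t -> `|phi s| <= K) -> `|prim phi t| <= K * t.
Proof.
move=> cphi t0 phiK; have i1 := continuous_intergable_itv 0 t cphi.
apply: le_trans (le_normr_Rintegral _ i1) _ => //.
have -> : K * t = \int[leb]_(s in `[0, t]) K.
  by rewrite Rintegral_cst // lebesgue_itv0.
apply: le_Rintegral => //.
- exact: (integrable_abse i1).
- exact: (continuous_intergable_itv 0 t (@cst_continuous _ _ K)).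
- by move=> s /=; rewrite in_itv /= => /andP[s0 st]; exact: phiK.
Qed.

Lemma prim_add phi psi t : continuous phi -> continuous psi ->
  prim (fun s => phi s + psi s) t = prim phi t + prim psi t.
Proof.
by move=> cphi cpsi; apply: RintegralD => //; exact: continuous_intergable_itv.
Qed.

Lemma primZ phi K t : continuous phi -> prim (fun s => K * phi s) t = K * prim phi t.
Proof. by move=> cphi; apply: RintegralZl => //; exact: continuous_intergable_itv. Qed.

Lemma prim_lipschitz phi K s t : continuous phi -> (forall s, `|phi s| <= K) ->
  0 <= s -> 0 <= t -> `|prim phi s - prim phi t| <= K * `|s - t|.
Proof.
move=> cphi phiK s0 t0.
wlog st : s t s0 t0 / s <= t.
  move=> h; have [st|/ltW ts] := leP s t; first exact: h.
  by rewrite distrC (distrC s t); exact: h.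
have -> : t = s + (t - s) by rewrite addrC subrK.
have ts0 : 0 <= t - s by rewrite subr_ge0.
rewrite primD // opprD addrA subrr add0r normrN.
have -> : s - (s + (t - s)) = - (t - s) by ring.
rewrite normrN (ger0_norm ts0); apply: prim_le => //.
move=> r; apply: continuous_comp; last exact: cphi.
by apply: cvgD; [exact: cvg_cst|exact: cvg_id].
Qed.

End TimeIntegral.

Lemma mul_le_sqrs {R : realType} (x y : R) : x * y <= x ^+ 2 + y ^+ 2.
Proof. have := sqr_ge0 (x - y); have := sqr_ge0 (x + y); rewrite sqrrB sqrrD; lra. Qed.

Lemma sqrD_le {R : realType} (x y : R) : (x + y) ^+ 2 <= 2 * x ^+ 2 + 2 * y ^+ 2.
Proof. have := sqr_ge0 (x - y); rewrite sqrrB sqrrD; lra. Qed.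

Section Flow.
Context {R : realType} {M : Type}.
Variables (dist : M -> M -> R) (T : R -> M -> M) (eta K : R).
Hypothesis dist0 : forall x y, 0 <= dist x y.
Hypothesis TD : forall s t x, 0 <= s -> 0 <= t -> T (s + t) x = T s (T t x).
Hypothesis eta0 : 0 < eta.
Hypothesis Tholder : forall (t t' : R) (x : M), 0 <= t -> 0 <= t' ->
  dist (T t x) (T t' x) <= K * `|t - t'| `^ eta.

Record unit_holder (v : M -> R) : Prop := UnitHolder {
  uh_le : forall x, `|v x| <= 1;
  uh_holder : forall x x', `|v x - v x'| <= dist x x' `^ eta }.

(** Nothing is known about [T] at negative times; freezing the path at time 0 makes it continuous on
    the whole line. *)
Definition orbit_path (v : M -> R) x s := v (T (Num.max s 0) x).

Definition Aint (v : M -> R) t x := prim (orbit_path v x) t.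

Definition Apath (v : M -> R) x s := Aint v (Num.max s 0) x.

Definition Bint (v w : M -> R) t x := prim (fun s => Apath v x s * orbit_path w x s) t.

Lemma max0_lip (s s' : R) : `|Num.max s 0 - Num.max s' 0| <= `|s - s'|.
Proof.
have [h|h] := leP s 0; have [h'|h'] := leP s' 0; rewrite ?subr0 ?sub0r ?subrr ?normr0 //.
- by rewrite normrN (ger0_norm (ltW h')) ler_normr; apply/orP; right; lra.
- by rewrite (ger0_norm (ltW h)) ler_normr; apply/orP; left; lra.
Qed.

Lemma max0_ge0 (s : R) : 0 <= Num.max s 0.
Proof. by rewrite le_max lexx orbT. Qed.

Lemma max0_id (s : R) : 0 <= s -> Num.max s 0 = s.
Proof. by move=> s0; apply/max_idPl. Qed.

Section Observable.
Variable v : M -> R.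
Hypothesis hv : unit_holder v.

Lemma orbit_path_le x s : `|orbit_path v x s| <= 1.
Proof. exact: (uh_le hv). Qed.

Lemma orbit_path_continuous x : continuous (orbit_path v x).
Proof.
have e0 := eta0.
(* Composing the flow with [v], both of exponent [eta], gives the exponent [eta * eta]; [|K|] spares
   a discussion of the sign of [K]. *)
apply: (@holder_continuous _ _ (`|K| `^ eta) (eta * eta)); first exact: mulr_gt0.
move=> s s'; apply: le_trans (uh_holder hv _ _) _.
rewrite powRrM -powRM ?powR_ge0 //; apply: ler_powR2l => //; first exact: ltW.
apply: le_trans (Tholder _ (max0_ge0 s) (max0_ge0 s')) _.
apply: (@le_trans _ _ (`|K| * `|Num.max s 0 - Num.max s' 0| `^ eta)).
  by rewrite ler_wpM2r ?powR_ge0 ?ler_norm.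
by rewrite ler_wpM2l // ler_powR2l ?max0_lip // ltW.
Qed.

Lemma orbit_path_shift x s t : 0 <= s -> 0 <= t ->
  orbit_path v x (s + t) = orbit_path v (T s x) t.
Proof.
by move=> s0 t0; rewrite /orbit_path !max0_id ?addr_ge0 // addrC TD.
Qed.

Lemma AintD s t x : 0 <= s -> 0 <= t -> Aint v (s + t) x = Aint v s x + Aint v t (T s x).
Proof.
move=> s0 t0; rewrite /Aint primD //; last exact: orbit_path_continuous.
by congr (_ + _); apply: eq_prim => r r0 _; rewrite orbit_path_shift.
Qed.

Lemma Aint_le t x : 0 <= t -> `|Aint v t x| <= t.
Proof.
move=> t0; rewrite -[leRHS]mul1r; apply: prim_le => //; first exact: orbit_path_continuous.
by move=> s _ _; exact: orbit_path_le.
Qed.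

Lemma Aint0 x : Aint v 0 x = 0.
Proof. by apply/normr0_eq0/le_anti; rewrite normr_ge0 andbT Aint_le. Qed.

Lemma Apath_continuous x : continuous (Apath v x).
Proof.
apply: (@holder_continuous _ _ 1 1) => // s s'.
have := prim_lipschitz (@orbit_path_continuous x) (orbit_path_le x)
  (max0_ge0 s) (max0_ge0 s').
by move=> /le_trans; apply; rewrite !mul1r powRr1 // max0_lip.
Qed.

End Observable.

Section Pair.
Variables v w : M -> R.
Hypotheses (hv : unit_holder v) (hw : unit_holder w).

Lemma Bint_path_continuous x : continuous (fun s => Apath v x s * orbit_path w x s).
Proof.
by move=> s; apply: cvgM; [exact: Apath_continuous|exact: orbit_path_continuous].
Qed.

Lemma Bint_le t x : 0 <= t -> `|Bint v w t x| <= t * t.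
Proof.
move=> t0; apply: prim_le => //; first exact: Bint_path_continuous.
move=> s s0 st; rewrite normrM -[leRHS]mulr1; apply: ler_pM => //.
  by rewrite /Apath max0_id //; apply: le_trans st; exact: Aint_le.
exact: orbit_path_le.
Qed.

(** Chen's relation in continuous time: beyond time [s] the inner integral splits into its value at
    [s] and the integral along the shifted orbit. *)
Lemma BintD s t x : 0 <= s -> 0 <= t ->
  Bint v w (s + t) x = Bint v w s x + Bint v w t (T s x) + Aint v s x * Aint w t (T s x).
Proof.
move=> s0 t0; rewrite /Bint primD //; last exact: Bint_path_continuous.
rewrite -addrA; congr (_ + _).
rewrite (_ : _ * Aint w t (T s x) =
  prim (fun r => Aint v s x * orbit_path w (T s x) r) t); last first.
  by rewrite primZ //; exact: orbit_path_continuous.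
rewrite -prim_add; last first.
- by move=> r; apply: cvgM; [exact: cvg_cst|exact: orbit_path_continuous].
- exact: Bint_path_continuous.
apply: eq_prim => r r0 _; rewrite orbit_path_shift // /Apath !max0_id ?addr_ge0 //.
by rewrite AintD // mulrDl addrC.
Qed.

End Pair.

(* Decomposition of the trajectory of a point of the base into excursions, that
   is, into the time intervals between consecutive returns. *)
Section Excursion.
Variables (Y : set M) (F : M -> M) (H : M -> R) (h0 : R).
Hypothesis FY : forall y, Y y -> Y (F y).
Hypothesis FE : forall y, Y y -> F y = T (H y) y.
Hypothesis h00 : 0 < h0.
Hypothesis Hh0 : forall y, Y y -> h0 <= H y.

Lemma iterFY n y : Y y -> Y (iter n F y).
Proof. by move=> Yy; elim: n => //= n; exact: FY. Qed.

Lemma H_ge0' y : Y y -> 0 <= H y.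
Proof. by move=> Yy; apply: le_trans (Hh0 Yy); exact: ltW. Qed.

Lemma birkhoff_H_ge n y : Y y -> n%:R * h0 <= birkhoff F H n y.
Proof.
elim: n y => [|n IH] y Yy; first by rewrite mul0r birkhoff0.
rewrite birkhoffS -natr1 mulrDl mul1r addrC lerD ?Hh0 //; exact/IH/FY.
Qed.

Lemma birkhoff_H_ge0 n y : Y y -> 0 <= birkhoff F H n y.
Proof.
by move=> Yy; apply: le_trans (birkhoff_H_ge n Yy); rewrite mulr_ge0 // ltW.
Qed.

Lemma Aint_excursion v n r y : unit_holder v -> Y y -> 0 <= r ->
  Aint v (birkhoff F H n y + r) y =
  birkhoff F (fun z => Aint v (H z) z) n y + Aint v r (iter n F y).
Proof.
move=> hv + r0; elim: n y => [|n IH] y Yy; first by rewrite !birkhoff0 !add0r.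
rewrite !birkhoffS -!addrA AintD ?H_ge0' //.
  by rewrite -FE // IH ?iterSr //; exact: FY.
by rewrite addr_ge0 // birkhoff_H_ge0 //; exact: FY.
Qed.

Lemma birkhoff2S (f g : M -> R) n y :
  birkhoff2 F f g n.+1 y = birkhoff2 F f g n (F y) + f y * birkhoff F g n (F y).
Proof. by []. Qed.

Lemma Bint_excursion v w n r y : unit_holder v -> unit_holder w -> Y y -> 0 <= r ->
  Bint v w (birkhoff F H n y + r) y =
  birkhoff F (fun z => Bint v w (H z) z) n y
  + birkhoff2 F (fun z => Aint v (H z) z) (fun z => Aint w (H z) z) n y
  + birkhoff F (fun z => Aint v (H z) z) n y * Aint w r (iter n F y)
  + Bint v w r (iter n F y).
Proof.
move=> hv hw + r0; elim: n y => [|n IH] y Yy.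
  by rewrite !birkhoff0 /= mul0r !add0r.
rewrite birkhoff2S !birkhoffS -!addrA BintD ?H_ge0' //; last first.
  by rewrite addr_ge0 // birkhoff_H_ge0 //; exact: FY.
have YF := FY Yy; rewrite -FE // IH // (Aint_excursion n hw YF r0) -!iterSr; ring.
Qed.

Lemma birkhoffSr (f : M -> R) n y : birkhoff F f n.+1 y = birkhoff F f n y + f (iter n F y).
Proof. by rewrite -addn1 birkhoffD birkhoffS birkhoff0 addr0. Qed.

(** The roof is bounded below by [h0 > 0], so return times tend to infinity; [n] counts the returns
    completed by time [t] and [r] is the age of the current excursion. *)
Lemma excursion_index t y : Y y -> 0 <= t -> exists n r,
  [/\ 0 <= r, r < H (iter n F y) & t = birkhoff F H n y + r].
Proof.
move=> Yy t0.
have ex : exists n, t < birkhoff F H n y.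
  exists (Num.bound (t / h0)); apply: lt_le_trans (birkhoff_H_ge _ Yy).
  by rewrite -ltr_pdivrMr // archi_boundP // divr_ge0 // ltW.
case: (ex_minnP ex) => -[|n]; first by rewrite birkhoff0 ltNge t0.
move=> + hmin; rewrite birkhoffSr => tn.
have nt : birkhoff F H n y <= t.
  by rewrite leNgt; apply/negP => /hmin; rewrite ltnn.
by exists n, (t - birkhoff F H n y); split; [lra|lra|ring].
Qed.

Lemma birkhoff_ge_term (g : M -> R) n i y : Y y -> (forall z, Y z -> 0 <= g z) ->
  (i < n)%N -> g (iter i F y) <= birkhoff F g n y.
Proof.
move=> Yy g0 ilt; rewrite /birkhoff (bigD1 (Ordinal ilt)) //= lerDl.
by apply: sumr_ge0 => j _; apply: g0; exact: iterFY.
Qed.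

Lemma ler_birkhoff (g : M -> R) m n y : Y y -> (forall z, Y z -> 0 <= g z) ->
  (m <= n)%N -> birkhoff F g m y <= birkhoff F g n y.
Proof.
move=> Yy g0 /subnK <-; rewrite addnC birkhoffD lerDl.
by apply: sumr_ge0 => j _; apply: g0; do 2 apply: iterFY.
Qed.

Variables (v w : M -> R).
Hypotheses (hv : unit_holder v) (hw : unit_holder w).
Variables (U Vt Wt : M -> R) (t0 : R) (N : nat).
Hypothesis VtE : forall y, Y y -> H y <= t0 -> Vt y = Aint v (H y) y.
Hypothesis WtE : forall y, Y y -> H y <= t0 -> Wt y = Aint w (H y) y.
Hypothesis UH : forall y, Y y -> Num.min (H y) t0 <= U y.
Hypothesis t00 : 0 < t0.
Hypothesis Nt0 : t0 < N%:R * h0.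

Lemma eq_birkhoff (f g : M -> R) n y : (forall i, (i < n)%N -> f (iter i F y) = g (iter i F y)) ->
  birkhoff F f n y = birkhoff F g n y.
Proof. by move=> E; apply: eq_bigr => i _; exact: E. Qed.

Lemma eq_birkhoff2 (f f' g g' : M -> R) n y :
  (forall i, (i < n)%N -> f (iter i F y) = g (iter i F y)) ->
  (forall i, (i < n)%N -> f' (iter i F y) = g' (iter i F y)) ->
  birkhoff2 F f f' n y = birkhoff2 F g g' n y.
Proof.
elim: n y => //= n IH y E E'; rewrite (E 0%N) //; congr (_ + _ * _).
  by apply: IH => i lin; rewrite -iterSr; [exact: E|exact: E'].
by apply: eq_birkhoff => i lin; rewrite -iterSr; exact: E'.
Qed.

Lemma U_ge0 y : Y y -> 0 <= U y.
Proof. by move=> Yy; apply: le_trans (UH Yy); rewrite le_min H_ge0' // ltW. Qed.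

Lemma U_ge r y : Y y -> r <= H y -> r <= t0 -> r <= U y.
Proof. by move=> Yy rH rt; apply: le_trans (UH Yy); rewrite le_min rH. Qed.

(** Excursions completed before [t <= t0] have [H <= t0], so the truncated observables agree with
    the original ones on them. The unfinished one lasts at most [min(H, t0)], which is at most [U].
    Finally [n < N] because [N] excursions take longer than [t0]. *)
Lemma excursion_le t y : Y y -> 0 <= t -> t <= t0 -> exists n,
  [/\ (n < N)%N,
      `|Aint v t y| <= `|birkhoff F Vt n y| + U (iter n F y),
      `|Aint w t y| <= `|birkhoff F Wt n y| + U (iter n F y) &
      `|Bint v w t y| <= `|birkhoff2 F Vt Wt n y| + birkhoff F (fun z => U z ^+ 2) n.+1 y
                         + `|birkhoff F Vt n y| * U (iter n F y)].
Proof.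
move=> Yy tge tle; have [n [r [r0 rH tE]]] := excursion_index Yy tge.
have Rt : birkhoff F H n y <= t0 by apply: le_trans tle; rewrite tE lerDl.
have Ht i : (i < n)%N -> H (iter i F y) <= t0.
  by move=> lin; apply: le_trans Rt; apply: birkhoff_ge_term => // z; exact: H_ge0'.
have rU : r <= U (iter n F y).
  apply: U_ge; [exact: iterFY|exact: ltW|].
  by apply: le_trans tle; rewrite tE lerDr birkhoff_H_ge0.
have Yi i : Y (iter i F y) by exact: iterFY.
have EV : birkhoff F (fun z => Aint v (H z) z) n y = birkhoff F Vt n y.
  by apply: eq_birkhoff => i lin; rewrite VtE // Ht.
have EW : birkhoff F (fun z => Aint w (H z) z) n y = birkhoff F Wt n y.
  by apply: eq_birkhoff => i lin; rewrite WtE // Ht.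
have EVW : birkhoff2 F (fun z => Aint v (H z) z) (fun z => Aint w (H z) z) n y =
    birkhoff2 F Vt Wt n y.
  by apply: eq_birkhoff2 => i lin; rewrite ?VtE ?WtE // Ht.
exists n; split.
- rewrite -(ltr_nat R) -(ltr_pM2r h00); apply: le_lt_trans Nt0.
  exact: le_trans (birkhoff_H_ge _ Yy) Rt.
- rewrite tE Aint_excursion // EV; apply: le_trans (ler_normD _ _) _.
  by rewrite lerD2l; apply: le_trans rU; exact: Aint_le.
- rewrite tE Aint_excursion // EW; apply: le_trans (ler_normD _ _) _.
  by rewrite lerD2l; apply: le_trans rU; exact: Aint_le.
rewrite tE Bint_excursion // EVW EV.
have b1 : `|birkhoff F (fun z => Bint v w (H z) z) n y| <=
    birkhoff F (fun z => U z ^+ 2) n y.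
  apply: le_trans (ler_norm_sum _ _ _) _; apply: ler_sum => i _.
  have HU := U_ge (Yi i) (lexx _) (Ht _ (ltn_ord i)).
  apply: le_trans (Bint_le hv hw _ (H_ge0' (Yi i))) _.
  by rewrite expr2 ler_pM // H_ge0'.
have b2 : `|Bint v w r (iter n F y)| <= U (iter n F y) ^+ 2.
  by apply: le_trans (Bint_le hv hw _ r0) _; rewrite expr2 ler_pM.
have b3 : `|birkhoff F Vt n y * Aint w r (iter n F y)| <=
    `|birkhoff F Vt n y| * U (iter n F y).
  rewrite normrM ler_wpM2l //; apply: le_trans rU; exact: Aint_le.
rewrite birkhoffSr.
apply: le_trans (ler_normD _ _) _; apply: le_trans (lerD (ler_normD _ _) b2) _.
apply: le_trans (lerD (lerD (ler_normD _ _) b3) (lexx _)) _.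
move: b1; move: (birkhoff F _ n y) (birkhoff F _ n y) => ? ? b1; lra.
Qed.

(** A point of the flow space is [T s y] with [y] in the base. The remainder of its excursion, as
    far as it is used, is covered by [U y]; what follows starts at [F y], so [y] itself enters
    through [U y] alone. *)
Lemma Aint_flow_le t s y : Y y -> 0 <= s -> s <= H y -> 0 <= t -> t <= t0 ->
  `|Aint v t (T s y)| <=
  U y + runmax (birkhoff F Vt) N (F y) + runmax (fun k z => U (iter k F z)) N (F y).
Proof.
move=> Yy s0 sH tge tle.
have Hs0 : 0 <= H y - s by rewrite subr_ge0.
have r1 := runmax_ge0 (birkhoff F Vt) N (F y).
have r2 := runmax_ge0 (fun k z => U (iter k F z)) N (F y).
have [tH|/ltW Ht] := leP t (H y - s).
  have := U_ge Yy (le_trans tH _) tle; rewrite gerBl => /(_ s0).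
  have := Aint_le hv (T s y) tge; lra.
have tE : t = (H y - s) + (t - (H y - s)) by lra.
have FyE : T (H y - s) (T s y) = F y by rewrite -TD // subrK FE.
rewrite tE AintD // ?subr_ge0 // FyE.
have [||n [nN h _ _]] := @excursion_le (t - (H y - s)) (F y) (FY Yy); [lra..|].
have h1 := Aint_le hv (T s y) Hs0.
have h2 : H y - s <= U y by apply: U_ge => //; lra.
have h3 := runmax_ge (birkhoff F Vt) (F y) (ltnW nN).
have h4 := runmax_ge (fun k z => U (iter k F z)) (F y) (ltnW nN).
rewrite ger0_norm ?U_ge0 // in h4; last by apply: iterFY; exact: FY.
apply: le_trans (ler_normD _ _) _; lra.
Qed.

(** As for [Aint_flow_le], with Chen's relation at the first return. Of the four sums of squares,
    one comes from the excursions themselves, two from the product across the first return and one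
    from the unfinished excursion. *)
Lemma Bint_flow_le t s y : Y y -> 0 <= s -> s <= H y -> 0 <= t -> t <= t0 ->
  `|Bint v w t (T s y)| <=
  2 * U y ^+ 2 + runmax (birkhoff2 F Vt Wt) N (F y)
  + 4 * birkhoff F (fun z => U z ^+ 2) N (F y)
  + runmax (birkhoff F Vt) N (F y) ^+ 2 + 2 * runmax (birkhoff F Wt) N (F y) ^+ 2.
Proof.
move=> Yy s0 sH tge tle.
have Hs0 : 0 <= H y - s by rewrite subr_ge0.
have YF := FY Yy.
have sq0 z : Y z -> 0 <= U z ^+ 2 by move=> _; exact: sqr_ge0.
have r1 := runmax_ge0 (birkhoff2 F Vt Wt) N (F y).
have r2 := sqr_ge0 (runmax (birkhoff F Vt) N (F y)).
have r3 := sqr_ge0 (runmax (birkhoff F Wt) N (F y)).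
have r4 : 0 <= birkhoff F (fun z => U z ^+ 2) N (F y) by apply: sumr_ge0 => i _; exact: sqr_ge0.
have [tH|/ltW Ht] := leP t (H y - s).
  have tU : t <= U y by apply: U_ge => //; lra.
  have := Bint_le hv hw (T s y) tge; have : t * t <= U y ^+ 2 by rewrite expr2 ler_pM.
  have := sqr_ge0 (U y); lra.
have tE : t = (H y - s) + (t - (H y - s)) by lra.
have FyE : T (H y - s) (T s y) = F y by rewrite -TD // subrK FE.
rewrite tE BintD // ?subr_ge0 // FyE.
have [||n [nN _ hA hB]] := @excursion_le (t - (H y - s)) (F y) YF; [lra..|].
have h2 : H y - s <= U y by apply: U_ge => //; lra.
have h1 : `|Bint v w (H y - s) (T s y)| <= U y ^+ 2.
  by apply: le_trans (Bint_le hv hw _ Hs0) _; rewrite expr2 ler_pM.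
have h3 : `|Aint v (H y - s) (T s y)| <= U y by apply: le_trans h2; exact: Aint_le.
have m2 := runmax_ge (birkhoff2 F Vt Wt) (F y) (ltnW nN).
have mV := runmax_ge (birkhoff F Vt) (F y) (ltnW nN).
have mW := runmax_ge (birkhoff F Wt) (F y) (ltnW nN).
have Q1 : birkhoff F (fun z => U z ^+ 2) n.+1 (F y) <= birkhoff F (fun z => U z ^+ 2) N (F y).
  exact: ler_birkhoff.
have Q2 : U (iter n F (F y)) ^+ 2 <= birkhoff F (fun z => U z ^+ 2) N (F y).
  exact: (@birkhoff_ge_term (fun z => U z ^+ 2)).
have u0 : 0 <= U (iter n F (F y)) by apply/U_ge0/iterFY.
have u1 := U_ge0 Yy.
apply: le_trans (ler_normD _ _) _; apply: le_trans (lerD (ler_normD _ _) (lexx _)) _.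
rewrite normrM -[2 * U y ^+ 2]/(2 * (U y ^+ 2)).
have X := normr_ge0 (birkhoff F Vt n (F y)).
have X' := normr_ge0 (birkhoff F Wt n (F y)).
have AW := normr_ge0 (Aint w (t - (H y - s)) (F y)).
(* Products of first-order quantities are replaced by squares, so that only sums of nonnegative
   terms with known moments remain. *)
have p1 : `|Aint v (H y - s) (T s y)| * `|Aint w (t - (H y - s)) (F y)| <=
    U y ^+ 2 + (2 * runmax (birkhoff F Wt) N (F y) ^+ 2
    + 2 * birkhoff F (fun z => U z ^+ 2) N (F y)).
  apply: le_trans (ler_pM _ _ h3 (le_trans hA (lerD mW (lexx _)))) _ => //.
  apply: le_trans (mul_le_sqrs (U y) _) _; rewrite lerD2l.
  by apply: le_trans (sqrD_le _ _) _; rewrite lerD2l ler_wpM2l.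
have p2 : `|birkhoff F Vt n (F y)| * U (iter n F (F y)) <=
    runmax (birkhoff F Vt) N (F y) ^+ 2 + birkhoff F (fun z => U z ^+ 2) N (F y).
  apply: le_trans (mul_le_sqrs _ _) (lerD _ Q2).
  by rewrite -[leLHS]real_normK ?num_real // normr_id lerXn2r ?nnegrE // runmax_ge0.
lra.
Qed.

End Excursion.
End Flow.

(** * The induced system *)

Section InducedSystem.
Context {R : realType} {dM : measure_display} {M : measurableType dM}.
Variables (T : R -> M -> M) (X Y : set M) (h : M -> R) (tau : M -> nat).
Hypothesis hT : is_semiflow T.
Hypothesis mX : measurable X.
Hypothesis mY : measurable Y.
Hypothesis YX : Y `<=` X.
Hypothesis hpos : forall x, X x -> 0 < h x.
Hypothesis hmeas : measurable_fun X h.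
Hypothesis fX : forall x, X x -> X (flowf T h x).
Hypothesis taumeas : measurable_fun Y (fun y => (tau y)%:R : R).
Hypothesis FY : forall y, Y y -> Y (indF T h tau y).
Local Notation f := (flowf T h).
Local Notation F := (indF T h tau).
Local Notation H := (Hroof T h tau).

Definition flow_time k x : R := \sum_(l < k) h (iter l f x).

Lemma iter_flowf_in k x : X x -> X (iter k f x).
Proof. by move=> Xx; elim: k => //= k; exact: fX. Qed.

Lemma flow_time_ge0 k x : X x -> 0 <= flow_time k x.
Proof. by move=> Xx; apply: sumr_ge0 => l _; apply/ltW/hpos/iter_flowf_in. Qed.

Lemma iter_flowf_time k x : X x -> iter k f x = T (flow_time k x) x.
Proof.
have [T0 TD _] := hT.
move=> Xx; elim: k => [|k IH]; first by rewrite /flow_time big_ord0 T0.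
rewrite /flow_time big_ord_recr /= addrC TD; last 2 first.
- exact/ltW/hpos/iter_flowf_in.
- exact: flow_time_ge0.
by rewrite -[flowf _ _ _]/(T (h (iter k f x)) (iter k f x)) {2}IH.
Qed.

Lemma indF_time y : Y y -> F y = T (H y) y.
Proof. by move=> /YX; exact: iter_flowf_time. Qed.

Lemma Hroof_ge0 y : Y y -> 0 <= H y.
Proof. by move=> /YX; exact: flow_time_ge0. Qed.

Lemma flow_in_excursion l u y : Y y -> (l < tau y)%N -> 0 <= u -> u <= h (iter l f y) ->
  exists s, [/\ 0 <= s, s <= H y & T u (iter l f y) = T s y].
Proof.
have [_ TD _] := hT.
move=> /YX Xy lt u0 uh; exists (u + flow_time l y).
have l0 := flow_time_ge0 l Xy; split; [lra| |by rewrite TD // -iter_flowf_time].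
have : flow_time l.+1 y <= H y.
  rewrite /Hroof /flow_time; move: lt => /subnK <-; rewrite addnC.
  rewrite big_split_ord /= lerDl; apply: sumr_ge0 => i _.
  by apply/ltW/hpos/fX; exact: iter_flowf_in.
by rewrite /flow_time big_ord_recr /= -/(flow_time l y); lra.
Qed.

(** [h] is measurable on [X] and [T] on nonnegative times; extending [h] by 0 keeps the pair of time
    and point inside the domain of [T]. *)
Lemma measurable_flowf : measurable_fun X f.
Proof.
have [_ _ mT] := hT.
have mh : measurable_fun setT (h \_ X) by apply/(measurable_restrictT _ mX).
have mp : measurable_fun setT (fun x => ((h \_ X) x, x)).
  by apply: measurable_fun_pair => //; exact: measurable_id.
apply: (@eq_measurable_fun _ _ _ _ X (fun x => T ((h \_ X) x) x)).
  by move=> x Xx; rewrite patchT.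
apply: (@measurable_comp _ _ _ _ _ _ [set p : R * M | 0 <= p.1]
  (fun p => T p.1 p.2) X (fun x => ((h \_ X) x, x))) => //.
- rewrite (_ : [set _ | _] = setT `&` (fst @^-1` `[0, +oo[%classic)).
    by apply: (@measurable_fst _ _ R M) => //; exact: measurable_itv.
  by rewrite setTI; apply/seteqP; split => p /=; rewrite in_itv /= andbT.
- by move=> _ [x Xx <-] /=; rewrite patchT ?mem_set //; exact/ltW/hpos.
- exact: measurable_funTS.
Qed.

Lemma measurable_iter_flowf k : measurable_fun X (iter k f).
Proof.
elim: k => [|k IH]; first exact: measurable_id.
apply: (@measurable_comp _ _ _ _ _ _ X f X (iter k f)) => //.
- by move=> _ [x Xx <-]; exact: iter_flowf_in.
- exact: measurable_flowf.
Qed.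

Lemma measurable_indF A : measurable A -> measurable (Y `&` F @^-1` A).
Proof.
move=> mA.
have -> : Y `&` F @^-1` A = \bigcup_n ((Y `&` (fun y => (tau y)%:R : R) @^-1` [set n%:R])
    `&` (X `&` iter n f @^-1` A)).
  apply/seteqP; split => [y [Yy Ay]|y [n _ [[Yy /eqP] + [_ Ay]]]].
    by exists (tau y) => //; split; split => //; exact: YX.
  by rewrite eqr_nat => /eqP E; split => //=; rewrite /indF E.
by apply: bigcupT_measurable => n; apply: measurableI;
  [apply: taumeas => //; exact: measurable_set1|exact: measurable_iter_flowf].
Qed.

End InducedSystem.

(** * Regularity of the roof and of the induced observables *)

Section Regularity.
Context {R : realType} {dM : measure_display} {M : measurableType dM}.
Variables (dist : M -> M -> R) (T : R -> M -> M) (Y : set M) (F : M -> M) (H : M -> R).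
Variables (I : set nat) (Yj : nat -> set M) (eta K theta C gam : R).
Hypothesis dist0 : forall x y, 0 <= dist x y.
Hypothesis TD : forall s t x, 0 <= s -> 0 <= t -> T (s + t) x = T s (T t x).
Hypothesis eta0 : 0 < eta.
Hypothesis eta1 : eta <= 1.
Hypothesis Tholder : forall (t t' : R) (x : M), 0 <= t -> 0 <= t' ->
  dist (T t x) (T t' x) <= K * `|t - t'| `^ eta.
Hypothesis FY : forall y, Y y -> Y (F y).
Hypothesis part : is_partition Y I Yj.
Hypothesis theta0 : 0 < theta.
Hypothesis theta1 : theta < 1.
Hypothesis C1 : 1 <= C.
Hypothesis thetagam : theta `^ eta <= gam.
Hypothesis Hreg : forall j, I j -> forall y y', Yj j y -> Yj j y' -> y <> y' ->
  `|H y - H y'| <= C * inf [set H z | z in Yj j] * dtheta theta F I Yj y y'.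
Hypothesis Tsep : forall j, I j -> forall y y', Yj j y -> Yj j y' ->
  forall t : R, 0 <= t -> t <= H y -> t <= H y' ->
  dist (T t y) (T t y') <= C * dtheta theta F I Yj y y'.
Hypothesis Hge0 : forall y, Y y -> 0 <= H y.
Hypothesis Hinf : 0 < inf [set H y | y in Y].
Local Notation cylE := (cyl_eq Y F I Yj).

Lemma cyl_eq1 j y z : I j -> Yj j y -> cylE 1 y z <-> Yj j z.
Proof.
move=> Ij yj; split => [/cyl_eqS[[i [Ii yi zi]] _]|zj].
  have [_ dis _] := part; suff -> : j = i by [].
  apply: contrapT => ji.
  by have : (Yj j `&` Yj i) y by []; rewrite (dis j i Ij Ii ji).
exists [:: j]; rewrite /= /branch_preimage asboolT //.
by split => //; split => //; apply: FY; apply: (piece_sub part Ij).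
Qed.

Lemma in_piece y : Y y -> exists2 j, I j & Yj j y.
Proof. by have [_ _ YE] := part; rewrite {1}YE => -[j]; exists j. Qed.

Lemma dtheta_le k y y' : cylE k y y' -> dtheta theta F I Yj y y' <= theta ^+ k.
Proof.
move=> yy'; rewrite /dtheta /sep_time; case: pselect => [e|_]; last first.
  by rewrite exprn_ge0 // ltW.
case: ex_minnP => n /asboolP hn _; rewrite ler_wiXn2l //; [exact: ltW..|].
by rewrite leqNgt; apply/negP => nk; exact: hn (cyl_eq_same_piece yy' nk).
Qed.

(** The infimum over the partition element of [y], written with cylinders of length one to avoid
    naming the index of the element. *)
Definition roof_min y := inf [set H z | z in [set z | cylE 1 y z]].

Lemma roof_min_piece j y : I j -> Yj j y -> roof_min y = inf [set H z | z in Yj j].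
Proof.
move=> Ij yj; congr (inf (_ @` _)).
by apply/seteqP; split => z /=; rewrite (cyl_eq1 _ Ij yj).
Qed.

Lemma roof_min_cyl y y' : cylE 1 y y' -> roof_min y = roof_min y'.
Proof.
move=> yy'; have [Yy _] := cyl_eq_sub part yy'; have [j Ij yj] := in_piece Yy.
have := yy'; rewrite (cyl_eq1 _ Ij yj) => y'j.
by rewrite (roof_min_piece Ij yj) (roof_min_piece Ij y'j).
Qed.

Lemma Hinf_le y : Y y -> inf [set H y | y in Y] <= H y.
Proof.
move=> Yy; apply: ge_inf; last by exists y.
by exists 0 => _ [z Yz <-]; exact: Hge0.
Qed.

Lemma roof_min_le y : Y y -> roof_min y <= H y.
Proof.
move=> Yy; apply: ge_inf; last by exists y => //=; exact: (cyl_eq_refl FY part).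
by exists 0 => _ [z /(cyl_eq_sub part)[_ Yz] <-]; exact: Hge0.
Qed.

Lemma le_roof_min y c : Y y -> (forall z, cylE 1 y z -> c <= H z) -> c <= roof_min y.
Proof.
move=> Yy hc; apply: lb_le_inf; first by exists (H y), y => //=; exact: (cyl_eq_refl FY part).
by move=> _ [z yz <-]; exact: hc.
Qed.

Lemma roof_min_gt0 y : Y y -> 0 < roof_min y.
Proof.
move=> Yy; apply: (lt_le_trans Hinf); apply: le_roof_min => // z /(cyl_eq_sub part)[_ Yz].
exact: Hinf_le.
Qed.

Lemma roof_regular k y y' : (0 < k)%N -> cylE k y y' ->
  `|H y - H y'| <= C * theta ^+ k * roof_min y.
Proof.
move=> k0 yy'; have [Yy _] := cyl_eq_sub part yy'; have r0 := roof_min_gt0 Yy.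
have [->|/eqP nyy'] := eqVneq y y'.
  rewrite subrr normr0 !mulr_ge0 ?exprn_ge0 ?(ltW theta0) // ?(le_trans _ C1) //.
  by have [_ Yy'] := cyl_eq_sub part yy'; exact/ltW/roof_min_gt0.
have [j Ij yj] := in_piece Yy.
have y'j : Yj j y' by apply/(cyl_eq1 _ Ij yj); exact: (cyl_eq_le part k0 yy').
apply: le_trans (Hreg Ij yj y'j nyy') _.
rewrite -(roof_min_piece Ij yj) mulrAC ler_wpM2r ?(ltW r0) // ler_wpM2l ?(le_trans _ C1) //.
exact: dtheta_le.
Qed.

Lemma roof_le_min y : Y y -> H y <= (1 + C) * roof_min y.
Proof.
move=> Yy; suff : H y - C * roof_min y <= roof_min y by lra.
apply: le_roof_min => // z yz; have := roof_regular (leqnn 1) yz.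
have := roof_min_gt0 Yy; rewrite ler_norml expr1 => r0 /andP[_ hz].
have : C * theta * roof_min y <= C * roof_min y.
  rewrite ler_wpM2r ?(ltW r0) // ger_pMr ?(ltW theta1) //; exact: lt_le_trans C1.
lra.
Qed.

Lemma theta_gam k : theta ^+ k <= gam ^+ k.
Proof.
rewrite lerXn2r ?nnegrE ?(ltW theta0) //; first exact: le_trans (powR_ge0 _ _) thetagam.
apply: le_trans thetagam; rewrite -[leLHS]powRr1 ?(ltW theta0) //.
by rewrite ger_powR // theta0 ltW.
Qed.

(** Two orbits of the same cylinder are compared up to the shorter roof, which is at most
    [(1 + C) * roof_min] and along which [v] differs by at most [C * gam ^+ k]; the excess of the
    longer roof contributes the last [C]. *)
Definition reg_const := (1 + C) * C + C.

Lemma induced_regular v k y y' : unit_holder dist eta v -> (0 < k)%N -> cylE k y y' ->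
  `|Aint T v (H y) y - Aint T v (H y') y'| <= reg_const * gam ^+ k * roof_min y.
Proof.
move=> hv k0; wlog yy'H : y y' / H y <= H y'.
  move=> hw yy'; have [|/ltW] := leP (H y) (H y'); first by move=> ?; exact: hw.
  move=> ?; rewrite distrC (roof_min_cyl (cyl_eq_le part k0 yy')); apply: hw => //.
  exact: cyl_eq_sym.
move=> yy'; have [Yy Yy'] := cyl_eq_sub part yy'; have r0 := roof_min_gt0 Yy.
have [j Ij yj] := in_piece Yy.
have y'j : Yj j y' by apply/(cyl_eq1 _ Ij yj); exact: (cyl_eq_le part k0 yy').
have H0 := Hge0 Yy; have dH0 : 0 <= H y' - H y by rewrite subr_ge0.
have -> : Aint T v (H y') y' =
    Aint T v (H y) y' + Aint T v (H y' - H y) (T (H y) y').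
  by rewrite -(AintD dist0 TD eta0 Tholder hv) // addrC subrK.
have c x := orbit_path_continuous dist0 eta0 Tholder hv x.
have C0 : 0 <= C by exact: le_trans C1.
have t0 : 0 <= theta ^+ k by rewrite exprn_ge0 // ltW.
have g0 : 0 <= gam ^+ k by exact: le_trans (theta_gam k).
have h1 : `|Aint T v (H y) y - Aint T v (H y) y'| <= C * gam ^+ k * H y.
  have cN : continuous (fun s => -1 * orbit_path T v y' s).
    by move=> s; apply: cvgM; [exact: cvg_cst|exact: c].
  have -> : Aint T v (H y) y - Aint T v (H y) y' =
      prim (fun s => orbit_path T v y s + -1 * orbit_path T v y' s) (H y).
    by rewrite (prim_add _ (c y) cN) primZ ?mulN1r //; exact: c.
  apply: prim_le => //.
    by move=> s; apply: cvgD; [exact: c|exact: cN].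
  move=> s s0 sH; rewrite mulN1r /orbit_path max0_id //.
  apply: le_trans (uh_holder hv _ _) _.
  have d1 : dist (T s y) (T s y') <= C * theta ^+ k.
    apply: le_trans (Tsep Ij yj y'j s0 sH (le_trans sH yy'H)) _.
    by rewrite ler_wpM2l // dtheta_le.
  apply: le_trans (ler_powR2l (ltW eta0) (dist0 _ _) d1) _.
  rewrite powRM //; apply: ler_pM; rewrite ?powR_ge0 //.
    by rewrite -[leRHS]powRr1 // ler_powR.
  rewrite -powR_mulrn ?(ltW theta0) // powRAC powR_mulrn ?powR_ge0 //.
  by rewrite lerXn2r // ?nnegrE ?powR_ge0 // (le_trans _ thetagam) ?powR_ge0.
have h2 := Aint_le dist0 eta0 Tholder hv (T (H y) y') dH0.
have h3 := roof_regular k0 yy'.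
rewrite distrC ger0_norm // in h3.
have h4 : C * theta ^+ k * roof_min y <= C * gam ^+ k * roof_min y.
  by rewrite ler_wpM2r ?(ltW r0) // ler_wpM2l // theta_gam.
have h5 : C * gam ^+ k * H y <= C * gam ^+ k * ((1 + C) * roof_min y).
  by rewrite ler_wpM2l ?mulr_ge0 // roof_le_min.
rewrite opprD addrA; apply: le_trans (ler_normB _ _) _.
rewrite /reg_const; lra.
Qed.

End Regularity.

(* No measurability of [f] is needed: the integral of a nonnegative function is a
   supremum over simple functions below it. *)
Lemma ge0_le_integral_upper {R : realType} {d} {S : measurableType d}
    (mu : {measure set S -> \bar R}) (D : set S) (f g : S -> \bar R) :
  (forall x, D x -> (0 <= f x)%E) -> (forall x, D x -> (f x <= g x)%E) ->
  (\int[mu]_(x in D) f x <= \int[mu]_(x in D) g x)%E.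
Proof.
move=> f0 fg; have g0 x : D x -> (0 <= g x)%E by move=> Dx; exact: le_trans (f0 x Dx) (fg x Dx).
rewrite !ge0_integralE //; apply: le_ereal_sup => _ [s /= sf <-]; exists s => // x.
apply: le_trans (sf x) _; rewrite !patchE; case: ifPn => // /set_mem; exact: fg.
Qed.

Lemma mx_norm_ge_entry {R : realType} m n (g : 'M[R]_(m, n)) i j : `|g i j| <= `|g|.
Proof.
rewrite -[Num.norm g]/(mx_norm g) mx_normrE.
exact: (le_bigmax _ (fun ij : 'I_m * 'I_n => `|g ij.1 ij.2|) (i, j)).
Qed.

Lemma mx_norm_powR_le {R : realType} m n (g : 'M[R]_(m, n)) (q : R) : 0 < q ->
  `|g| `^ q <= \sum_i \sum_j `|g i j| `^ q.
Proof.
move=> q0; have [->|g0] := eqVneq (`|g|) 0.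
  by rewrite powR0 ?gt_eqF //; do 2 (apply: sumr_ge0 => ? _); exact: powR_ge0.
have [[i j] /= e] := mx_norm_neq0 g0; rewrite -[Num.norm g]/(mx_norm g) e.
rewrite (bigD1 i) //= (bigD1 j) //= -addrA lerDl addr_ge0 //.
  by apply: sumr_ge0 => ? _; exact: powR_ge0.
by do 2 (apply: sumr_ge0 => ? _); exact: powR_ge0.
Qed.

(** * Coordinates of a vector observable and their normalisation *)

Section HolderNorm.
Context {R : realType} {dM : measure_display} {M : measurableType dM}.
Variables (dist : M -> M -> R) (eta : R) (n : nat) (v : M -> 'rV[R]_n).
Hypothesis hmet : is_metric dist.
Hypothesis vfin : (holder_norm dist eta v < +oo)%E.
Local Notation K := (fine (holder_norm dist eta v)).

Lemma holder_norm_ge0 : (0 <= holder_norm dist eta v)%E.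
Proof.
by apply: adde_ge0; apply: ereal_sup_ubound; left.
Qed.

Lemma holder_norm_fine : (K%:E)%E = holder_norm dist eta v.
Proof. by rewrite fineK // ge0_fin_numE // holder_norm_ge0. Qed.

Lemma holder_norm_coord_le i x : `|v x 0 i| <= K.
Proof.
apply: le_trans (mx_norm_ge_entry _ _ _) _.
rewrite -lee_fin holder_norm_fine /holder_norm; apply: le_trans (leeDl _ _).
  by apply: ereal_sup_ubound; right; exists x.
by apply: ereal_sup_ubound; left.
Qed.

Lemma holder_norm_coord_holder i x x' : `|v x 0 i - v x' 0 i| <= K * dist x x' `^ eta.
Proof.
have [d0 d1 _ _] := hmet.
have K0 : 0 <= K by rewrite fine_ge0 // holder_norm_ge0.
have [->|/eqP xx'] := eqVneq x x'.
  by rewrite subrr normr0 mulr_ge0 // powR_ge0.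
have dpos : 0 < dist x x'.
  by rewrite lt0r d0 andbT; apply/eqP => /d1.
have -> : v x 0 i - v x' 0 i = (v x - v x') 0 i by rewrite !mxE.
apply: le_trans (mx_norm_ge_entry _ _ _) _.
rewrite -ler_pdivrMr ?powR_gt0 // -lee_fin holder_norm_fine /holder_norm.
apply: le_trans (leeDr _ _).
  by apply: ereal_sup_ubound; right; exists (x, x').
by apply: ereal_sup_ubound; left.
Qed.

Lemma unit_holder_coord i : 0 < K -> unit_holder dist eta (fun x => v x 0 i / K).
Proof.
move=> K0; split => [x|x x'].
  by rewrite normrM normfV (gtr0_norm K0) ler_pdivrMr // mul1r holder_norm_coord_le.
rewrite -mulrBl normrM normfV (gtr0_norm K0) ler_pdivrMr // mulrC.
exact: holder_norm_coord_holder.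
Qed.

End HolderNorm.

(** * Integrals over the flow space as integrals over the base *)

Section FlowIntegral.
Context {R : realType} {dM : measure_display} {M : measurableType dM}.
Variables (dist : M -> M -> R) (T : R -> M -> M) (X Y : set M) (h : M -> R) (tau : M -> nat).
Variables (eta K : R) (muY : {measure set M -> \bar R}).
Hypothesis hT : is_semiflow T.
Hypothesis YX : Y `<=` X.
Hypothesis hpos : forall x, X x -> 0 < h x.
Hypothesis fX : forall x, X x -> X (flowf T h x).
Hypothesis dist0 : forall x y, 0 <= dist x y.
Hypothesis eta0 : 0 < eta.
Hypothesis Tholder : forall (t t' : R) (x : M), 0 <= t -> 0 <= t' ->
  dist (T t x) (T t' x) <= K * `|t - t'| `^ eta.
Local Notation f := (flowf T h).
Local Notation H := (Hroof T h tau).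
Local Notation leb := (@lebesgue_measure R).

(** The product of the two normalising factors. With the conventions for [fine] and for the inverse
    of 0, it is 0 when one of the integrals is zero or infinite, a case treated by [LqM_scale0]. *)
Definition intM_scale : R :=
  (fine (\int[muY]_(y in Y) ((tau y)%:R)%:E))^-1 *
  (fine (intX muY Y tau f (fun x => (h x)%:E)))^-1.

Lemma intM_scale_ge0 : 0 <= intM_scale.
Proof.
have ge1 : (0 <= \int[muY]_(y in Y) ((tau y)%:R : R)%:E)%E.
  by apply: integral_ge0 => y _; rewrite lee_fin.
apply: mulr_ge0; rewrite invr_ge0; apply: fine_ge0 => //; apply: mule_ge0.
  apply: integral_ge0 => y /YX Xy; apply: sume_ge0 => l _.
  by rewrite lee_fin; apply/ltW/hpos; apply: (iter_flowf_in fX).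
by rewrite lee_fin invr_ge0 fine_ge0.
Qed.

Lemma intME (g : M -> \bar R) : intM muY Y tau T h g =
  ((\int[muY]_(y in Y) (\sum_(l < tau y)
     \int[leb]_(u in `[0%R, h (iter l f y)]) g (T u (iter l f y)))) * (intM_scale)%:E)%E.
Proof. by rewrite /intM {1}/intX -muleA -EFinM. Qed.

Lemma iter_h_gt0 l y : Y y -> 0 < h (iter l f y).
Proof. by move=> /YX Xy; apply: hpos; exact: iter_flowf_in. Qed.

(** On the excursion of [y] the integrand is at most [G y], and the times [h (f^l y)] spent along it
    add up to [H y]; this is the origin of the weight. *)
Lemma intM_le (g G : M -> R) : (forall x, 0 <= g x) -> (forall y, Y y -> 0 <= G y) ->
  (forall y s, Y y -> 0 <= s -> s <= H y -> g (T s y) <= G y) ->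
  (intM muY Y tau T h (fun x => (g x)%:E) <=
   (\int[muY]_(y in Y) (H y * G y)%:E) * (intM_scale)%:E)%E.
Proof.
move=> g0 G0 gG; rewrite intME; apply: lee_wpmul2r; first by rewrite lee_fin intM_scale_ge0.
apply: ge0_le_integral_upper => y Yy.
  by apply: sume_ge0 => l _; apply: integral_ge0 => u _; rewrite lee_fin.
rewrite /Hroof mulr_suml -sumEFin; apply: lee_sum => l _.
have hl := iter_h_gt0 l Yy; set z := iter l _ y.
apply: (@le_trans _ _ (\int[leb]_(u in `[0%R, h z]) (G y)%:E)%E).
  apply: ge0_le_integral_upper => u; rewrite /= in_itv /= => /andP[u0 uh]; rewrite lee_fin //.
  have [s [s0 sH ->]] := flow_in_excursion hT YX hpos fX Yy (ltn_ord l) u0 uh.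
  exact: gG.
rewrite integral_cst //= lebesgue_measure_itv /= lte_fin hl.
by rewrite oppr0 adde0 -EFinM mulrC.
Qed.

Lemma Aint_flow_time v k x : unit_holder dist eta v -> X x ->
  Aint T v (flow_time T h k x) x = \sum_(l < k) Aint T v (h (iter l f x)) (iter l f x).
Proof.
have [T0 TD _] := hT; move=> hv Xx; elim: k => [|k IH].
  by rewrite /flow_time !big_ord0 (Aint0 dist0 eta0 Tholder hv).
rewrite /flow_time !big_ord_recr /= (AintD dist0 TD eta0 Tholder hv); last 2 first.
- exact: (flow_time_ge0 hpos fX).
- by apply/ltW/hpos; exact: iter_flowf_in.
by rewrite -/(flow_time T h k x) IH -(iter_flowf_time hT hpos fX).
Qed.

Lemma integral_observable v c t x : unit_holder dist eta v -> 0 <= t ->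
  (\int[leb]_(u in `[0%R, t]) (c * v (T u x))%:E = (c * Aint T v t x)%:E)%E.
Proof.
move=> hv t0; have cv : continuous (orbit_path T v x) by exact: (orbit_path_continuous dist0 eta0 Tholder hv).
rewrite -primZ //.
have cc : continuous (fun s => c * orbit_path T v x s).
  by move=> s; apply: cvgM; [exact: cvg_cst|exact: cv].
rewrite /prim /Rintegral fineK; last first.
  by apply: integrable_fin_num => //; exact: continuous_intergable_itv.
apply: eq_integral => s /set_mem /=; rewrite in_itv /= => /andP[s0 _].
by rewrite /orbit_path max0_id.
Qed.

(** Summing the time integrals over the steps of [f] restores the integral over the whole excursion.
    Hence zero mean on [M] becomes zero mean of the induced observable on [Y], provided the scale is
    nonzero. *)
Lemma intM_observable v c : unit_holder dist eta v ->
  (intM muY Y tau T h (fun x => (c * v x)%:E) =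
   (\int[muY]_(y in Y) (c * Aint T v (H y) y)%:E) * (intM_scale)%:E)%E.
Proof.
move=> hv; rewrite intME; congr (_ * _)%E; apply: eq_integral => y /set_mem Yy.
rewrite [Aint T v (H y) y](Aint_flow_time _ hv (YX Yy)) mulr_sumr -sumEFin.
by apply: eq_bigr => l _; rewrite (integral_observable _ _ hv) // ltW // iter_h_gt0.
Qed.

Lemma LqM_le m n (g : M -> 'M[R]_(m, n)) (q B : R) (G : 'I_m -> 'I_n -> M -> R) :
  0 < q -> 0 <= B -> measurable Y ->
  (forall i j, measurable_fun Y (fun y => H y * G i j y `^ q)) ->
  (forall i j y, Y y -> 0 <= G i j y) ->
  (forall i j y s, Y y -> 0 <= s -> s <= H y -> `|g (T s y) i j| <= G i j y) ->
  (forall i j, (\int[muY]_(y in Y) (H y * G i j y `^ q)%:E <= (B `^ q)%:E)%E) ->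
  (LqM muY Y tau T h q g <= (((m * n)%:R * intM_scale) `^ q^-1 * B)%:E)%E.
Proof.
move=> q0 B0 mY mG G0 gG hB.
have q00 : 0 <= q by exact: ltW.
have H0 y : Y y -> 0 <= H y by move=> Yy; exact: (Hroof_ge0 _ YX hpos fX).
have sc0 := intM_scale_ge0.
have h1 : (intM muY Y tau T h (fun x => (`|g x| `^ q)%:E) <=
    ((m * n)%:R * intM_scale * B `^ q)%:E)%E.
  apply: le_trans (@intM_le _ (fun y => \sum_i \sum_j G i j y `^ q) _ _ _) _.
  - by move=> x; exact: powR_ge0.
  - by move=> y _; do 2 (apply: sumr_ge0 => ? _); exact: powR_ge0.
  - move=> y s Yy s0 sH; apply: le_trans (mx_norm_powR_le _ q0) _.
    by apply: ler_sum => i _; apply: ler_sum => j _; apply: ler_powR2l => //; exact: gG.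
  rewrite mulrAC [leRHS]EFinM; apply: lee_wpmul2r; first by rewrite lee_fin.
  under eq_integral do rewrite mulr_sumr -sumEFin.
  rewrite ge0_integral_sum //; last 2 first.
  - move=> i; apply/measurable_EFinP; under eq_fun do rewrite mulr_sumr.
    by apply: measurable_sum => j; exact: mG.
  - move=> i y Yy; rewrite lee_fin mulr_ge0 ?H0 //.
    by apply: sumr_ge0 => ? _; exact: powR_ge0.
  rewrite natrM -mulrA mulr_natl -[m in leRHS]card_ord -sumr_const.
  rewrite -sumEFin; apply: lee_sum => i _.
  under eq_integral do rewrite mulr_sumr -sumEFin.
  rewrite ge0_integral_sum //; last 2 first.
  - by move=> j; apply/measurable_EFinP; exact: mG.
  - by move=> j y Yy; rewrite lee_fin mulr_ge0 ?H0 // powR_ge0.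
  rewrite mulr_natl -[n in leRHS]card_ord -sumr_const -sumEFin.
  by apply: lee_sum => j _; exact: hB.
rewrite /LqM; apply: (@le_trans _ _ ((((m * n)%:R * intM_scale * B `^ q)%:E) `^ q^-1)%E).
  apply: gt0_ler_poweR => //; rewrite ?invr_ge0 //.
  - rewrite in_itv /= leey andbT intME mule_ge0 ?lee_fin // integral_ge0 // => y Yy.
    apply: sume_ge0 => l _; apply: integral_ge0 => u _; rewrite lee_fin; exact: powR_ge0.
  - rewrite in_itv /= leey andbT lee_fin; apply: mulr_ge0; last exact: powR_ge0.
    exact: mulr_ge0.
rewrite poweR_EFin powRM ?powR_ge0 //; last exact: mulr_ge0.
by rewrite -[(B `^ q) `^ _]powRrM divff ?gt_eqF // powRr1.
Qed.

End FlowIntegral.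

(** * Moments of the truncated excursions *)

Section Moments.
Context {R : realType} {dM : measure_display} {M : measurableType dM}.
Variables (Y : set M) (F : M -> M) (I : set nat) (Yj : nat -> set M) (gam C0 : R).
Hypothesis mY : measurable Y.
Hypothesis FY : forall y, Y y -> Y (F y).
Hypothesis part : is_partition Y I Yj.
Hypothesis mF : forall A, measurable A -> measurable (Y `&` F @^-1` A).
Hypothesis gam0 : 0 < gam.
Hypothesis gam1 : gam < 1.
Hypothesis C00 : 0 <= C0.
Variable mu : probability M R.
Hypothesis muY : mu Y = 1%E.
Hypothesis invmu : forall A, measurable A -> A `<=` Y -> mu (Y `&` F @^-1` A) = mu A.
Hypothesis dmu : distortion_le Y F I Yj gam (msr mu) C0.
Local Notation cylE := (cyl_eq Y F I Yj).
Local Notation Ft := (extend_id Y F).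

Variables (H Hs : M -> R) (D : R).
Hypothesis D1 : 1 <= D.
Hypothesis Hs_cyl : forall y y', cylE 1 y y' -> Hs y = Hs y'.
Hypothesis Hs0 : forall y, Y y -> 0 < Hs y.
Hypothesis HsH : forall y, Y y -> Hs y <= H y.
Hypothesis HHs : forall y, Y y -> H y <= (1 + D) * Hs y.
Hypothesis Hreg : forall k y y', (0 < k)%N -> cylE k y y' ->
  `|H y - H y'| <= D * gam ^+ k * Hs y.

Local Notation tU := (truncU Y H D).
Local Notation env := (envelope Y H D).
Local Notation obs := (induced_observable Y F I Yj gam mu H Hs D).
Local Notation tset := (trunc_set Y Hs).
Local Notation HY := (H \_ Y).

Let mFt : measurable_fun setT Ft.
Proof. exact: measurable_extend_id. Qed.

Let invFt A : measurable A -> mu (Ft @^-1` A) = mu A.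
Proof. exact: invariant_extend_id. Qed.

Let HY0 y : 0 <= HY y.
Proof. exact: (HY_ge0 Hs0 HsH). Qed.

Let mHY' : measurable_fun setT HY.
Proof. exact: (mHY mY FY part mF gam0 gam1 Hreg). Qed.

Let env1 y : 1 <= env y.
Proof. exact: (envelope1 D1 Hs0 HsH). Qed.

Let HY_env y : HY y <= env y.
Proof.
rewrite patchE; case: ifPn => [/set_mem Yy|_]; first exact: (envelope_ge_H D1 Hs0 HsH).
exact: le_trans (env1 y).
Qed.

Let mHg g : bddm g -> measurable_fun setT (fun y => (HY y * g y)%:E).
Proof. by move=> [mg _]; apply/measurable_EFinP; exact: measurable_funM. Qed.

(** [U] is at most [(2 + D) * t0] and at most the envelope; the excess [s - r] of the exponent is
    charged to the former. *)
Lemma truncU_powR_le s r t0 y : 1 <= t0 -> 0 <= r -> r <= s ->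
  tU t0 y `^ s <= ((2 + D) * t0) `^ (s - r) * env y `^ r.
Proof.
move=> t1 r0 rs; have d := D1; have t00 : 0 < t0 by lra.
have u1 : 1 <= tU t0 y by exact: (truncU1 D1 Hs0 HsH).
have u0 : 0 <= tU t0 y by lra.
rewrite -{1}(subrK r s) powRD; last by apply/implyP => /eqP; lra.
apply: ler_pM; rewrite ?powR_ge0 //; apply: ler_powR2l => //; first by lra.
  have /andP[_ m] := min_bounds Hs0 HsH t00 y.
  have : (1 + D) * Num.min (HY y) t0 <= (1 + D) * t0 by rewrite ler_wpM2l //; lra.
  rewrite /truncU; lra.
exact: truncU_le_envelope.
Qed.

Lemma mean_truncU_powR s r t0 : 1 <= t0 -> 0 <= r -> r <= s ->
  mu.-integrable setT (EFin \o (fun y => env y `^ r)) ->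
  mean mu (fun y => tU t0 y `^ s) <= ((2 + D) * t0) `^ (s - r) * mean mu (fun y => env y `^ r).
Proof.
move=> t1 r0 rs ir; have t00 : 0 < t0 by lra.
rewrite /mean -RintegralZl //; apply: le_mean_int.
- apply: bddm_powR; [lra|exact: (bddm_truncU mY FY part mF gam0 gam1 D1 Hs0 HsH Hreg t00)|].
  by move=> x; apply: le_trans (truncU1 D1 Hs0 HsH t00 x).
- exact: (integrableZl measurableT _ ir).
- by move=> y; exact: truncU_powR_le.
Qed.

(** The weight [H] is itself below the envelope and counts as one of its [p] powers, so
    [s - (p - 1)] powers of [U] are left to be bounded by a multiple of [t0]. *)
Lemma integral_roof_truncU s p t0 : 1 <= t0 -> 1 <= p -> p - 1 <= s ->
  mu.-integrable setT (EFin \o (fun y => env y `^ p)) ->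
  (\int[mu]_y (HY y * tU t0 y `^ s)%:E <=
   (((2 + D) * t0) `^ (s + 1 - p) * mean mu (fun y => env y `^ p))%:E)%E.
Proof.
move=> t1 p1 ps ip.
have iZ := integrableZl measurableT (((2 + D) * t0) `^ (s + 1 - p)) ip.
have p10 : 0 <= p - 1 by lra.
rewrite /mean -RintegralZl // /Rintegral fineK; last exact: integrable_fin_num iZ.
apply: ge0_le_integral_upper => y _ /=; rewrite lee_fin.
  by rewrite mulr_ge0 // powR_ge0.
apply: le_trans (ler_wpM2l (HY0 y) (truncU_powR_le y t1 p10 ps)) _.
rewrite (_ : s - (p - 1) = s + 1 - p); last by ring.
rewrite mulrCA ler_wpM2l ?powR_ge0 // [leRHS]powRS1 ?ler_wpM2r ?powR_ge0 //; last by lra.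
exact: le_trans (env1 y).
Qed.

(** The roof, regarded as a density, is log-Hoelder on cylinders. After one return its push-forward
    is comparable with [mu], and the weight disappears. *)
Lemma integral_roof_comp : mu.-integrable setT (EFin \o env) ->
  exists2 C, 0 < C & forall g, bddm g -> (forall x, 0 <= g x) ->
  (\int[mu]_y (HY y * g (Ft y))%:E <= (C * mean mu g)%:E)%E.
Proof.
move=> ienv; have d := D1; have D0 : 0 <= D by lra.
have [K [s [K0 _ mix]]] := mixing_fun mY FY part mF gam0 gam1 C00 muY invmu dmu D0.
have iHY : mu.-integrable setT (EFin \o HY).
  apply: le_integrable ienv => //; first exact/measurable_EFinP.
  by move=> y _ /=; rewrite lee_fin !ger0_norm // (le_trans _ (env1 y)).
have m0 : 0 <= mean mu HY by exact: mean_ge0.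
exists ((1 + K) * mean mu HY + 1); first by rewrite ltr_wpDl // mulr_ge0 // addr_ge0.
have ratio w y y' : (0 < size w)%N -> wcyl Y F I Yj w y -> wcyl Y F I Yj w y' ->
    HY y <= expR (D * gam ^+ size w) * HY y'.
  move=> w0 wy wy'; have yy' : cylE (size w) y y' by exists w.
  have [Yy Yy'] := cyl_eq_sub part yy'; rewrite !patchT ?mem_set //.
  exact: (cyl_ratio_H part gam0 D1 Hs_cyl Hs0 HsH Hreg w0 yy').
move=> g bg g0; have [mixg _] := mix _ mHY' HY0 iHY ratio 0%N g bg.1 g0.
rewrite /= expr0 mulr1 in mixg; apply: le_trans mixg _.
have bZ := bddmZ ((1 + K) * mean mu HY) bg.
rewrite -EFin_mean // lee_fin meanZ // ler_wpM2r ?mean_ge0 //; lra.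
Qed.

Lemma integral_roof_split C q X (u z : M -> R) :
  (forall g, bddm g -> (forall x, 0 <= g x) ->
    (\int[mu]_y (HY y * g (Ft y))%:E <= (C * mean mu g)%:E)%E) ->
  0 <= q -> bddm u -> bddm z -> (forall y, 0 <= u y) -> (forall y, 0 <= z y) ->
  (\int[mu]_y (HY y * u y `^ q)%:E <= X%:E)%E ->
  (\int[mu]_y (HY y * (u y + z (Ft y)) `^ q)%:E <=
   (2 `^ q * (X + C * mean mu (fun y => z y `^ q)))%:E)%E.
Proof.
move=> hC q0 bu bz u0 z0 hX.
have bzq : bddm (fun y => z y `^ q) by exact: bddm_powR.
have buq : bddm (fun y => u y `^ q) by exact: bddm_powR.
have bzF : bddm (fun y => z (Ft y) `^ q) by apply: (bddm_comp mFt bzq).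
apply: (@le_trans _ _ ((2 `^ q)%:E * (\int[mu]_y (HY y * u y `^ q)%:E +
    \int[mu]_y (HY y * z (Ft y) `^ q)%:E))%E); last first.
  rewrite EFinM; apply: lee_wpmul2l; first by rewrite lee_fin powR_ge0.
  rewrite EFinD; apply: leeD => //; exact: (hC _ bzq (fun x => powR_ge0 _ _)).
rewrite -ge0_integralD //; last 4 first.
- by move=> y _; rewrite lee_fin mulr_ge0 // powR_ge0.
- exact: mHg.
- by move=> y _; rewrite lee_fin mulr_ge0 // powR_ge0.
- exact: mHg.
rewrite -ge0_integralZl //; last 2 first.
- by apply: emeasurable_funD; exact: mHg.
- by move=> y _; rewrite adde_ge0 // lee_fin mulr_ge0 // powR_ge0.
apply: ge0_le_integral_upper => y _; first by rewrite lee_fin mulr_ge0 // powR_ge0.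
rewrite -EFinD -EFinM lee_fin -mulrDr mulrCA ler_wpM2l //.
exact: powRD_le.
Qed.

(** The maximal inequalities need a horizon that is a power of 2, long enough that no orbit
    completes it before time [t], yet at most a multiple of [t]. *)
Lemma dyadic_above (h0 t : R) : 0 < h0 -> 1 <= t ->
  exists r, t < (2 ^ r)%:R * h0 /\ (2 ^ r)%:R <= (1 + 2 / h0) * t.
Proof.
move=> h00 t1.
have ex : exists r, t < (2 ^ r)%:R * h0.
  exists (Num.bound (t / h0)); rewrite -ltr_pdivrMr //.
  apply: (lt_le_trans (archi_boundP _)); first by rewrite divr_ge0 ?ltW //; lra.
  by rewrite ler_nat ltnW // ltn_expl.
case: (ex_minnP ex) => r tr rmin; exists r; split => //.
have h20 : 0 <= 2 / h0 by rewrite divr_ge0 // ltW.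
case: r tr rmin => [_ _|r tr rmin].
  by rewrite expn0; apply: (le_trans t1); rewrite ler_peMl //; lra.
have h : (2 ^ r)%:R * h0 <= t by rewrite leNgt; apply/negP => /rmin; rewrite ltnn.
rewrite expnS natrM; apply: (@le_trans _ _ (2 / h0 * t)); last by rewrite ler_wpM2r //; lra.
by rewrite -mulrA ler_wpM2l // mulrC ler_pdivlMr.
Qed.

Section FixParams.
Variables (h0 : R).
Hypothesis h00 : 0 < h0.
Local Notation Vt V t := (V \_ (tset t)).
Local Notation RU t N := (runmax (fun k z => tU t (iter k Ft z)) N).
Local Notation kappa := (1 + 2 / h0).

Let kappa0 : 0 <= kappa.
Proof. by rewrite addr_ge0 // divr_ge0 // ltW. Qed.

Lemma integrable_powR_env (a b : R) : 0 <= a -> a <= b ->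
  mu.-integrable setT (EFin \o (fun y => env y `^ b)) ->
  mu.-integrable setT (EFin \o (fun y => env y `^ a)).
Proof. exact: (integrable_envelope mY FY part mF gam0 gam1 D1 Hs0 HsH Hreg). Qed.

Lemma integrable_env (b : R) : 1 <= b ->
  mu.-integrable setT (EFin \o (fun y => env y `^ b)) -> mu.-integrable setT (EFin \o env).
Proof.
move=> b1 /(integrable_powR_env ler01 b1); congr (_.-integrable _ _).
by apply/funext => y /=; rewrite powRr1 // (le_trans _ (env1 y)).
Qed.

Lemma powR_le_scale (c t N r : R) : 0 <= r -> 0 <= c -> 0 <= N -> 0 <= t -> N <= c * t ->
  N `^ r <= c `^ r * t `^ r.
Proof. by move=> r0 c0 N0 t0 h; rewrite -powRM //; exact: ler_powR2l. Qed.

Lemma bddm_Vt V t : obs V -> 0 < t -> bddm (Vt V t).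
Proof.
move=> [VH Vreg _] t0; apply: (bddm_trunc mY FY part mF D1 Hs_cyl HHs t0) => //.
exact: (measurable_regular mY FY part mF gam0 gam1 Vreg).
Qed.

Lemma bddm_first_bound V t N : obs V -> 0 < t ->
  bddm (fun y => tU t y + (runmax (birkhoff Ft (Vt V t)) N (Ft y) + RU t N (Ft y))).
Proof.
move=> oV t0; have bV := bddm_Vt oV t0.
have bU := bddm_truncU mY FY part mF gam0 gam1 D1 Hs0 HsH Hreg t0.
apply: bddmD => //; apply: (bddm_comp mFt (f := fun y => runmax (birkhoff Ft (Vt V t)) N y + RU t N y)).
by apply: bddmD; apply: bddm_runmax => i; [exact: bddm_birkhoff|exact: bddm_iter].
Qed.

Lemma bddm_second_bound V W t N : obs V -> obs W -> 0 < t ->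
  bddm (fun y => 2 * tU t y ^+ 2 +
     (runmax (birkhoff2 Ft (Vt V t) (Vt W t)) N (Ft y)
      + 4 * birkhoff Ft (fun z => tU t z ^+ 2) N (Ft y)
      + runmax (birkhoff Ft (Vt V t)) N (Ft y) ^+ 2
      + 2 * runmax (birkhoff Ft (Vt W t)) N (Ft y) ^+ 2)).
Proof.
move=> oV oW t0; have bV := bddm_Vt oV t0; have bW := bddm_Vt oW t0.
have bU := bddm_truncU mY FY part mF gam0 gam1 D1 Hs0 HsH Hreg t0.
apply: bddmD; first exact/bddmZ/bddmX.
apply: (bddm_comp mFt (f := fun y => runmax (birkhoff2 Ft (Vt V t) (Vt W t)) N y
  + 4 * birkhoff Ft (fun z => tU t z ^+ 2) N y
  + runmax (birkhoff Ft (Vt V t)) N y ^+ 2 + 2 * runmax (birkhoff Ft (Vt W t)) N y ^+ 2)).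
apply: bddmD; [apply: bddmD; [apply: bddmD|]|].
- by apply: bddm_runmax => i; exact: bddm_birkhoff2.
- by apply/bddmZ/bddm_birkhoff => //; exact: bddmX.
- by apply/bddmX/bddm_runmax => i; exact: bddm_birkhoff.
- by apply/bddmZ/bddmX/bddm_runmax => i; exact: bddm_birkhoff.
Qed.

(** Maximal inequalities are used with [delta = p1 - p], positive because [p1 > p]. The current
    excursion keeps the weight [H], while everything from the first return on is freed of it by
    [integral_roof_comp]. *)
Lemma first_moment p p1 : 2 < p -> p < p1 -> p1 <= 2 * p - 2 ->
  mu.-integrable setT (EFin \o (fun y => env y `^ p1)) ->
  exists2 C, 0 < C & forall V, obs V -> forall t, 1 <= t -> exists N, t < N%:R * h0 /\
  (\int[mu]_y (HY y * (tU t y + (runmax (birkhoff Ft (Vt V t)) N (Ft y) + RU t N (Ft y)))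
     `^ (2 * (p - 1)))%:E <= (C * t `^ (p - 1))%:E)%E.
Proof.
move=> p2 pp1 p1p ip1; set q := 2 * (p - 1).
have d := D1; have p10 : 0 <= p1 by lra. have p11 : 1 <= p1 by lra.
have p12 : 2 <= p1 by lra. have p1q : p1 <= q by rewrite /q; lra.
have D2 : 0 <= 2 + D by lra. have D21 : 1 <= 2 + D by lra. have p1q1 : p1 - 1 <= q by rewrite /q; lra.
have pq1 : q + 1 - p1 <= p - 1 by rewrite /q; lra. have q20 : 0 <= p - 1 by lra.
(* The growth of the truncated moment, [t^(q-p1)], is exactly what the maximal inequality tolerates
   for this [delta]. *)
have e1 : q / 2 - 1 - (p1 - p) = q - p1 by rewrite /q; lra.
have e2 : q / 2 - 1 - (p1 - p) + (1 + (p1 - p)) = p - 1 by rewrite /q; lra.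
have e3 : q / 2 - 1 - (p1 - p) <= p - 1 - 1 by rewrite /q; lra.
have h20 : (0 : R) <= 2 by []. have q0 : 0 < q by rewrite /q; lra. have q2 : 2 < q by rewrite /q; lra.
have i2 := integrable_powR_env h20 p12 ip1.
have [c [D' [c0 D'0 WD]]] := truncated_weakly_dependent mY FY part mF gam0 gam1 C00 muY invmu
  dmu D1 Hs_cyl Hs0 HsH HHs Hreg i2 p12 kappa0 ip1.
have [CH CH0 hCH] := integral_roof_comp (integrable_env p11 ip1).
pose E1 := mean mu (fun y => env y `^ p1).
have E10 : 0 <= E1 by apply: mean_ge0 => y; exact: powR_ge0.
(* From [t < N * h0]: the bound [(2 + D) * t] for [U] becomes [(2 + D) * h0 * N]. *)
pose Bd := ((2 + D) * h0) `^ (q - p1) * E1.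
have Bd0 : 0 <= Bd by rewrite mulr_ge0 // powR_ge0.
have del0 : 0 < p1 - p by lra. have delq : 1 + (p1 - p) <= q / 2 by rewrite /q; lra.
have [C1 C10 hC1] := moment_runmax_birkhoff q2 c0 D'0 Bd0 del0 delq.
have C1B : 0 <= C1 + 2 * Bd := addr_ge0 (ltW C10) (mulr_ge0 h20 Bd0).
pose X1 := (2 + D) `^ (p - 1) * E1.
pose X2 := 2 `^ q * (C1 + 2 * Bd) * kappa `^ (p - 1).
have X10 : 0 <= X1 by rewrite mulr_ge0 // powR_ge0.
have X20 : 0 <= X2.
  by apply: mulr_ge0; [apply: mulr_ge0; [exact: powR_ge0|exact: C1B]|exact: powR_ge0].
have K0 : 0 < 2 `^ q :> R by rewrite powR_gt0.
exists (2 `^ q * (X1 + CH * X2) + 1).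
  by rewrite ltr_wpDl // mulr_ge0 ?(ltW K0) // addr_ge0 // mulr_ge0 // ltW.
move=> V oV t t1; have [r [rt rk]] := dyadic_above h00 t1; exists (2 ^ r)%N; split => //.
have t0 : 0 < t by exact: lt_le_trans t1.
have tD1 : 1 <= (2 + D) * t by rewrite mulr_ege1.
have wd := WD V oV t (2 ^ r)%N t0 rk.
set N := (2 ^ r)%N in rt rk wd *.
have N0 : 0 < N%:R :> R by rewrite ltr0n expn_gt0.
have N1 : 1 <= N%:R :> R by rewrite ler1n expn_gt0.
have bU := bddm_truncU mY FY part mF gam0 gam1 D1 Hs0 HsH Hreg t0.
have U1 y : 1 <= tU t y by exact: (truncU1 D1 Hs0 HsH).
have U0 y : 0 <= tU t y by exact: le_trans (U1 y).
have bV := bddm_Vt oV t0.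
have mU : mean mu (fun x => tU t x `^ q) <= Bd * N%:R `^ (q / 2 - 1 - (p1 - p)).
  apply: le_trans (mean_truncU_powR t1 p10 p1q ip1) _; rewrite -/E1 /Bd mulrAC ler_wpM2r //.
  rewrite e1 -powRM ?mulr_ge0 ?(ltW h00) ?(ltW N0) //; apply: ler_powR2l.
  - by rewrite subr_ge0.
  - by rewrite mulr_ge0 // ltW.
  - by rewrite -mulrA ler_wpM2l // [h0 * _]mulrC ltW.
have [_] := hC1 _ _ mu Ft mFt invFt p1 r (tU t) (Vt V t) p12 wd mU r (leqnn r).
rewrite /= -/N -powRD; last by apply/implyP => _; rewrite gt_eqF.
rewrite e2 => m1.
have m2 : mean mu (fun x => RU t N x `^ q) <= 2 * Bd * N%:R `^ (p - 1).
  apply: (moment_runmax_comp q0 Bd0 q20 mFt invFt) => //; first by rewrite expn_gt0.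
  rewrite (_ : (fun x => `|tU t x| `^ q) = (fun x => tU t x `^ q)); last first.
    by apply/funext => x; rewrite ger0_norm.
  by apply: le_trans mU _; rewrite ler_wpM2l // ler_powR.
have bR1 : bddm (runmax (birkhoff Ft (Vt V t)) N).
  by apply: bddm_runmax => i; exact: bddm_birkhoff.
have bR2 : bddm (RU t N) by apply: bddm_runmax => i; exact: bddm_iter.
have R10 x := runmax_ge0 (birkhoff Ft (Vt V t)) N x.
have R20 x := runmax_ge0 (fun k z => tU t (iter k Ft z)) N x.
have hU : (\int[mu]_y (HY y * tU t y `^ q)%:E <= (X1 * t `^ (p - 1))%:E)%E.
  apply: le_trans (integral_roof_truncU t1 p11 p1q1 ip1) _; rewrite lee_fin -/E1 /X1.
  by rewrite mulrAC ler_wpM2r // -powRM ?(ltW t0) // ler_powR.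
have bRR : bddm (fun x => runmax (birkhoff Ft (Vt V t)) N x + RU t N x) by exact: bddmD.
have RR0 x : 0 <= runmax (birkhoff Ft (Vt V t)) N x + RU t N x by exact: addr_ge0.
apply: le_trans (integral_roof_split hCH (ltW q0) bU bRR U0 RR0 hU) _.
rewrite lee_fin.
have mR : mean mu (fun y => (runmax (birkhoff Ft (Vt V t)) N y + RU t N y) `^ q) <=
    X2 * t `^ (p - 1).
  have b1 : bddm (fun y => runmax (birkhoff Ft (Vt V t)) N y `^ q).
    by apply: bddm_powR => //; exact: ltW.
  have b2 : bddm (fun y => RU t N y `^ q) by apply: bddm_powR => //; exact: ltW.
  have b3 := bddmD b1 b2.
  apply: (@le_trans _ _ (mean mu (fun y => 2 `^ q *
      (runmax (birkhoff Ft (Vt V t)) N y `^ q + RU t N y `^ q)))).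
    apply: le_mean; [apply: bddm_powR => //; exact: ltW|exact: bddmZ|].
    by move=> x; apply: powRD_le => //; exact: ltW.
  rewrite meanZ // meanD // /X2 -!mulrA ler_wpM2l ?(ltW K0) //.
  have sc := powR_le_scale q20 kappa0 (ltW N0) (ltW t0) rk.
  apply: le_trans (lerD m1 m2) _; rewrite -mulrDl; exact: ler_wpM2l.
have tp : 0 <= t `^ (p - 1) by exact: powR_ge0.
rewrite (_ : (2 `^ q * (X1 + CH * X2) + 1) * t `^ (p - 1) =
  2 `^ q * (X1 * t `^ (p - 1) + CH * (X2 * t `^ (p - 1))) + t `^ (p - 1)); last by ring.
apply: ler_wpDr => //; rewrite ler_wpM2l ?(ltW K0) // lerD2l ler_wpM2l //; exact: ltW.
Qed.

(** Here [p = 3 * q / 2 + 1], so that [q <= p] and the [q]-th moment of [U] is bounded uniformly in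
    [t], while the moment of order [2 * q] grows like [t^(2q-p)]. *)
Lemma second_moment p : 4 < p ->
  mu.-integrable setT (EFin \o (fun y => env y `^ p)) ->
  exists2 C, 0 < C & forall V W, obs V -> obs W -> forall t, 1 <= t -> exists N, t < N%:R * h0 /\
  (\int[mu]_y (HY y * (2 * tU t y ^+ 2 +
     (runmax (birkhoff2 Ft (Vt V t) (Vt W t)) N (Ft y)
      + 4 * birkhoff Ft (fun z => tU t z ^+ 2) N (Ft y)
      + runmax (birkhoff Ft (Vt V t)) N (Ft y) ^+ 2
      + 2 * runmax (birkhoff Ft (Vt W t)) N (Ft y) ^+ 2))
     `^ (2 * (p - 1) / 3))%:E <= (C * t `^ (2 * (p - 1) / 3))%:E)%E.
Proof.
move=> p4 ip; set q := 2 * (p - 1) / 3.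
have d := D1; have p0 : 0 <= p by lra. have p1 : 1 <= p by lra. have p2 : 2 <= p by lra.
have q2 : 2 < q by rewrite /q; lra. have q0 : 0 < q by lra. have q00 : 0 <= q by lra.
have qp : q <= p by rewrite /q; lra. have pq : p <= 2 * q by rewrite /q; lra.
have qq2 : 2 < 2 * q by lra. have qq0 : 0 <= 2 * q by lra.
(* With [delta = q / 2], the tolerated exponent [q - 1 - delta] equals [2 * q - p]. *)
have del0 : 0 < q / 2 by lra. have delq : 1 + q / 2 <= q by lra.
have delq' : 1 + q / 2 <= 2 * q / 2 by lra.
have e1 : q - 1 - q / 2 = 2 * q - p by rewrite /q; lra.
have e2 : 2 * q / 2 - 1 - q / 2 = q - 1 - q / 2 by lra.
have e3 : q - 1 - q / 2 + (1 + q / 2) = q by lra.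
have e4 : 1 + (q - 1 - q / 2) <= q by lra.
have p1qq : p - 1 <= 2 * q by lra. have e5 : 2 * q + 1 - p <= q by rewrite /q; lra.
have D2 : 0 <= 2 + D by lra. have D21 : 1 <= 2 + D by lra.
have h20 : (0 : R) <= 2 by []. have h40 : (0 : R) <= 4 by [].
have i2 := integrable_powR_env h20 p2 ip.
have iq := integrable_powR_env q00 qp ip.
have [c [D' [c0 D'0 WD]]] := truncated_weakly_dependent mY FY part mF gam0 gam1 C00 muY invmu
  dmu D1 Hs_cyl Hs0 HsH HHs Hreg i2 p2 kappa0 ip.
have [CH CH0 hCH] := integral_roof_comp (integrable_env p1 ip).
pose E1 := mean mu (fun y => env y `^ p).
pose Eq := mean mu (fun y => env y `^ q).
have E10 : 0 <= E1 by apply: mean_ge0 => y; exact: powR_ge0.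
have Eq0 : 0 <= Eq by apply: mean_ge0 => y; exact: powR_ge0.
pose B1 := ((2 + D) * h0) `^ (2 * q - p) * E1.
have B10 : 0 <= B1 by rewrite mulr_ge0 // powR_ge0.
pose Bd := Eq + B1.
have Bd0 : 0 <= Bd by exact: addr_ge0.
have [C2 C20 hC2] := moment_runmax_birkhoff2 q2 c0 D'0 Bd0 del0 delq.
have [C3 C30 hC3] := moment_birkhoff_sqr D' q2 c0.
have [C4 C40 hC4] := moment_runmax_birkhoff qq2 c0 D'0 Bd0 del0 delq'.
pose K : R := 2 `^ q.
have K0 : 0 < K by rewrite powR_gt0.
have K00 := ltW K0.
pose X1 := K * ((2 + D) `^ q * E1).
pose X2 := K * (C2 + K * (4 `^ q * (C3 * (1 + Bd)) + K * (C4 + K * C4))) * kappa `^ q.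
have X10 : 0 <= X1 by do 2 (apply: mulr_ge0; rewrite ?powR_ge0 //).
have S0 : 0 <= C2 + K * (4 `^ q * (C3 * (1 + Bd)) + K * (C4 + K * C4)).
  have C40' := ltW C40; have C1B : 0 <= 1 + Bd by exact: addr_ge0.
  apply: addr_ge0; first exact: ltW.
  apply: mulr_ge0 => //; apply: addr_ge0.
    by apply: mulr_ge0; [exact: powR_ge0|apply: mulr_ge0 => //; exact: ltW].
  by apply: mulr_ge0 => //; apply: addr_ge0 => //; exact: mulr_ge0.
have X20 : 0 <= X2 by apply: mulr_ge0; [exact: mulr_ge0|exact: powR_ge0].
exists (K * (X1 + CH * X2) + 1).
  by rewrite ltr_wpDl // mulr_ge0 // addr_ge0 // mulr_ge0 // ltW.
move=> V W oV oW t t1; have [r [rt rk]] := dyadic_above h00 t1; exists (2 ^ r)%N; split => //.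
have t0 : 0 < t by exact: lt_le_trans t1.
have tD1 : 1 <= (2 + D) * t by rewrite mulr_ege1.
have wdV := WD V oV t (2 ^ r)%N t0 rk.
have wdW := WD W oW t (2 ^ r)%N t0 rk.
set N := (2 ^ r)%N in rt rk wdV wdW *.
have N0 : 0 < N%:R :> R by rewrite ltr0n expn_gt0.
have N1 : 1 <= N%:R :> R by rewrite ler1n expn_gt0.
have bU := bddm_truncU mY FY part mF gam0 gam1 D1 Hs0 HsH Hreg t0.
have U1 y : 1 <= tU t y by exact: (truncU1 D1 Hs0 HsH).
have U0 y : 0 <= tU t y by exact: le_trans (U1 y).
have bV := bddm_Vt oV t0; have bW := bddm_Vt oW t0.
have m2q : mean mu (fun x => tU t x `^ (2 * q)) <= Bd * N%:R `^ (q - 1 - q / 2).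
  apply: le_trans (mean_truncU_powR t1 p0 pq ip) _; rewrite -/E1.
  apply: (@le_trans _ _ (B1 * N%:R `^ (q - 1 - q / 2))); last first.
    by apply: ler_wpM2r; [exact: powR_ge0|rewrite lerDr].
  rewrite /B1 mulrAC ler_wpM2r // e1 -powRM ?mulr_ge0 ?(ltW h00) ?(ltW N0) //; apply: ler_powR2l.
  - by rewrite subr_ge0.
  - by rewrite mulr_ge0 // ltW.
  - by rewrite -mulrA ler_wpM2l // [h0 * _]mulrC ltW.
have mq : mean mu (fun x => tU t x `^ q) <= Bd.
  apply: (@le_trans _ _ Eq); last by rewrite lerDl.
  apply: le_mean_int => //; first exact: bddm_powR.
  by move=> x; apply: ler_powR2l => //; exact: truncU_le_envelope.
have mB := hC2 _ _ mu Ft mFt invFt p r (tU t) (Vt V t) (Vt W t) qp wdV wdW mq m2q.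
have mQ : mean mu (fun x => birkhoff Ft (fun y => tU t y ^+ 2) N x `^ q) <=
    C3 * (1 + Bd) * N%:R `^ q.
  apply: le_trans (hC3 _ _ mu Ft mFt invFt p N (tU t) (Vt V t) p2 wdV N) _.
  rewrite (_ : C3 * (1 + Bd) * N%:R `^ q = C3 * (N%:R `^ q + Bd * N%:R `^ q)); last by ring.
  apply: ler_wpM2l; [exact: ltW|apply: lerD => //].
  apply: le_trans (ler_wpM2l (ltW N0) m2q) _; rewrite mulrCA ler_wpM2l //.
  rewrite -{1}[N%:R]powRr1 ?(ltW N0) // -powRD; last by apply/implyP => _; rewrite gt_eqF.
  exact: ler_powR.
have mR V' : weakly_dependent mu Ft p c D' N (tU t) V' ->
    mean mu (fun x => (runmax (birkhoff Ft V') N x ^+ 2) `^ q) <= C4 * N%:R `^ q.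
  move=> wd; have m2q' := m2q; rewrite -e2 in m2q'.
  have [_] := hC4 _ _ mu Ft mFt invFt p r (tU t) V' p2 wd m2q' r (leqnn r).
  rewrite /= -/N -powRD; last by apply/implyP => _; rewrite gt_eqF.
  rewrite e2 e3 => h; apply: le_trans h; rewrite le_eqVlt; apply/orP; left; apply/eqP.
  congr (mean _ _); apply/funext => x.
  by rewrite -powR_mulrn ?runmax_ge0 // -powRrM.
have mRV := mR _ wdV; have mRW := mR _ wdW.
have hU : (\int[mu]_y (HY y * (2 * tU t y ^+ 2) `^ q)%:E <= (X1 * t `^ q)%:E)%E.
  have E y : HY y * (2 * tU t y ^+ 2) `^ q = K * (HY y * tU t y `^ (2 * q)).
    rewrite powRM ?sqr_ge0 // -[tU t y ^+ 2]powR_mulrn // -powRrM mulrCA //.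
  under eq_integral do rewrite E EFinM.
  rewrite ge0_integralZl ?lee_fin //; last 2 first.
  - by apply: mHg; apply: bddm_powR.
  - by move=> y _; rewrite lee_fin mulr_ge0 // powR_ge0.
  rewrite /X1 -mulrA EFinM; apply: lee_wpmul2l; first by rewrite lee_fin.
  apply: le_trans (integral_roof_truncU t1 p1 p1qq ip) _; rewrite lee_fin -/E1.
  by rewrite mulrAC ler_wpM2r // -powRM ?(ltW t0) // ler_powR.
have R0 V' x := runmax_ge0 (birkhoff Ft V') N x.
have bR V' : bddm V' -> bddm (runmax (birkhoff Ft V') N).
  by move=> bV'; apply: bddm_runmax => i; exact: bddm_birkhoff.
pose RB := runmax (birkhoff2 Ft (Vt V t) (Vt W t)) N.
pose Q := birkhoff Ft (fun z => tU t z ^+ 2) N.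
pose RV x := runmax (birkhoff Ft (Vt V t)) N x ^+ 2.
pose RW x := runmax (birkhoff Ft (Vt W t)) N x ^+ 2.
have RB0 x : 0 <= RB x by exact: runmax_ge0.
have RV0 x : 0 <= RV x by exact: sqr_ge0.
have RW0 x : 0 <= RW x by exact: sqr_ge0.
have Q0 x : 0 <= Q x by apply: sumr_ge0 => i _; exact: sqr_ge0.
have bRB : bddm RB by apply: bddm_runmax => i; exact: bddm_birkhoff2.
have bRV : bddm RV by apply: bddmX; exact: bR.
have bRW : bddm RW by apply: bddmX; exact: bR.
have bU2 : bddm (fun z => tU t z ^+ 2) by exact: bddmX.
have bQ : bddm Q by exact: bddm_birkhoff.
have mean2 (f g : M -> R) (a b : R) : bddm f -> bddm g -> (forall x, 0 <= f x) -> (forall x, 0 <= g x) ->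
    mean mu (fun x => f x `^ q) <= a -> mean mu (fun x => g x `^ q) <= b ->
    mean mu (fun x => (f x + g x) `^ q) <= K * (a + b).
  move=> bf bg f0 g0 fa gb.
  have b1 : bddm (fun x => f x `^ q) by exact: bddm_powR.
  have b2 : bddm (fun x => g x `^ q) by exact: bddm_powR.
  have b3 := bddmD b1 b2.
  apply: (@le_trans _ _ (mean mu (fun y => K * (f y `^ q + g y `^ q)))).
    apply: le_mean; [|exact: bddmZ|by move=> x; exact: powRD_le].
    apply: bddm_powR => //; [exact: bddmD|by move=> x; exact: addr_ge0].
  by rewrite meanZ // meanD // ler_wpM2l // lerD.
have meanc (f : M -> R) (k a : R) : bddm f -> 0 <= k -> (forall x, 0 <= f x) ->
    mean mu (fun x => f x `^ q) <= a -> mean mu (fun x => (k * f x) `^ q) <= k `^ q * a.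
  move=> bf k0 f0 fa; under eq_fun do rewrite powRM //.
  by rewrite meanZ; [rewrite ler_wpM2l ?powR_ge0|exact: bddm_powR].
have bz : bddm (fun x => RB x + 4 * Q x + RV x + 2 * RW x).
  by do 3 (apply: bddmD => //; try exact: bddmZ).
have z0 x : 0 <= RB x + 4 * Q x + RV x + 2 * RW x by rewrite !addr_ge0 // mulr_ge0.
have bu : bddm (fun y => 2 * tU t y ^+ 2) by exact: bddmZ.
have u0 y : 0 <= 2 * tU t y ^+ 2 by rewrite mulr_ge0 // sqr_ge0.
apply: le_trans (integral_roof_split hCH q00 bu bz u0 z0 hU) _.
rewrite lee_fin.
have mz : mean mu (fun x => (RB x + 4 * Q x + RV x + 2 * RW x) `^ q) <= X2 * t `^ q.
  have E : (fun x => (RB x + 4 * Q x + RV x + 2 * RW x) `^ q) =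
      (fun x => (RB x + (4 * Q x + (RV x + 2 * RW x))) `^ q).
    by apply/funext => x; rewrite -!addrA.
  have g3 x : 0 <= 2 * RW x by exact: mulr_ge0.
  have g4 x : 0 <= 4 * Q x by exact: mulr_ge0.
  have g2 x : 0 <= RV x + 2 * RW x by exact: addr_ge0.
  have g1 x : 0 <= 4 * Q x + (RV x + 2 * RW x) by exact: addr_ge0.
  have b3 := bddmZ 2 bRW; have b4 := bddmZ 4 bQ.
  have b2 := bddmD bRV b3; have b1 := bddmD b4 b2.
  have h3 := meanc _ _ _ bRW h20 RW0 mRW.
  have h2 := mean2 _ _ _ _ bRV b3 RV0 g3 mRV h3.
  have h4 := meanc _ _ _ bQ h40 Q0 mQ.
  have h1 := mean2 _ _ _ _ b4 b2 g4 g2 h4 h2.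
  have h0' := mean2 _ _ _ _ bRB b1 RB0 g1 mB h1.
  rewrite E; apply: (le_trans h0').
  have sc := powR_le_scale q00 kappa0 (ltW N0) (ltW t0) rk.
  rewrite (_ : K * _ = K * (C2 + K * (4 `^ q * (C3 * (1 + Bd)) + K * (C4 + K * C4))) * N%:R `^ q);
    last by rewrite -/K; ring.
  by rewrite /X2 -!mulrA ler_wpM2l // ler_wpM2l.
have tp : 0 <= t `^ q by exact: powR_ge0.
rewrite (_ : (K * (X1 + CH * X2) + 1) * t `^ q =
  K * (X1 * t `^ q + CH * (X2 * t `^ q)) + t `^ q); last by ring.
apply: ler_wpDr => //; rewrite ler_wpM2l // lerD2l ler_wpM2l //; exact: ltW.
Qed.

End FixParams.
End Moments.

(** Dyadic decomposition of the range: [f^p] is at most [b_0^p] plus the sum of [b_(k+1)^p] over the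
    levels [b_k < f]. By the tail bound these terms have integrals of geometric decay, with ratio
    [2^(p-beta) < 1]. *)
Lemma powR_integrable_of_tail {R : realType} {d} {S : measurableType d} (P : probability S R)
    (f : S -> R) (p beta K : R) (N0 : nat) :
  measurable_fun setT f -> (forall x, 0 <= f x) -> 0 <= p -> p < beta ->
  (forall n, (N0 <= n)%N -> (P [set x | n%:R < f x]%R <= (K * n%:R `^ (- beta))%:E)%E) ->
  P.-integrable setT (EFin \o (fun x => f x `^ p)).
Proof.
move=> mf f0 p0 pb tail.
have mfp : measurable_fun setT (fun x => f x `^ p).
  by apply: (measurableT_comp (measurable_powR _)).
apply/integrableP; split; first exact/measurable_EFinP.
under eq_integral => x _ do rewrite /= ger0_norm ?powR_ge0 //.
(* Starting at [2^N0 >= N0] ensures that the tail bound holds at every level. *)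
pose b k : R := (2 ^ (N0 + k))%:R.
have b0 k : 0 < b k by rewrite ltr0n expn_gt0.
have bS k : b k.+1 = 2 * b k by rewrite /b addnS expnS natrM.
pose E k := [set x | b k < f x].
have mE k : measurable (E k).
  rewrite (_ : E k = setT `&` f @^-1` `]b k, +oo[%classic).
    by apply: mf => //; exact: measurable_itv.
  by rewrite setTI; apply/seteqP; split => x /=; rewrite in_itv /= andbT.
pose g k x : \bar R := ((b k.+1 `^ p)%:E * (\1_(E k) x)%:E)%E.
have g0 k x : (0 <= g k x)%E by rewrite mule_ge0 // lee_fin ?powR_ge0.
have mg k : measurable_fun setT (g k).
  by apply: emeasurable_funM => //; apply/measurable_EFinP; exact: measurable_indic.
pose rho : R := 2 `^ (p - beta).
have rho0 : 0 < rho by rewrite powR_gt0.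
have rho1 : rho < 1.
  rewrite /rho (_ : p - beta = - (beta - p)); last by ring.
  rewrite powRN invf_lt1 ?powR_gt0 //.
  have : (1 : R) `^ (beta - p) < 2 `^ (beta - p).
    by apply: gt0_ltr_powR; rewrite ?subr_gt0 ?nnegrE ?ltr1n.
  by rewrite powR1.
pose A := 2 `^ p * `|K| * b 0 `^ (p - beta).
have A0 : 0 <= A by rewrite !mulr_ge0 ?powR_ge0.
have hg k : (\int[P]_x g k x <= (A * rho ^+ k)%:E)%E.
  have m1 : measurable_fun setT (fun x => (\1_(E k) x)%:E : \bar R).
    by apply/measurable_EFinP; exact: measurable_indic.
  have p1 : (0 <= (b k.+1 `^ p)%:E)%E by rewrite lee_fin powR_ge0.
  rewrite (ge0_integralZl P measurableT m1 _ p1) //.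
  rewrite integral_indic // setIT.
  have bE : b k = b 0 * 2 ^+ k.
    by elim: (k) => [|n IH]; rewrite ?expr0 ?mulr1 // bS IH exprS; ring.
  apply: (@le_trans _ _ ((b k.+1 `^ p)%:E * (`|K| * b k `^ (- beta))%:E)%E).
    apply: lee_wpmul2l; first by rewrite lee_fin powR_ge0.
    apply: le_trans (tail (2 ^ (N0 + k))%N _) _.
      by apply: (leq_trans (leq_addr k N0)); exact/ltnW/ltn_expl.
    by rewrite lee_fin ler_wpM2r ?powR_ge0 // ler_norm.
  rewrite -EFinM lee_fin bS powRM ?(ltW (b0 k)) // le_eqVlt; apply/orP; left; apply/eqP.
  transitivity (2 `^ p * `|K| * (b k `^ p * b k `^ (- beta))); first by ring.
  rewrite -powRD; last by apply/implyP => _; rewrite gt_eqF.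
  rewrite bE powRM ?(ltW (b0 0%N)) ?exprn_ge0 // /A -!mulrA; congr (_ * (_ * (_ * _))).
  by rewrite -(powR_mulrn k (ltW rho0)) -(powR_mulrn k (ler0n _ 2)) /rho powRAC.
have sumg : (\sum_(k <oo) \int[P]_x g k x <= (A / (1 - rho))%:E)%E.
  apply: lime_le; first by apply: is_cvg_nneseries => n _ _; exact: integral_ge0.
  near=> n; apply: (@le_trans _ _ (\sum_(0 <= k < n) (A * rho ^+ k)%:E)%E).
    by apply: lee_sum => k _; exact: hg.
  rewrite sumEFin lee_fin -mulr_sumr ler_wpM2l // big_mkord.
  have r1 : 0 < 1 - rho by rewrite subr_gt0.
  rewrite -[leRHS]mul1r ler_pdivlMr // mulrC.
  have := subrX1 rho n; have : 0 <= rho ^+ n by rewrite exprn_ge0 // ltW.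
  lra.
apply: (@le_lt_trans _ _ (\int[P]_x ((b 0%N `^ p)%:E + \sum_(k <oo) g k x))%E).
  apply: ge0_le_integral_upper => x _; first by rewrite lee_fin powR_ge0.
  have s0 : (0 <= \sum_(k <oo) g k x)%E by apply: nneseries_ge0.
  have [fb|bf] := leP (f x) (b 0%N).
    by apply: lee_paddr => //; rewrite lee_fin ler_powR2l.
  have ex : exists k, f x <= b k.
    exists (Num.bound (f x)); apply/ltW; apply: (lt_le_trans (archi_boundP (f0 x))).
    rewrite ler_nat; apply: (leq_trans (ltnW (ltn_expl _ (leqnn 2)))).
    by rewrite leq_exp2l // leq_addl.
  case: (ex_minnP ex) => -[|k] fk kmin; first by move: bf; rewrite ltNge fk.
  have kf : b k < f x by rewrite ltNge; apply/negP => /kmin; rewrite ltnn.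
  apply: (@le_trans _ _ (g k x)).
    by rewrite /g indicE mem_set // mule1 lee_fin ler_powR2l.
  apply: (@le_trans _ _ (\sum_(k <oo) g k x)%E); last by rewrite leeDr // lee_fin powR_ge0.
  apply: le_trans (@nneseries_lim_ge _ _ xpredT 0%N k.+1 _) => //.
  by rewrite big_nat_recr //= leeDr // sume_ge0.
rewrite ge0_integralD //; last 3 first.
- by move=> x _; rewrite lee_fin powR_ge0.
- by move=> x _; exact: nneseries_ge0.
- by apply: ge0_emeasurable_sum => // k x _ _; exact: g0.
rewrite integral_cst // integral_nneseries //.
apply: lte_add_pinfty; first by have := probability_setT P => /= ->; rewrite mule1 ltry.
by apply: le_lt_trans sumg _; rewrite ltry.
Unshelve. all: by end_near. Qed.

(** * Bounds for the entries of the integrals *)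

Section EntryBounds.
Context {R : realType} {dM : measure_display} {M : measurableType dM}.
Variables (T : R -> M -> M) (X Y : set M) (h : M -> R) (tau : M -> nat).
Variables (muY : {measure set M -> \bar R}).
Hypothesis hT : is_semiflow T.
Hypothesis mY : measurable Y.
Hypothesis YX : Y `<=` X.
Hypothesis hpos : forall x, X x -> 0 < h x.
Hypothesis fX : forall x, X x -> X (flowf T h x).
Local Notation H := (Hroof T h tau).

(** Domination by a function [G] of the base point along each excursion. Measurability is required
    of the weighted power of [G] only, not of [g] along the flow. *)
Definition entry_bound (q : R) (g : M -> R) (B : R) := exists G : M -> R,
  [/\ measurable_fun Y (fun y => H y * G y `^ q), forall y, Y y -> 0 <= G y,
      forall y s, Y y -> 0 <= s -> s <= H y -> `|g (T s y)| <= G y &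
      (\int[muY]_(y in Y) (H y * G y `^ q)%:E <= (B `^ q)%:E)%E].

Lemma LqM_le_entries m n (g : M -> 'M[R]_(m, n)) (q B : R) : 0 < q -> 0 <= B ->
  (forall i j, entry_bound q (fun x => g x i j) B) ->
  (LqM muY Y tau T h q g <= (((m * n)%:R * intM_scale T Y h tau muY) `^ q^-1 * B)%:E)%E.
Proof.
move=> q0 B0 hg; have [G hG] := choice (fun ij : 'I_m * 'I_n => hg ij.1 ij.2).
by apply: (@LqM_le _ _ _ T X Y h tau muY hT YX hpos fX m n g q B (fun i j => G (i, j))) => //
  [i j|i j|i j|i j]; have [h1 h2 h3 h4] := hG (i, j).
Qed.

Lemma entry_boundZ q g B K : 0 < q -> 0 <= B -> 0 <= K -> entry_bound q g B ->
  entry_bound q (fun x => K * g x) (K * B).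
Proof.
move=> q0 B0 K0 [G [mG G0 gG hB]].
have E y : Y y -> H y * (K * G y) `^ q = K `^ q * (H y * G y `^ q).
  by move=> Yy; rewrite powRM ?G0 // mulrCA.
have H0 := Hroof_ge0 tau YX hpos fX.
exists (fun y => K * G y); split.
- apply: (eq_measurable_fun (fun y => K `^ q * (H y * G y `^ q))).
    by move=> y /set_mem Yy; rewrite E.
  exact: measurable_funM.
- by move=> y Yy; rewrite mulr_ge0 // G0.
- by move=> y s Yy s0 sH; rewrite normrM ger0_norm // ler_wpM2l // gG.
- under eq_integral => y /set_mem Yy do rewrite E // EFinM.
  rewrite ge0_integralZl //; last 3 first.
  + exact/measurable_EFinP.
  + by move=> y Yy; rewrite lee_fin mulr_ge0 ?powR_ge0 // H0.
  + by rewrite lee_fin powR_ge0.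
  rewrite powRM // EFinM; apply: lee_wpmul2l => //; rewrite lee_fin; exact: powR_ge0.
Qed.

Lemma entry_bound0 q g B : 0 < q -> (forall x, g x = 0) -> entry_bound q g B.
Proof.
move=> q0 g0; exists (fun=> 0); split=> //.
- under eq_fun do rewrite powR0 ?gt_eqF // mulr0; exact: measurable_cst.
- by move=> y s _ _ _; rewrite g0 normr0.
- under eq_integral do rewrite powR0 ?gt_eqF // mulr0.
  by rewrite integral0 lee_fin powR_ge0.
Qed.

Lemma LqM_scale0 m n (g : M -> 'M[R]_(m, n)) (q : R) : 0 < q ->
  intM_scale T Y h tau muY = 0 -> LqM muY Y tau T h q g = 0%E.
Proof.
move=> q0 s0; rewrite /LqM intME s0 mule0 poweR0r //.
by rewrite invr_eq0 gt_eqF.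
Qed.

End EntryBounds.

(** * Moment bounds for the entries under the standing assumptions *)

Section Main.
Context {R : realType} {dM : measure_display} {M : measurableType dM}.
Variables (dist : M -> M -> R) (T : R -> M -> M) (X Y : set M) (h : M -> R) (tau : M -> nat).
Hypotheses (hmet : is_metric dist) (hbd : bounded_metric dist) (hborel : borel_wrt dist).
Hypothesis hT : is_semiflow T.
Hypotheses (mX : measurable X) (mY : measurable Y) (YX : Y `<=` X).
Hypotheses (hpos : forall x, X x -> 0 < h x) (hmeas : measurable_fun X h).
Hypothesis fX : forall x, X x -> X (flowf T h x).
Hypothesis taumeas : measurable_fun Y (fun y => (tau y)%:R : R).
Hypothesis FY : forall y, Y y -> Y (indF T h tau y).
Variables (mu0 : {finite_measure set M -> \bar R}) (I : set nat) (Yj : nat -> set M).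
Variables (lam C eta : R).
Hypothesis mu0Y : (0 < mu0 Y)%E.
Hypotheses (lam1 : 1 < lam) (C1 : 1 <= C) (eta0 : 0 < eta) (eta1 : eta <= 1).
Hypothesis GM : gibbs_markov dist mu0 Y (indF T h tau) tau I Yj lam C eta.
Variable muY : probability M R.
Hypothesis muYY : muY Y = 1%E.
Hypothesis muYinv : invariant_on muY Y (indF T h tau).
Hypothesis muYac : muY `<< mu0.
Variables (theta C' : R).
Hypotheses (theta0 : 0 < theta) (theta1 : theta < 1) (C'1 : 1 <= C').
Hypothesis Hreg : forall j, I j -> forall y y', Yj j y -> Yj j y' -> y <> y' ->
  `|Hroof T h tau y - Hroof T h tau y'|
    <= C' * inf [set Hroof T h tau z | z in Yj j] * dtheta theta (indF T h tau) I Yj y y'.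
Hypothesis Tsep : forall j, I j -> forall y y', Yj j y -> Yj j y' ->
  forall t : R, 0 <= t -> t <= Hroof T h tau y -> t <= Hroof T h tau y' ->
  dist (T t y) (T t y') <= C' * dtheta theta (indF T h tau) I Yj y y'.
Hypothesis Hinf : 0 < inf [set Hroof T h tau y | y in Y].
Variable C'' : R.
Hypothesis Tholder : forall (t t' : R) (x : M), 0 <= t -> 0 <= t' ->
  dist (T t x) (T t' x) <= C'' * `|t - t'| `^ eta.
Variable beta : R.
Hypothesis beta1 : 1 < beta.
Hypothesis tail : exists K : R, \forall n \near \oo,
  (muY [set y | Y y /\ (n%:R < Hroof T h tau y)%R] <= ((K * n%:R `^ (- beta))%R)%:E)%E.

Local Notation F := (indF T h tau).
Local Notation H := (Hroof T h tau).
(** The slower of two rates: [theta^eta] for Hoelder observables along two orbits of one cylinder,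
    [lam^(-eta)] for the Jacobian on cylinders. *)
Local Notation gam := (Num.max (theta `^ eta) (lam `^ (- eta))).
Local Notation Hs := (roof_min Y F H I Yj).
Local Notation D := (reg_const C').
Local Notation Ft := (extend_id Y F).
Local Notation env := (envelope Y H D).
Local Notation bound := (entry_bound T Y h tau muY).

Let dist0 x y : 0 <= dist x y.
Proof. by case: hmet. Qed.

Let TD s t x : 0 <= s -> 0 <= t -> T (s + t) x = T s (T t x).
Proof. by case: hT => _ + _; apply. Qed.

Let part : is_partition Y I Yj.
Proof. by case: GM. Qed.

Let mF A : measurable A -> measurable (Y `&` F @^-1` A).
Proof. exact: (measurable_indF hT mX mY YX hpos hmeas fX taumeas). Qed.

Let gam0 : 0 < gam.
Proof. by rewrite lt_max powR_gt0. Qed.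

Let gam1 : gam < 1.
Proof.
have l0 : 0 < lam by exact: lt_trans lam1.
have e0 := eta0; have pw (a b : R) : 0 <= a -> 0 <= b -> a < b -> a `^ eta < b `^ eta.
  by move=> a0 b0 ab; apply: gt0_ltr_powR.
have := pw _ _ (ltW theta0) ler01 theta1; have := pw _ _ ler01 (ltW l0) lam1.
rewrite !powR1 gt_max => h1 ->.
by rewrite powRN invf_lt1 ?powR_gt0.
Qed.

Let Hge0 y : Y y -> 0 <= H y.
Proof. exact: (Hroof_ge0 tau YX hpos fX). Qed.

Let D1 : 1 <= D.
Proof. by have c := C'1; rewrite /reg_const; nra. Qed.

Let C'0 : 0 <= C'. Proof. exact: le_trans C'1. Qed.

Let C'D : C' <= D.
Proof. by rewrite /reg_const lerDr mulr_ge0 // addr_ge0. Qed.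

Let Hs_cyl := roof_min_cyl H FY part.
Let Hs0 := roof_min_gt0 FY part Hge0 Hinf.
Let HsH := roof_min_le FY part Hge0.

Let HHs y : Y y -> H y <= (1 + D) * Hs y.
Proof.
move=> Yy; apply: le_trans (roof_le_min FY part theta0 theta1 C'1 Hreg Hge0 Hinf Yy) _.
by rewrite ler_wpM2r ?lerD2l ?C'D // ltW // Hs0.
Qed.

Let thetagam : theta `^ eta <= gam.
Proof. by rewrite le_max lexx. Qed.

Let Hreg' k y y' : (0 < k)%N -> cyl_eq Y F I Yj k y y' ->
  `|H y - H y'| <= D * gam ^+ k * Hs y.
Proof.
move=> k0 yy'; have [Yy _] := cyl_eq_sub part yy'.
apply: le_trans (roof_regular FY part theta0 theta1 C'1 Hreg Hge0 Hinf k0 yy') _.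
apply: ler_wpM2r; first exact/ltW/Hs0.
apply: ler_pM => //; first by rewrite exprn_ge0 // ltW.
exact: (theta_gam eta1 theta0 theta1 thetagam).
Qed.

Lemma distortion_muY : exists C0, 0 <= C0 /\ distortion_le Y F I Yj gam (msr muY) C0.
Proof.
have [B distB] := hbd.
have lamgam : lam `^ (- eta) <= gam by rewrite le_max lexx orbT.
have d0 := gibbs_markov_distortion dist0 distB mY FY mF lam1 C1 eta0 gam0 lamgam GM.
set C0 := C * B `^ eta / gam in d0.
have C00 : 0 <= C0.
  by rewrite divr_ge0 ?(ltW gam0) // mulr_ge0 ?powR_ge0 // (le_trans _ C1).
have g1 : 0 < 1 - gam by rewrite subr_gt0.
(* The fixed point of [L -> (L + C0) * gam], the change of the regularity constant under
   push-forward. *)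
pose L := C0 * gam / (1 - gam).
have L0 : 0 <= L by rewrite divr_ge0 ?(ltW g1) // mulr_ge0 // ltW.
have LC : (L + C0) * gam <= L.
  rewrite le_eqVlt; apply/orP; left; apply/eqP; rewrite /L; field.
  by rewrite gt_eqF.
have small e : 0 < e -> exists k, forall y y', cyl_eq Y F I Yj k y y' -> dist y y' < e.
  move=> e0; have l0 : 0 < lam by exact: lt_trans lam1.
  have li0 : 0 < lam^-1 by rewrite invr_gt0.
  have li1 : lam^-1 < 1 by rewrite invf_lt1.
  have [k [_ hk]] := gam_expn_small li0 li1 B e0; exists k => y y' [w [wk wy wy']].
  apply: le_lt_trans hk; rewrite exprVn ler_pdivlMr ?exprn_gt0 // mulrC -wk.
  exact: (wcyl_diam distB lam1 GM wy wy').
exists (C0 + L + L / gam); split; first by rewrite !addr_ge0 // divr_ge0 // ltW.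
exact: (distortion_invariant hborel mY FY part mF small gam0 L0 LC d0 muYac muYinv mu0Y muYY).
Qed.

Lemma integrable_env_tail p : 0 <= p -> p < beta ->
  muY.-integrable setT (EFin \o (fun y => env y `^ p)).
Proof.
move=> p0 pb; have [K [N0 _ hN]] := tail.
have D0 : 0 <= 1 + D by rewrite addr_ge0 // (le_trans _ D1).
have HY0 := HY_ge0 Hs0 HsH.
have mH := mHY mY FY part mF gam0 gam1 Hreg'.
have iH : muY.-integrable setT (EFin \o (fun y => (H \_ Y) y `^ p)).
  apply: (@powR_integrable_of_tail _ _ _ muY (H \_ Y) p beta K N0) => // n nN.
  apply: le_trans (hN n nN); rewrite le_eqVlt; apply/orP; left; apply/eqP; congr (muY _).
  apply/seteqP; split => y /=; rewrite patchE.
    by case: ifPn => [/set_mem//|_]; rewrite ltNge ler0n.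
  by move=> [Yy ny]; rewrite mem_set.
have i1 := bddm_integrable muY (bddm_cst (1 : R)).
have i2 : muY.-integrable setT
    (EFin \o (fun y => 2 `^ p * (1 + (1 + D) `^ p * (H \_ Y) y `^ p))).
  exact: (integrableZl measurableT (2 `^ p)
    (integrableD measurableT i1 (integrableZl measurableT ((1 + D) `^ p) iH))).
apply: le_integrable i2 => //.
  apply/measurable_EFinP; apply: (measurableT_comp (measurable_powR _)).
  exact: (measurable_envelope mY FY part mF gam0 gam1 Hreg').
move=> y _ /=; rewrite lee_fin !ger0_norm ?powR_ge0 //; last first.
  by rewrite mulr_ge0 ?powR_ge0 // addr_ge0 // mulr_ge0 // powR_ge0.
have h1 : 0 <= (1 + D) * (H \_ Y) y by exact: mulr_ge0.
apply: le_trans (powRD_le p0 ler01 h1) _.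
by rewrite powR1 powRM.
Qed.

Lemma observable_induced v : unit_holder dist eta v ->
  \int[muY]_(y in Y) Aint T v (H y) y = 0 ->
  induced_observable Y F I Yj gam muY H Hs D (fun y => Aint T v (H y) y).
Proof.
move=> hv v0; split => //.
- by move=> y Yy; apply: (Aint_le dist0 eta0 Tholder hv); exact: Hge0.
- move=> k y y' k0 yy'; exact: (induced_regular dist0 TD eta0 eta1 Tholder FY part
    theta0 theta1 C'1 thetagam Hreg Tsep Hge0 Hinf hv k0 yy').
Qed.

(** The vanishing integral is what [intM_observable] extracts from the zero mean on [M], with [c]
    the norm by which the observable was normalised; integrability of the roof allows [c] to be
    factored out. *)
Lemma observable_mean0 v c : unit_holder dist eta v -> c != 0 ->
  (\int[muY]_(y in Y) (c * Aint T v (H y) y)%:E = 0)%E ->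
  \int[muY]_(y in Y) Aint T v (H y) y = 0.
Proof.
move=> hv c0; have i1 := integrable_env_tail ler01 beta1.
have mV : measurable_fun Y (fun y => Aint T v (H y) y).
  apply: (measurable_regular mY FY part mF gam0 gam1 (Hs := Hs) (D := D)) => k y y' k0 yy'.
  exact: (induced_regular dist0 TD eta0 eta1 Tholder FY part
    theta0 theta1 C'1 thetagam Hreg Tsep Hge0 Hinf hv k0 yy').
have iV : muY.-integrable Y (EFin \o (fun y => Aint T v (H y) y)).
  apply: (le_integrable mY _ _ (integrableS measurableT mY (@subsetT _ _) i1)).
    exact/measurable_EFinP.
  move=> y Yy /=; have e1 := envelope1 D1 Hs0 HsH y.
  rewrite lee_fin powRr1; last exact: le_trans e1.
  rewrite [leRHS]ger0_norm; last exact: le_trans e1.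
  apply: le_trans (Aint_le dist0 eta0 Tholder hv y (Hge0 Yy)) _.
  exact: (envelope_ge_H D1 Hs0 HsH).
under eq_integral do rewrite EFinM.
rewrite (integralZl mY iV) => /eqP; rewrite mule_eq0 eqe (negPf c0) /= => /eqP E.
by rewrite /Rintegral E.
Qed.

Let Hh0 y : Y y -> inf [set H y | y in Y] <= H y.
Proof. exact: Hinf_le. Qed.

Let FtY y : Y y -> Y (Ft y).
Proof. by move=> Yy; rewrite extend_idE //; exact: FY. Qed.

Let FtE y : Y y -> Ft y = T (H y) y.
Proof. by move=> Yy; rewrite extend_idE //; exact: (indF_time tau hT YX hpos fX). Qed.

Let integral_roof (g : M -> R) :
  (\int[muY]_(y in Y) (H y * g y)%:E = \int[muY]_y ((H \_ Y) y * g y)%:E)%E.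
Proof.
rewrite integral_mkcond; apply: eq_integral => y _; rewrite !patchE.
by case: ifPn => //; rewrite mul0r.
Qed.

Let measurable_roof (g : M -> R) q : 0 <= q -> measurable_fun setT g ->
  measurable_fun Y (fun y => H y * g y `^ q).
Proof.
move=> q0 mg; apply: measurable_funM.
  exact: (measurable_regular mY FY part mF gam0 gam1 Hreg').
apply: measurable_funTS; exact: (measurableT_comp (measurable_powR _)).
Qed.

(** For [t < 1] the trivial bound on the integrals is enough; only the finite integral of the weight
    [H] is involved. *)
Let small_time_bound q c g t : 0 < q -> 0 <= t ->
  (\int[muY]_(y in Y) (H y * 1)%:E <= c%:E)%E -> 0 <= c ->
  (forall x, `|g x| <= t) -> bound q g (c `^ q^-1 * t).
Proof.
move=> q0 t0 hc c0 gt; exists (fun=> t); split => //.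
  by apply: measurable_roof; [exact: ltW|exact: measurable_cst].
under eq_integral do rewrite -[t `^ q]mul1r mulrA EFinM.
rewrite ge0_integralZr ?lee_fin ?powR_ge0 //; last 2 first.
- apply/measurable_EFinP; apply: measurable_funM => //.
  exact: (measurable_regular mY FY part mF gam0 gam1 Hreg').
- by move=> y Yy; rewrite lee_fin mulr1 Hge0.
rewrite powRM ?powR_ge0 // -powRrM mulVf ?gt_eqF // powRr1 // EFinM.
by apply: lee_wpmul2r => //; rewrite lee_fin powR_ge0.
Qed.

Let entry_bound_le q g B B' : 0 < q -> 0 <= B -> B <= B' -> bound q g B -> bound q g B'.
Proof.
move=> q0 B0 BB' [G [h1 h2 h3 h4]]; exists G; split => //; apply: le_trans h4 _.
by rewrite lee_fin; apply: ler_powR2l => //; exact: ltW.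
Qed.

Lemma integral_roof_finite : exists2 c, 0 <= c &
  (\int[muY]_(y in Y) (H y * 1)%:E <= c%:E)%E.
Proof.
have := integrable_env_tail ler01 beta1 => i1.
exists (mean muY (fun y => env y `^ 1)); first by apply: mean_ge0 => y; exact: powR_ge0.
rewrite integral_roof /mean /Rintegral fineK; last exact: integrable_fin_num i1.
apply: ge0_le_integral_upper => y _ /=; rewrite lee_fin mulr1; first exact: (HY_ge0 Hs0 HsH).
rewrite powRr1; last exact: le_trans (envelope1 D1 Hs0 HsH y).
rewrite patchE; case: ifPn => [/set_mem|_]; first exact: (envelope_ge_H D1 Hs0 HsH).
exact: le_trans (envelope1 D1 Hs0 HsH y).
Qed.

Lemma Aint_entry_bound p : 2 < p -> p < beta -> exists2 c, 0 < c & forall v,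
  unit_holder dist eta v -> \int[muY]_(y in Y) Aint T v (H y) y = 0 ->
  forall t, 0 < t -> bound (2 * (p - 1)) (Aint T v t) (c * t `^ (2^-1)).
Proof.
move=> p2 pb; set q := 2 * (p - 1).
have q0 : 0 < q by rewrite /q; lra.
have [C0 [C00 dmu]] := distortion_muY.
(* Strictly between [p] and [beta], so that the moment of order [p1] is finite, and at most
   [q = 2 * p - 2], the order of the truncated moment. *)
pose p1 := Num.min ((p + beta) / 2) (2 * p - 2).
have pp1 : p < p1 by rewrite lt_min; apply/andP; split; lra.
have p1p : p1 <= 2 * p - 2 by rewrite ge_min lexx orbT.
have p1b : p1 < beta by rewrite gt_min; apply/orP; left; lra.
have p10 : 0 <= p1 by lra.
have ip := integrable_env_tail p10 p1b.
have [K K0 hK] := first_moment mY FY part mF gam0 gam1 C00 muYY muYinv dmu D1 Hs_cyl Hs0 HsH HHs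
  Hreg' Hinf p2 pp1 p1p ip.
have [c c0 hc] := integral_roof_finite.
have Kc0 : 0 <= K + c by exact: addr_ge0 (ltW K0) c0.
have qi : 0 <= q^-1 by rewrite invr_ge0 ltW.
exists ((K + c) `^ q^-1); first by rewrite powR_gt0 // ltr_wpDr.
move=> v hv v0 t t0; have oV := observable_induced hv v0.
have Ale s x : 0 <= s -> `|Aint T v s x| <= s by move=> s0; exact: (Aint_le dist0 eta0 Tholder hv).
(* Short times: [|Aint| <= t <= t^(1/2)]. *)
have [t1|t1] := ltP t 1.
  apply: (@entry_bound_le _ _ (c `^ q^-1 * t)) => //.
  - by rewrite mulr_ge0 ?powR_ge0 // ltW.
  - apply: ler_pM; rewrite ?powR_ge0 ?(ltW t0) //.
      by apply: ler_powR2l => //; rewrite lerDr ltW.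
    rewrite -[leLHS]powRr1 ?(ltW t0) // ger_powR //; last by lra.
    by rewrite t0 ltW.
  - by apply: small_time_bound => // [|x]; [exact: ltW|exact/Ale/ltW].
have [N [tN hN]] := hK _ oV t t1.
have bG := bddm_first_bound mY FY part mF gam0 gam1 D1 Hs_cyl Hs0 HsH HHs Hreg' N oV t0.
exists (fun y => truncU Y H D t y +
  (runmax (birkhoff Ft ((fun z => Aint T v (H z) z) \_ (trunc_set Y Hs t))) N (Ft y) +
   runmax (fun k z => truncU Y H D t (iter k Ft z)) N (Ft y))); split.
- by apply: measurable_roof; [exact: ltW|exact: bG.1].
- move=> y Yy; apply: addr_ge0; last by rewrite addr_ge0 ?runmax_ge0.
  by apply: (le_trans _ (truncU1 D1 Hs0 HsH t0 y)).
- move=> y s Yy s0 sH; rewrite addrA.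
  have VtE z : Y z -> H z <= t ->
      ((fun z => Aint T v (H z) z) \_ (trunc_set Y Hs t)) z = Aint T v (H z) z.
    by move=> Yz zt; rewrite patchT //; apply: mem_set; split => //; exact: le_trans (HsH Yz) zt.
  have UH z : Y z -> Num.min (H z) t <= truncU Y H D t z by exact: (truncU_ge_H D1 Hs0 HsH t0).
  exact: (Aint_flow_le dist0 TD eta0 Tholder FtY FtE Hinf Hh0 hv hv VtE VtE
    UH t0 tN Yy s0 sH (ltW t0) (lexx t)).
rewrite integral_roof; apply: le_trans hN _; rewrite lee_fin.
rewrite powRM ?powR_ge0 // -!powRrM mulVf ?gt_eqF // powRr1 //.
rewrite (_ : 2^-1 * q = p - 1); last by rewrite /q; lra.
by rewrite ler_wpM2r ?powR_ge0 // lerDl.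
Qed.

Lemma Bint_entry_bound p : 4 < p -> p < beta -> exists2 c, 0 < c & forall v w,
  unit_holder dist eta v -> \int[muY]_(y in Y) Aint T v (H y) y = 0 ->
  unit_holder dist eta w -> \int[muY]_(y in Y) Aint T w (H y) y = 0 ->
  forall t, 0 < t -> bound (2 * (p - 1) / 3) (Bint T v w t) (c * t).
Proof.
move=> p4 pb; set q := 2 * (p - 1) / 3.
have q0 : 0 < q by rewrite /q; lra.
have [C0 [C00 dmu]] := distortion_muY.
have p0 : 0 <= p by lra.
have ip := integrable_env_tail p0 pb.
have [K K0 hK] := second_moment mY FY part mF gam0 gam1 C00 muYY muYinv dmu D1 Hs_cyl Hs0 HsH HHs
  Hreg' Hinf p4 ip.
have [c c0 hc] := integral_roof_finite.
have Kc0 : 0 <= K + c by exact: addr_ge0 (ltW K0) c0.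
have qi : 0 <= q^-1 by rewrite invr_ge0 ltW.
exists ((K + c) `^ q^-1); first by rewrite powR_gt0 // ltr_wpDr.
move=> v w hv v0 hw w0 t t0; have oV := observable_induced hv v0; have oW := observable_induced hw w0.
have Ble s x : 0 <= s -> `|Bint T v w s x| <= s * s.
  by move=> s0; exact: (Bint_le dist0 eta0 Tholder hv hw).
(* Short times: [|Bint| <= t * t <= t]. *)
have [t1|t1] := ltP t 1.
  apply: (@entry_bound_le _ _ (c `^ q^-1 * t)) => //.
  - by rewrite mulr_ge0 ?powR_ge0 // ltW.
  - by apply: ler_wpM2r; [exact: ltW|apply: ler_powR2l => //; rewrite lerDr ltW].
  - apply: small_time_bound => // [|x]; first exact: ltW.
    by apply: le_trans (Ble _ _ (ltW t0)) _; rewrite ler_piMr // ltW.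
have [N [tN hN]] := hK _ _ oV oW t t1.
have bG := bddm_second_bound mY FY part mF gam0 gam1 D1 Hs_cyl Hs0 HsH HHs Hreg' N oV oW t0.
set V := fun z => Aint T v (H z) z in oV hN bG.
set W := fun z => Aint T w (H z) z in oW hN bG.
exists (fun y => 2 * truncU Y H D t y ^+ 2 +
     (runmax (birkhoff2 Ft (V \_ (trunc_set Y Hs t)) (W \_ (trunc_set Y Hs t))) N (Ft y)
      + 4 * birkhoff Ft (fun z => truncU Y H D t z ^+ 2) N (Ft y)
      + runmax (birkhoff Ft (V \_ (trunc_set Y Hs t))) N (Ft y) ^+ 2
      + 2 * runmax (birkhoff Ft (W \_ (trunc_set Y Hs t))) N (Ft y) ^+ 2)); split.
- by apply: measurable_roof; [exact: ltW|exact: bG.1].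
- move=> y Yy.
  have Q0 : 0 <= birkhoff Ft (fun z => truncU Y H D t z ^+ 2) N (Ft y).
    by apply: sumr_ge0 => i _; exact: sqr_ge0.
  apply: addr_ge0; first by apply: mulr_ge0 => //; exact: sqr_ge0.
  apply: addr_ge0; last by apply: mulr_ge0 => //; exact: sqr_ge0.
  apply: addr_ge0; last exact: sqr_ge0.
  by apply: addr_ge0; [exact: runmax_ge0|exact: mulr_ge0].
- move=> y s Yy s0 sH; rewrite !addrA.
  have VtE z : Y z -> H z <= t -> (V \_ (trunc_set Y Hs t)) z = V z.
    by move=> Yz zt; rewrite patchT //; apply: mem_set; split => //; exact: le_trans (HsH Yz) zt.
  have WtE z : Y z -> H z <= t -> (W \_ (trunc_set Y Hs t)) z = W z.
    by move=> Yz zt; rewrite patchT //; apply: mem_set; split => //; exact: le_trans (HsH Yz) zt.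
  have UH z : Y z -> Num.min (H z) t <= truncU Y H D t z by exact: (truncU_ge_H D1 Hs0 HsH t0).
  exact: (Bint_flow_le dist0 TD eta0 Tholder FtY FtE Hinf Hh0 hv hw VtE WtE
    UH t0 tN Yy s0 sH (ltW t0) (lexx t)).
rewrite integral_roof; apply: le_trans hN _; rewrite lee_fin.
rewrite powRM ?powR_ge0 ?(ltW t0) // -powRrM mulVf ?gt_eqF // powRr1 //.
by rewrite ler_wpM2r ?powR_ge0 // lerDl.
Qed.

End Main.

Lemma observable_integral {R : realType} {M : Type} (dist : M -> M -> R) (T : R -> M -> M)
    (eta K2 K : R) (u : M -> R) t x :
  (forall x y, 0 <= dist x y) -> 0 < eta ->
  (forall (t t' : R) (x : M), 0 <= t -> 0 <= t' ->
    dist (T t x) (T t' x) <= K2 * `|t - t'| `^ eta) ->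
  unit_holder dist eta u ->
  \int[@lebesgue_measure R]_(s in `[0, t]) (K * u (T s x)) = K * Aint T u t x.
Proof.
move=> dist0 eta0 Tholder hu.
rewrite -primZ; last exact: (orbit_path_continuous dist0 eta0 Tholder hu).
by apply: eq_prim => s s0 _; rewrite /orbit_path max0_id.
Qed.

Lemma observable_integral2 {R : realType} {M : Type} (dist : M -> M -> R) (T : R -> M -> M)
    (eta K2 K : R) (u w : M -> R) t x :
  (forall x y, 0 <= dist x y) -> 0 < eta ->
  (forall (t t' : R) (x : M), 0 <= t -> 0 <= t' ->
    dist (T t x) (T t' x) <= K2 * `|t - t'| `^ eta) ->
  unit_holder dist eta u -> unit_holder dist eta w ->
  \int[@lebesgue_measure R]_(s in `[0, t])
    \int[@lebesgue_measure R]_(r in `[0, s]) (K * u (T r x) * (K * w (T s x))) =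
  K * K * Bint T u w t x.
Proof.
move=> dist0 eta0 Tholder hu hw.
rewrite -primZ; last exact: (Bint_path_continuous dist0 eta0 Tholder hu hw).
apply: eq_prim => s s0 _.
transitivity (K * w (T s x) * (K * Aint T u s x)).
  rewrite -(observable_integral K s x dist0 eta0 Tholder hu).
  rewrite -[RHS]/(K * w (T s x) * prim (fun r => K * u (T r x)) s).
  rewrite -[LHS]/(prim (fun r => K * u (T r x) * (K * w (T s x))) s).
  rewrite (@eq_prim _ (fun r => K * u (T r x) * (K * w (T s x)))
    (fun r => K * w (T s x) * (K * orbit_path T u x r))); last first.
    by move=> r r0 _; rewrite mulrC /orbit_path max0_id.
  rewrite primZ; last first.
    move=> r; apply: cvgM; [exact: cvg_cst|].
    exact: (orbit_path_continuous dist0 eta0 Tholder hu).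
  by congr (_ * _); apply: eq_prim => r r0 _; rewrite /orbit_path max0_id.
by rewrite /Apath /orbit_path max0_id //; ring.
Qed.

Theorem theorem3p6
  (R : realType) (dM : measure_display) (M : measurableType dM)
  (dist : M -> M -> R)
  (hmet : is_metric dist) (hbd : bounded_metric dist) (hborel : borel_wrt dist)
  (T : R -> M -> M) (hT : is_semiflow T)
  (X Y : set M) (mX : measurable X) (mY : measurable Y) (YX : Y `<=` X)
  (h : M -> R) (hpos : forall x, X x -> 0 < h x) (hmeas : measurable_fun X h)
  (fX : forall x, X x -> X (flowf T h x))
  (tau : M -> nat) (taupos : forall y, Y y -> (0 < tau y)%N)
  (taumeas : measurable_fun Y (fun y => (tau y)%:R : R))
  (FY : forall y, Y y -> Y (indF T h tau y))
  (mu0 : {finite_measure set M -> \bar R})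
  (mu0X : mu0 (~` X) = 0%E) (mu0Y : (0 < mu0 Y)%E)
  (nons : nonsingular_on mu0 X (flowf T h)) (erg : ergodic_on mu0 X (flowf T h))
  (tauL1 : (\int[mu0]_(y in Y) ((tau y)%:R)%:E < +oo)%E)
  (I : set nat) (Yj : nat -> set M) (lam C eta : R)
  (lam1 : 1 < lam) (C1 : 1 <= C) (eta0 : 0 < eta) (eta1 : eta <= 1)
  (GM : gibbs_markov dist mu0 Y (indF T h tau) tau I Yj lam C eta)
  (muY : probability M R) (muYY : muY Y = 1%E)
  (muYinv : invariant_on muY Y (indF T h tau))
  (muYerg : ergodic_on muY Y (indF T h tau))
  (muYac : muY `<< mu0)
  (hL1 : (intX muY Y tau (flowf T h) (fun x => (h x)%:E) < +oo)%E)
  (theta C' : R) (theta0 : 0 < theta) (theta1 : theta < 1) (C'1 : 1 <= C')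
  (Hreg : forall j, I j -> forall y y', Yj j y -> Yj j y' -> y <> y' ->
     `|Hroof T h tau y - Hroof T h tau y'|
       <= C' * inf [set Hroof T h tau z | z in Yj j]
             * dtheta theta (indF T h tau) I Yj y y')
  (Tsep : forall j, I j -> forall y y', Yj j y -> Yj j y' ->
     forall t : R, 0 <= t -> t <= Hroof T h tau y -> t <= Hroof T h tau y' ->
     dist (T t y) (T t y') <= C' * dtheta theta (indF T h tau) I Yj y y')
  (Hinf : 0 < inf [set Hroof T h tau y | y in Y])
  (C'' : R)
  (Tholder : forall (t t' : R) (x : M), 0 <= t -> 0 <= t' ->
     dist (T t x) (T t' x) <= C'' * `|t - t'| `^ eta)
  (beta : R) (beta1 : 1 < beta)
  (tail : exists K : R, \forall n \near \oo,
     (muY [set y | Y y /\ (n%:R < Hroof T h tau y)%R] <= ((K * n%:R `^ (- beta))%R)%:E)%E)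
  (d : nat) :
  (forall p : R, 2 < p -> p < beta ->
     exists Cst : R, 0 < Cst /\
       forall v : M -> 'rV[R]_d, C0eta dist eta muY Y tau T h v ->
       forall t : R, 0 < t ->
         (LqM muY Y tau T h (2 * (p - 1)) (vint T v t)
            <= (Cst * t `^ (2^-1))%:E * holder_norm dist eta v)%E)
  /\
  (forall p : R, 4 < p -> p < beta ->
     exists Cst : R, 0 < Cst /\
       forall v : M -> 'rV[R]_d, C0eta dist eta muY Y tau T h v ->
       forall t : R, 0 < t ->
         (LqM muY Y tau T h (2 * (p - 1) / 3) (Sint T v t)
            <= (Cst * t)%:E * (holder_norm dist eta v * holder_norm dist eta v))%E).
Proof.
have dist0 x y : 0 <= dist x y by case: hmet.
pose sc := intM_scale T Y h tau muY.
have sc0 : 0 <= sc by exact: (intM_scale_ge0 tau muY YX hpos fX).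
(* The entry bounds concern observables of norm at most 1, so coordinates are divided by the norm
   [K]; homogeneity of degree one in (a) and two in (b) restores it. *)
have unitK (v : M -> 'rV[R]_d) : C0eta dist eta muY Y tau T h v -> sc != 0 ->
    forall j, let K := fine (holder_norm dist eta v) in K != 0 ->
    unit_holder dist eta (fun x => v x 0 j / K) /\
    \int[muY]_(y in Y) Aint T (fun x => v x 0 j / K) (Hroof T h tau y) y = 0.
  move=> [vfin vzero] scn j K Kn.
  have K0 : 0 < K by rewrite lt0r Kn fine_ge0 // holder_norm_ge0.
  have hu := unit_holder_coord hmet vfin j K0; split => //.
  apply: (observable_mean0 hmet hT mX mY YX hpos hmeas fX taumeas FY lam1 eta0 eta1 GM
    theta0 theta1 C'1 Hreg Tsep Hinf Tholder beta1 tail hu Kn) => //.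
  have := vzero j; rewrite (_ : (fun x => (v x 0 j)%:E) =
    (fun x => (K * (v x 0 j / K))%:E)); last first.
    by apply/funext => x; rewrite mulrC divfK.
  rewrite (intM_observable tau muY hT YX hpos fX dist0 eta0 Tholder K hu) => /eqP.
  by rewrite mule_eq0 eqe (negPf scn) orbF => /eqP.
have coord0 (v : M -> 'rV[R]_d) j x : C0eta dist eta muY Y tau T h v ->
    fine (holder_norm dist eta v) = 0 -> v x 0 j = 0.
  move=> [vfin _] K0; apply/normr0_eq0/le_anti; rewrite normr_ge0 andbT -K0.
  exact: holder_norm_coord_le.
have coordE (v : M -> 'rV[R]_d) (K : R) j x : K != 0 -> v x 0 j = K * (v x 0 j / K).
  by move=> Kn; rewrite mulrC divfK.
split => p p_lb pb.
- have q0 : 0 < 2 * (p - 1) by lra.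
  have [c c0 hc] := Aint_entry_bound hmet hbd hborel hT mX mY YX hpos hmeas fX taumeas FY mu0Y
    lam1 C1 eta0 eta1 GM muYY muYinv muYac theta0 theta1 C'1 Hreg Tsep Hinf Tholder beta1 tail
    p_lb pb.
  set q := 2 * (p - 1) in q0 hc *.
  pose A := ((1 * d)%:R * sc) `^ q^-1.
  have A0 : 0 <= A by exact: powR_ge0.
  exists (A * c + 1); split; first by rewrite ltr_wpDl // mulr_ge0 // ltW.
  move=> v Cv t t0; have Hf := holder_norm_fine Cv.1.
  set K := fine (holder_norm dist eta v) in Hf.
  have K0 : 0 <= K by rewrite fine_ge0 // holder_norm_ge0.
  have tp : 0 <= t `^ 2^-1 by exact: powR_ge0.
  rewrite -Hf -EFinM.
  (* If the scale vanishes, zero mean on [M] says nothing about the induced observable, but the norm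
     to be estimated is then 0. *)
  have [s0|sn0] := eqVneq sc 0.
    rewrite (LqM_scale0 _ q0 s0) lee_fin mulr_ge0 // mulr_ge0 // addr_ge0 //.
    by rewrite mulr_ge0 // ltW.
  have cB : 0 <= c * t `^ 2^-1 by rewrite mulr_ge0 // ltW.
  apply: le_trans (LqM_le_entries hT mY YX hpos fX (B := K * (c * t `^ 2^-1)) q0 _ _) _.
  + exact: mulr_ge0.
  (* An observable of norm 0 cannot be normalised, but it vanishes identically. *)
  + move=> i j; have [Kn|Kn] := eqVneq K 0.
      apply: entry_bound0 => // x; rewrite mxE.
      under eq_Rintegral do rewrite (coord0 _ _ _ Cv Kn).
      by rewrite Rintegral_cst // mul0r.
    have [hu u0] := unitK v Cv sn0 j Kn.
    rewrite (_ : (fun x => vint T v t x i j) =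
      (fun x => K * Aint T (fun x => v x 0 j / K) t x)); last first.
      apply/funext => x; rewrite mxE -(observable_integral K t x dist0 eta0 Tholder hu).
      by apply: eq_Rintegral => s _; exact: coordE.
    by apply: (entry_boundZ mY YX hpos fX) => //; exact: hc.
  rewrite lee_fin -/A.
  rewrite (_ : A * (K * (c * t `^ 2^-1)) = A * c * t `^ 2^-1 * K); last by ring.
  by rewrite ler_wpM2r // ler_wpM2r // lerDl.
- have q0 : 0 < 2 * (p - 1) / 3 by lra.
  have [c c0 hc] := Bint_entry_bound hmet hbd hborel hT mX mY YX hpos hmeas fX taumeas FY mu0Y
    lam1 C1 eta0 eta1 GM muYY muYinv muYac theta0 theta1 C'1 Hreg Tsep Hinf Tholder beta1 tail
    p_lb pb.
  set q := 2 * (p - 1) / 3 in q0 hc *.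
  pose A := ((d * d)%:R * sc) `^ q^-1.
  have A0 : 0 <= A by exact: powR_ge0.
  exists (A * c + 1); split; first by rewrite ltr_wpDl // mulr_ge0 // ltW.
  move=> v Cv t t0; have Hf := holder_norm_fine Cv.1.
  set K := fine (holder_norm dist eta v) in Hf.
  have K0 : 0 <= K by rewrite fine_ge0 // holder_norm_ge0.
  have tp : 0 <= t by exact: ltW.
  have KK0 : 0 <= K * K by exact: mulr_ge0.
  rewrite -Hf -!EFinM.
  have [s0|sn0] := eqVneq sc 0.
    rewrite (LqM_scale0 _ q0 s0) lee_fin mulr_ge0 // mulr_ge0 // addr_ge0 //.
    by rewrite mulr_ge0 // ltW.
  have cB : 0 <= c * t by rewrite mulr_ge0 // ltW.
  apply: le_trans (LqM_le_entries hT mY YX hpos fX (B := K * K * (c * t)) q0 _ _) _.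
  + exact: mulr_ge0.
  + move=> i j; have [Kn|Kn] := eqVneq K 0.
      apply: entry_bound0 => // x; rewrite mxE.
      under eq_Rintegral => s _.
        under eq_Rintegral do rewrite (coord0 _ _ _ Cv Kn) mul0r.
        rewrite Rintegral_cst // mul0r.
        over.
      by rewrite Rintegral_cst // mul0r.
    have [hu u0] := unitK v Cv sn0 i Kn.
    have [hw w0] := unitK v Cv sn0 j Kn.
    rewrite (_ : (fun x => Sint T v t x i j) = (fun x => K * K *
      Bint T (fun x => v x 0 i / K) (fun x => v x 0 j / K) t x)); last first.
      apply/funext => x; rewrite mxE -(observable_integral2 K t x dist0 eta0 Tholder hu hw).
      apply: eq_Rintegral => s _; apply: eq_Rintegral => r _.
      by rewrite -!coordE.
    by apply: (entry_boundZ mY YX hpos fX) => //; exact: hc.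
  rewrite lee_fin -/A.
  rewrite (_ : A * (K * K * (c * t)) = A * c * t * (K * K)); last by ring.
  by rewrite ler_wpM2r // ler_wpM2r // lerDl.
Qed.
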